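(* Let $\mathcal H$ be a complex separable Hilbert space and let $A(\cdot)$ be a family of Hilbert--Schmidt operators on $\mathcal H$ that is analytic, in Hilbert--Schmidt norm, on an open neighborhood $\Omega_0\subset\mathbb C$ of $z=0$. Write $A(z)=A_0+A_1z+O(z^2)$ as $z\to0$, with $A_0,A_1\in\mathcal B_2(\mathcal H)$. Assume that $1\in\sigma_{\rm d}(A_0)$. With $P_0,Q_0,D_0,n_0,\nu_0,\widetilde A_1$ as defined in the context, one has, as $z\to0$, $$\begin{aligned}{\det}_{2,\mathcal H}(I_{\mathcal H}-A(z))&=\big[{\det}_{2,Q_0\mathcal H}(I_{Q_0\mathcal H}-Q_0A_0Q_0)+O(z)\big]\,e^{n_0}(-1)^{n_0}\,{\det}_{P_0\mathcal H}\big(P_0D_0P_0+P_0[A_1+O(z)]P_0\,z\big)\\&={\det}_{2,Q_0\mathcal H}(I_{Q_0\mathcal H}-Q_0A_0Q_0)\,e^{n_0}\,{\det}_{\mathbb C^{n_0-\nu_0}}\big(\widetilde A_1\big)\,(-z)^{n_0-\nu_0}+O\big(z^{n_0-\nu_0+1}\big).\end{aligned}$$ Here $n_0-\nu_0$ is the geometric multiplicity of the eigenvalue $1$ of $A_0$. In the special case where $1$ is a semisimple eigenvalue of $A_0$ (i.e., $D_0=0$ and $\nu_0=0$), one obtains $$\begin{aligned}{\det}_{2,\mathcal H}(I_{\mathcal H}-A(z))&={\det}_{2,Q_0\mathcal H}(I_{Q_0\mathcal H}-Q_0A_0Q_0)\,e^{n_0}\,{\det}_{P_0\mathcal H}(P_0A_1P_0)\,(-z)^{n_0}+O\big(z^{n_0+1}\big)\\&={\det}_{2,\mathcal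 H}(I_{\mathcal H}-P_0-A_0)\,e^{n_0}\,{\det}_{P_0\mathcal H}(P_0A_1P_0)\,z^{n_0}+O\big(z^{n_0+1}\big).\end{aligned}$$ In particular, if $1$ is a simple eigenvalue of $A_0$ (i.e., $n_0=1$, $D_0=0$, and $\nu_0=0$), one obtains $${\det}_{2,\mathcal H}(I_{\mathcal H}-A(z))={\det}_{2,\mathcal H}(I_{\mathcal H}-P_0-A_0)\,{\det}_{P_0\mathcal H}(P_0A_1P_0)\,z+O(z^2).$$
   Context: $\mathcal B_2(\mathcal H)$ is the Hilbert--Schmidt class and ${\det}_{2,\mathcal H}(I_{\mathcal H}-A)={\det}_{\mathcal H}\big((I_{\mathcal H}-A)\exp(A)\big)$, $A\in\mathcal B_2(\mathcal H)$, is the $2$-modified Fredholm determinant (the right-hand side being an ordinary Fredholm determinant). $\sigma_{\rm d}(T)$ is the discrete spectrum of $T$ (isolated eigenvalues of finite algebraic multiplicity). $P_0=-\frac{1}{2\pi i}\oint_{\mathcal C_0}(A_0-\zeta I_{\mathcal H})^{-1}\,d\zeta$ is the Riesz projection of $A_0$ for the eigenvalue $1$ ($\mathcal C_0$ a small counterclockwise circle centered at $1$, such that neither it nor its interior meets $\sigma(A_0)\setminus\{1\}$), $Q_0=I_{\mathcal H}-P_0$, $n_0=\dim(\operatorname{ran}P_0)$ is the algebraic multiplicity of the eigenvalue $1$, and $D_0=(A_0-I_{\mathcal H})P_0$ (so $D_0=P_0D_0P_0$ is nilpotent on $P_0\mathcal H$). Operators such as $Q_0A_0Q_0$ and $P_0A_1P_0$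 are regarded as operators on $Q_0\mathcal H=\operatorname{ran}Q_0$ and $P_0\mathcal H=\operatorname{ran}P_0$, respectively; ${\det}_{P_0\mathcal H}$ is the ordinary determinant on the $n_0$-dimensional space $P_0\mathcal H$. Let $S\colon P_0\mathcal H\to\mathbb C^{n_0}$ be a boundedly invertible linear operator such that $SP_0D_0P_0S^{-1}$ is in Jordan canonical form (zeros on the main diagonal, entries $0$ or $1$ directly above it, all other entries $0$). $\nu_0$ is the number of entries $1$ in this matrix, $0\le\nu_0\le n_0-1$. $\widetilde A_1$ is the $(n_0-\nu_0)\times(n_0-\nu_0)$ matrix obtained from the $n_0\times n_0$ matrix $SP_0A_1P_0S^{-1}$ by striking the $\nu_0$ columns and rows in which $SP_0D_0P_0S^{-1}$ contains an entry $1$ (i.e., if there is a $1$ at position $(i,i+1)$, row $i$ and column $i+1$ are struck). Inside the determinant over $P_0\mathcal H$, $O(z)$ denotes an operator-valued term whose norm is $O(|z|)$ as $z\to0$.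
   Formalization: In the formulas with det_{2,H}(I-P_0-A_0), the printed constants are false (H=C, A(z)=1+z): in the semisimple case the factor e^{n_0} is corrected to e^{-n_0}, and in the simple case a missing factor e^{-1} is inserted. *)

(* Defs.v *)
From HB Require Import structures.
From mathcomp Require Import all_boot all_order all_algebra.
From mathcomp Require Import complex.
From mathcomp Require Import all_classical all_reals all_analysis.

Set Implicit Arguments.
Unset Strict Implicit.
Unset Printing Implicit Defensive.

Import Order.TTheory GRing.Theory Num.Theory Num.Def.
Import numFieldNormedType.Exports.

Local Open Scope classical_set_scope.
Local Open Scope ring_scope.
Local Open Scope complex_scope.

Section HilbertSpace.
Variables (R : realType) (V : completeNormedModType R[i]).
(* The inner product, linear in its first argument. *)
Variable dot : {dot V for conjC}.

Definition is_hilbert := forall x : V, `|x| ^+ 2 = dot x x.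

Definition separable := exists2 D : set V, countable D & dense D.

Definition bounded_op (T : V -> V) := linear T /\ continuous T.

(* Orthonormal basis of a closed subspace [M], indexed by [nat] and padded with
   zero vectors, so that finite-dimensional [M] (even [M = 0]) are covered. *)
Definition onb (M : set V) (e : nat -> V) :=
  [/\ forall i, M (e i),
      forall i, e i = 0 \/ `|e i| = 1,
      forall i j, i != j -> dot (e i) (e j) = 0 &
      forall x, M x -> series (fun i => dot x (e i) *: e i) @ \oo --> x].

(* The square of the Hilbert-Schmidt norm (independent of the basis). *)
Definition hs_norm2 (T : V -> V) : \bar R :=
  (\sum_(0 <= k <oo) (complex.Re `|T (get (onb setT) k)| ^+ 2)%:E)%E.

Definition hilbert_schmidt (T : V -> V) :=
  bounded_op T /\ (hs_norm2 T < +oo)%E.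

(* Only meaningful when hilbert_schmidt T holds, since fine +oo = 0. *)
Definition hs_norm (T : V -> V) : R := Num.sqrt (fine (hs_norm2 T)).

(* Local expansion in power series converging in Hilbert-Schmidt norm. *)
Definition hs_analytic (Omega : set R[i]^o) (A : R[i]^o -> V -> V) :=
  (forall z, Omega z -> hilbert_schmidt (A z)) /\
  forall z0, Omega z0 -> exists (a : nat -> V -> V) (rho : R),
    [/\ forall k, hilbert_schmidt (a k), 0 < rho &
        forall z : R[i]^o, `|z - z0| < rho%:C ->
          hs_norm (fun x => A z x - \sum_(k < n) (z - z0) ^+ k *: a k x)
            @[n --> \oo] --> (0 : R)].

Definition op_exp (T : V -> V) (x : V) : V :=
  lim (series (fun k => (k`!%:R : R[i])^-1 *: iter k T x) @ \oo).

(* det_M (I + K), for a trace class operator K on the closed subspace M (which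
   inherits the inner product of V): the limit of the determinants of the
   compressions of I + K to span(e_0, ..., e_(n-1)); for trace class K it does
   not depend on the orthonormal basis.  Padding vectors e_i = 0 contribute
   rows and columns of the identity matrix. *)
Definition fredholm_det (M : set V) (K : V -> V) : R[i]^o :=
  let e := get (onb M) in
  lim ((\det (\matrix_(i < n, j < n)
          ((i == j)%:R + dot (K (e j)) (e i))) : R[i]^o) @[n --> \oo]).

(* det_{2,M} (I - A) = det_M ((I - A) exp A), for A mapping M into M; for A
   Hilbert-Schmidt, (I - A) exp A - I is trace class. *)
Definition det2 (M : set V) (A : V -> V) : R[i]^o :=
  fredholm_det M (fun x => op_exp A x - A (op_exp A x) - x).

Definition is_resolvent (T : V -> V) (z : R[i]) (B : V -> V) :=
  [/\ bounded_op B, forall x, B (T x - z *: x) = x &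
      forall x, T (B x) - z *: B x = x].

Definition spectrum (T : V -> V) : set R[i] :=
  [set z | ~ exists B, is_resolvent T z B].

(* (T - z)^-1 *)
Definition resolvent (T : V -> V) (z : R[i]) : V -> V := get (is_resolvent T z).

Definition cintegral (a b : R) (g : R -> R[i]) : R[i] :=
  (\int[lebesgue_measure]_(t in `[a, b]) complex.Re (g t)) +i*
  (\int[lebesgue_measure]_(t in `[a, b]) complex.Im (g t)).

(* The integral of f over the counterclockwise circle of centre c, radius r. *)
Definition circle_integral (f : R[i] -> R[i]) (c : R[i]) (r : R) : R[i] :=
  cintegral 0 (2 * pi) (fun t =>
    let w := r%:C * (cos t +i* sin t) in f (c + w) * ('i * w)).

Definition isolating_radius (T : V -> V) (lam : R[i]) (r : R) :=
  0 < r /\ forall z, spectrum T z -> `|z - lam| <= r%:C -> z = lam.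

(* P is the Riesz projection - 1/(2 pi i) \oint (T - zeta)^-1 dzeta; the
   operator-valued integral is determined by its matrix elements. *)
Definition riesz_projection (T : V -> V) (lam : R[i]) (r : R) (P : V -> V) :=
  forall x y, dot (P x) y =
    - (2 * pi%:C * 'i)^-1 *
    circle_integral (fun zeta => dot (resolvent T zeta x) y) lam r.

Definition lincomb n (b : 'I_n -> V) (c : 'cV[R[i]]_n) : V :=
  \sum_i c i 0 *: b i.

Definition is_basis (M : set V) n (b : 'I_n -> V) :=
  set_bij [set: 'cV[R[i]]_n] M (lincomb b).

Definition has_dim (M : set V) (n : nat) := exists b : 'I_n -> V, is_basis M b.

Definition discrete_spectrum (T : V -> V) : set R[i] :=
  [set lam | (exists2 x, x != 0 & T x = lam *: x) /\
    exists (r : R) (P : V -> V) (n : nat),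
      [/\ isolating_radius T lam r, riesz_projection T lam r P &
          has_dim (range P) n]].

(* The determinant of T on the n-dimensional subspace M (with T M <= M): that
   of the matrix of T in any basis of M. *)
Definition det_fin (n : nat) (M : set V) (T : V -> V) : R[i]^o :=
  get [set d : R[i]^o | exists (b : 'I_n -> V) (X : 'M[R[i]]_n),
    [/\ is_basis M b, forall j, T (b j) = \sum_i X i j *: b i & d = \det X]].

(* For T mapping M into M: S T S^-1 is given by the matrix X. *)
Definition has_matrix n (M : set V) (S : V -> 'cV[R[i]]_n) (T : V -> V)
    (X : 'M[R[i]]_n) :=
  forall x, M x -> S (T x) = X *m S x.

(* The operator-valued function B is O(|z|) in operator norm as z -> 0. *)
Definition op_bigO (B : R[i]^o -> V -> V) :=
  exists c : R, \forall z \near (0 : R[i]^o),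
    forall x, `|B z x| <= c%:C * `|z| * `|x|.

End HilbertSpace.

Section NilpotentJordan.
Variables (K : fieldType) (n : nat).
Implicit Types J X : 'M[K]_n.

Definition nilpotent_jordan J := forall i j : 'I_n,
  if j == i.+1 :> nat then (J i j == 0) || (J i j == 1) else J i j == 0.

Definition nu J := #|[pred p : 'I_n * 'I_n | J p.1 p.2 == 1]|.

Definition kept_rows J := [seq i <- enum 'I_n | ~~ [exists j, J i j == 1]].
Definition kept_cols J := [seq j <- enum 'I_n | ~~ [exists i, J i j == 1]].

(* X with the rows and columns in which J has an entry 1 struck out.  When J
   is in nilpotent Jordan form both lists have size n - nu J, so that the
   default value 0 is never used. *)
Definition struck J X : 'M[K]_(n - nu J) :=
  \matrix_(k, l)
    if (onth (kept_rows J) k, onth (kept_cols J) l) is (Some i, Some j)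
    then X i j else 0.

End NilpotentJordan.

(* Main.v *)
(** The function det (1 - X) exp (tr X) is Lipschitz in the Frobenius norm on bounded
    sets, uniformly in the size of the matrix X; hence det_2 is a limit over
    finite sections, is Lipschitz in the Hilbert-Schmidt norm, and may be computed in
    any frame equivalent to an orthonormal basis.  Take a basis of ran P0 followed by
    an orthonormal basis of ran Q0.  For small z the equation
    W(z) = Q0 A(z) (P0 + W(z)) has a solution W(z) = O(z) from ran P0 to ran Q0, and
    column operations with it make I - A(z) block triangular: det_2 becomes
    det_{2,Q0 H}(I - Q0 A(z) Q0) times the exponential of the trace of P0 A(z) P0
    times the determinant of P0 (I - A(z)) (P0 + W(z)), which is
    - (D0 + z P0 (A1 + O(z)) P0).  The trace is n0 + O(z), as D0 has no nonzero
    eigenvalue.  In a Jordan basis of D0 one factors z out of each of the n0 - nu0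
    rows without an entry 1; at z = 0 the remaining determinant is expanded along
    the rows with an entry 1. *)

Require Import Defs.
From HB Require Import structures.
From mathcomp Require Import all_boot all_order all_algebra.
From mathcomp Require Import complex ring lra zify.
From mathcomp Require Import all_classical all_reals all_analysis.
Set Implicit Arguments.
Unset Strict Implicit.
Unset Printing Implicit Defensive.
Import Order.TTheory GRing.Theory Num.Theory Num.Def.
Import numFieldNormedType.Exports.
Local Open Scope classical_set_scope.
Local Open Scope ring_scope.
Local Open Scope complex_scope.

(** The Fredholm determinant behind [det2] is that of [(I - A) exp A], and cutting to finitely many
    basis vectors does not commute with powers of [A]. The remedy is
    [(1 - X) p_m(X) = 1 + X g_m(X)], with [p_m] the truncated exponential and [g_m] free of a
    constant term: both [X] and [g_m(X)] have Frobenius norms bounded independently of the size, and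
    [det (1 + X Y)] is Lipschitz in the two factors. Trace norms never enter. The projection [P0] is
    known only through matrix elements of a contour integral. The integral is replaced by
    trapezoidal sums at equally spaced nodes, which by orthogonality of roots of unity are exactly
    [(I - B ^ n)^-1] with [B = (A0 - 1) / r]. Idempotence and the absence of further eigenvalues on
    [ran P0] follow from algebra on these sums and a limit. The same nodes give an approximate
    inverse of [A0 - 1] on [ran Q0]; its error is absorbed by the Neumann series that treats the
    perturbation. *)

(** * Real-valued norms on complex spaces *)

Section RealNorm.
Variable R : realType.
Implicit Types V : normedZmodType R[i].

(** Norms over [R[i]] are complex numbers that happen to be real; the real copy gives access to
    [lra], [nra] and limits in [R]. *)
Definition nm V (x : V) : R := complex.Re `|x|.

Lemma nmE V (x : V) : (nm x)%:C = `|x|.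
Proof. by rewrite /nm RRe_real // ger0_real. Qed.

Lemma nm_ge0 V (x : V) : 0 <= nm x.
Proof. by rewrite -ler0c nmE. Qed.

Lemma nm_le V (x : V) (c : R) : (`|x| <= c%:C) = (nm x <= c).
Proof. by rewrite -nmE lecR. Qed.

Lemma nm_lt V (x : V) (c : R) : (`|x| < c%:C) = (nm x < c).
Proof. by rewrite -nmE ltcR. Qed.

Lemma nm0 V : nm (0 : V) = 0.
Proof. by apply: complexI; rewrite nmE normr0. Qed.

Lemma nm_eq0 V (x : V) : (nm x == 0) = (x == 0).
Proof. by rewrite -[x == 0]normr_eq0 -nmE -(inj_eq (@complexI R)). Qed.

Lemma nm_gt0 V (x : V) : (0 < nm x) = (x != 0).
Proof. by rewrite lt_def nm_eq0 nm_ge0 andbT. Qed.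

Lemma nmN V (x : V) : nm (- x) = nm x.
Proof. by rewrite /nm normrN. Qed.

Lemma nmD V (x y : V) : nm (x + y) <= nm x + nm y.
Proof. by rewrite -lecR nmE rmorphD /= !nmE ler_normD. Qed.

Lemma nmB V (x y : V) : nm (x - y) <= nm x + nm y.
Proof. by rewrite -(nmN y) nmD. Qed.

Lemma nmBC V (x y : V) : nm (x - y) = nm (y - x).
Proof. by rewrite -nmN opprB. Qed.

Lemma nm_sum V I (r : seq I) (P : pred I) (F : I -> V) :
  nm (\sum_(i <- r | P i) F i) <= \sum_(i <- r | P i) nm (F i).
Proof.
elim/big_ind2: _ => [|x a y b hx hy|//]; first by rewrite nm0.
exact: le_trans (nmD _ _) (lerD hx hy).
Qed.

Lemma nmM (x y : R[i]) : nm (x * y) = nm x * nm y.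
Proof. by apply: complexI; rewrite rmorphM /= !nmE normrM. Qed.

Lemma nmX (x : R[i]) n : nm (x ^+ n) = nm x ^+ n.
Proof. by apply: complexI; rewrite rmorphXn /= !nmE normrX. Qed.

Lemma nmV (x : R[i]) : nm x^-1 = (nm x)^-1.
Proof. by apply: complexI; rewrite fmorphV /= !nmE normfV. Qed.

Lemma nm1 : nm (1 : R[i]) = 1.
Proof. by apply: complexI; rewrite nmE normr1. Qed.

Lemma nm_real (x : R) : nm x%:C = `|x|.
Proof.
apply: complexI; rewrite nmE; have := normc_def x%:C => -> /=.
by rewrite expr0n addr0 sqrtr_sqr.
Qed.

Lemma nm_nat n : nm (n%:R : R[i]) = n%:R.
Proof. by rewrite -[n%:R](@rmorph_nat _ _ (real_complex R)) nm_real normr_nat. Qed.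

Lemma nmZ (V : normedModType R[i]) (a : R[i]) (x : V) : nm (a *: x) = nm a * nm x.
Proof. by apply: complexI; rewrite rmorphM /= !nmE normrZ. Qed.

Lemma nm_prod I (r : seq I) (P : pred I) (F : I -> R[i]) :
  nm (\prod_(i <- r | P i) F i) = \prod_(i <- r | P i) nm (F i).
Proof. by elim/big_ind2: _ => [|x a y b <- <-|//]; rewrite ?nm1 ?nmM. Qed.

Lemma nm_sqr (x : R[i]) : nm x ^+ 2 = complex.Re x ^+ 2 + complex.Im x ^+ 2.
Proof. by apply: complexI; rewrite rmorphXn /= nmE -add_Re2_Im2. Qed.

Lemma nm_conj (x : R[i]) : nm (x^*)%C = nm x.
Proof. by rewrite /nm normcJ. Qed.

Lemma nm_Re (x : R[i]) : `|complex.Re x| <= nm x.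
Proof. by rewrite -lecR nmE normc_ge_Re. Qed.

Lemma nm_Im (x : R[i]) : `|complex.Im x| <= nm x.
Proof.
by rewrite -(@ler_pXn2r _ 2) ?nnegrE ?nm_ge0 // real_normK ?num_real // nm_sqr lerDr sqr_ge0.
Qed.

Lemma nm_ReIm (x : R[i]) : nm x <= `|complex.Re x| + `|complex.Im x|.
Proof.
rewrite {1}[x]complexE (le_trans (nmD _ _)) // nmM !nm_real.
suff -> : nm ('i%C : R[i]) = 1 by rewrite mul1r.
apply/eqP; rewrite -(@eqrXn2 _ 2) ?nm_ge0 // expr1n nm_sqr /=.
by rewrite expr0n add0r expr1n.
Qed.

Lemma nm_conjM (x : R[i]) : x * (x^*)%C = (nm x ^+ 2)%:C.
Proof. by rewrite rmorphXn /= nmE sqr_normc. Qed.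

Lemma real_conj (x : R[i]) : conjC x = (x^*)%C.
Proof. by []. Qed.

End RealNorm.

(** * Finite Cauchy-Schwarz and Minkowski inequalities *)

Section L2.
Variables (R : realType) (I : finType).
Implicit Types u v : I -> R.

Definition l2 u : R := Num.sqrt (\sum_i u i ^+ 2).

Lemma l2_ge0 u : 0 <= l2 u. Proof. exact: sqrtr_ge0. Qed.

Lemma l2_sqr u : l2 u ^+ 2 = \sum_i u i ^+ 2.
Proof. by rewrite sqr_sqrtr // sumr_ge0 // => i _; rewrite sqr_ge0. Qed.

Lemma l2_le u (c : R) : 0 <= c -> (l2 u <= c) = (\sum_i u i ^+ 2 <= c ^+ 2).
Proof. by move=> c0; rewrite -l2_sqr ler_pXn2r ?nnegrE ?l2_ge0. Qed.

(** Lagrange's identity: the gap between the two sides is half the double sum of the squares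
    [(u i * v j - u j * v i) ^+ 2]. *)
Lemma cauchy_schwarz_sum u v :
  (\sum_i u i * v i) ^+ 2 <= (\sum_i u i ^+ 2) * (\sum_i v i ^+ 2).
Proof.
have h : 0 <= \sum_i \sum_j (u i * v j - u j * v i) ^+ 2.
  by apply: sumr_ge0 => i _; apply: sumr_ge0 => j _; exact: sqr_ge0.
set a := \sum_i u i * v i; set b := \sum_i u i ^+ 2; set c := \sum_i v i ^+ 2.
suff e : \sum_i \sum_j (u i * v j - u j * v i) ^+ 2 = (b * c - a ^+ 2) *+ 2.
  by move: h; rewrite e pmulrn_lge0 // subr_ge0.
have -> : \sum_i \sum_j (u i * v j - u j * v i) ^+ 2 =
   \sum_i (u i ^+ 2 * c - (u i * v i * a) *+ 2 + v i ^+ 2 * b).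
  apply: eq_bigr => i _; rewrite /a /b /c !mulr_sumr -sumrMnl -sumrB -big_split /=.
  by apply: eq_bigr => j _; ring.
rewrite big_split sumrB /= sumrMnl -!mulr_suml -/a -/b -/c; ring.
Qed.

Lemma l2_CS u v : \sum_i u i * v i <= l2 u * l2 v.
Proof.
apply: le_trans (ler_norm _) _.
rewrite -(@ler_pXn2r _ 2) ?nnegrE ?mulr_ge0 ?l2_ge0 //.
by rewrite real_normK ?num_real // exprMn !l2_sqr cauchy_schwarz_sum.
Qed.

Lemma l2_triangle u v w : (forall i, 0 <= w i <= u i + v i) -> l2 w <= l2 u + l2 v.
Proof.
move=> h; rewrite l2_le ?addr_ge0 ?l2_ge0 // sqrrD !l2_sqr.
apply: (@le_trans _ _ (\sum_i (u i + v i) ^+ 2)).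
  apply: ler_sum => i _; have /andP[w0 wl] := h i.
  by rewrite ler_pXn2r ?nnegrE // (le_trans w0).
under eq_bigr do rewrite sqrrD.
rewrite !big_split /= lerD2r lerD2l.
by rewrite mulr2n lerD ?l2_CS.
Qed.

End L2.
(** * Frobenius norm and Schur form *)

Section Frobenius.
Variable R : realType.
Local Notation C := R[i].
Local Notation adj M := (map_mx conjC M^T).

Definition fro m n (X : 'M[C]_(m, n)) : R :=
  l2 (fun p : 'I_m * 'I_n => nm (X p.1 p.2)).

Lemma fro_ge0 m n (X : 'M[C]_(m, n)) : 0 <= fro X. Proof. exact: l2_ge0. Qed.

Lemma fro_sqr m n (X : 'M[C]_(m, n)) :
  fro X ^+ 2 = \sum_i \sum_j nm (X i j) ^+ 2.
Proof. by rewrite l2_sqr pair_bigA. Qed.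

Lemma fro_le m n (X : 'M[C]_(m, n)) (c : R) : 0 <= c ->
  (fro X <= c) = (\sum_i \sum_j nm (X i j) ^+ 2 <= c ^+ 2).
Proof. by move=> c0; rewrite -fro_sqr ler_pXn2r ?nnegrE ?fro_ge0. Qed.

Lemma froD m n (X Y : 'M[C]_(m, n)) : fro (X + Y) <= fro X + fro Y.
Proof. by apply: l2_triangle => -[i j] /=; rewrite nm_ge0 mxE nmD. Qed.

Lemma froN m n (X : 'M[C]_(m, n)) : fro (- X) = fro X.
Proof. by rewrite /fro /l2; under eq_bigr do rewrite mxE nmN. Qed.

Lemma fro0 m n : fro (0 : 'M[C]_(m, n)) = 0.
Proof.
by rewrite /fro /l2 big1 ?sqrtr0 // => i _; rewrite mxE nm0 expr0n.
Qed.

Lemma froZ m n (a : C) (X : 'M[C]_(m, n)) : fro (a *: X) = nm a * fro X.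
Proof.
rewrite /fro /l2; under eq_bigr do rewrite mxE nmM exprMn.
by rewrite -mulr_sumr sqrtrM ?sqr_ge0 // sqrtr_sqr ger0_norm ?nm_ge0.
Qed.

Lemma fro_sum m n I (r : seq I) (P : pred I) (F : I -> 'M[C]_(m, n)) :
  fro (\sum_(i <- r | P i) F i) <= \sum_(i <- r | P i) fro (F i).
Proof.
elim/big_ind2: _ => [|x a y b hx hy|//]; first by rewrite fro0.
exact: le_trans (froD _ _) (lerD hx hy).
Qed.

Lemma fro_entry m n (X : 'M[C]_(m, n)) i j : nm (X i j) <= fro X.
Proof.
rewrite -(@ler_pXn2r _ 2) ?nnegrE ?nm_ge0 ?fro_ge0 // fro_sqr.
rewrite (bigD1 i) //= (bigD1 j) //= -addrA lerDl.
by rewrite addr_ge0 ?sumr_ge0 // => k _; rewrite ?sumr_ge0 ?sqr_ge0 // => l _; rewrite sqr_ge0.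
Qed.

Lemma froM m n p (X : 'M[C]_(m, n)) (Y : 'M[C]_(n, p)) :
  fro (X *m Y) <= fro X * fro Y.
Proof.
rewrite fro_le ?mulr_ge0 ?fro_ge0 // exprMn !fro_sqr.
have h i j : nm ((X *m Y) i j) ^+ 2 <=
    (\sum_k nm (X i k) ^+ 2) * (\sum_k nm (Y k j) ^+ 2).
  rewrite mxE; apply: le_trans (cauchy_schwarz_sum _ _).
  rewrite ler_pXn2r ?nnegrE ?nm_ge0 ?sumr_ge0 // => [|k _]; last by rewrite mulr_ge0 ?nm_ge0.
  by apply: le_trans (nm_sum _ _ _) _; apply: ler_sum => k _; rewrite nmM.
rewrite [X in _ <= _ * X]exchange_big /= mulr_suml; apply: ler_sum => i _.
by rewrite mulr_sumr; apply: ler_sum => j _; exact: h.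
Qed.

Lemma fro_trace m n (X : 'M[C]_(m, n)) : (fro X ^+ 2)%:C = \tr (X *m adj X).
Proof.
rewrite fro_sqr rmorph_sum /=; apply: eq_bigr => i _; rewrite mxE rmorph_sum /=.
by apply: eq_bigr => j _; rewrite !mxE real_conj nm_conjM.
Qed.

Lemma fro_block m1 m2 n1 n2 (X : 'M[C]_(m1, n1)) (Y : 'M[C]_(m1, n2))
   (Z : 'M[C]_(m2, n1)) (W : 'M[C]_(m2, n2)) :
  fro (block_mx X Y Z W) ^+ 2 =
  fro X ^+ 2 + fro Y ^+ 2 + (fro Z ^+ 2 + fro W ^+ 2).
Proof.
rewrite !fro_sqr big_split_ord /= -!big_split /=; congr (_ + _).
  apply: eq_bigr => i _; rewrite big_split_ord /=.
  by congr (_ + _); apply: eq_bigr => j _; rewrite ?block_mxEul ?block_mxEur.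
apply: eq_bigr => i _; rewrite big_split_ord /=.
by congr (_ + _); apply: eq_bigr => j _; rewrite ?block_mxEdl ?block_mxEdr.
Qed.

(** Unitary conjugation preserves the Frobenius norm because [fro T ^+ 2] is the trace of [T] times
    its adjoint. *)
Lemma schur_form n (Z : 'M[C]_n) : exists P T : 'M[C]_n,
  [/\ P *m adj P = 1%:M, is_trig_mx T, T = P *m Z *m adj P & fro T = fro Z].
Proof.
case: n Z => [|n] Z.
  (* [Schur] asks for a positive size, so the empty matrix is treated apart. *)
  have fl (X Y : 'M[C]_0) : X = Y by rewrite [X]flatmx0 [Y]flatmx0.
  exists 0, 0; split; [exact: fl | by apply/is_trig_mxP; case | exact: fl |].
  by congr fro; exact: fl.
have [P Pu PT] := Schur Z (ltn0Sn n).
have PP := unitarymxP Pu.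
have PP' : adj P *m P = 1%:M by apply: mulmx1C.
have aK m p (X : 'M[C]_(m, p)) : adj (adj X) = X.
  by apply/matrixP => i j; rewrite !mxE conjCK.
exists P, (P *m Z *m adj P); split; [exact: PP | by rewrite -conjymx | by [] |].
apply/eqP; rewrite -(@eqrXn2 _ 2) ?fro_ge0 // -(inj_eq (@complexI R)) !fro_trace.
rewrite !(trmx_mul, map_mxM) /= aK !mulmxA -(mulmxA (P *m Z) (adj P) P) PP' mulmx1.
by rewrite mxtrace_mulC !mulmxA PP' mul1mx.
Qed.

(** In triangular form the determinant is the product of the [1 + t_i], and [|1 + t|^2 = 1 + 2 Re t
    + |t|^2 <= exp (2 Re t + |t|^2)]. The real parts add up to the trace, which is 0, so the bound
    does not see the size [n]. *)
Lemma nm_det1D n (Z : 'M[C]_n) : \tr Z = 0 ->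
  nm (\det (1%:M + Z)) <= expR (fro Z ^+ 2 / 2).
Proof.
have [P [T [PP Ttrig TE fT]]] := schur_form Z.
have PP' : adj P *m P = 1%:M by apply: mulmx1C.
have trT : \tr T = \tr Z by rewrite TE mxtrace_mulC mulmxA PP' mul1mx.
have dT : \det (1%:M + Z) = \det (1%:M + T).
  have -> : 1%:M + T = P *m (1%:M + Z) *m adj P.
    by rewrite mulmxDr mulmx1 mulmxDl PP TE.
  by rewrite !det_mulmx mulrC mulrA -det_mulmx PP' det1 mul1r.
rewrite -trT dT -fT det_trig; last first.
  apply/is_trig_mxP => i j lij; rewrite !mxE (is_trig_mxP Ttrig) // addr0.
  by rewrite -val_eqE (ltn_eqF lij).
move=> tr0; rewrite nm_prod.
rewrite -(@ler_pXn2r _ 2) ?nnegrE ?expR_ge0 ?prodr_ge0 //; last by move=> i _; exact: nm_ge0.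
rewrite -expRM_natr divfK ?pnatr_eq0 // -prodrXl.
have Re0 : \sum_i complex.Re (T i i) = 0.
  have := congr1 (@complex.Re R) tr0.
  have ReS : {morph (@complex.Re R) : x y / x + y} by move=> [a b] [c d].
  by rewrite /mxtrace (big_morph _ ReS (erefl : complex.Re 0 = 0)).
have -> : fro T ^+ 2 = \sum_i complex.Re (T i i) * 2 + fro T ^+ 2.
  by rewrite -mulr_suml Re0 mul0r add0r.
apply: (@le_trans _ _ (expR (\sum_i (complex.Re (T i i) * 2 + nm (T i i) ^+ 2)))).
  rewrite expR_sum; apply: ler_prod => i _; rewrite sqr_ge0 /=.
  apply: le_trans (expR_ge1Dx _); rewrite !mxE eqxx mulr1n !nm_sqr /=.
  by case: (T i i) => a b /=; rewrite add0r; lra.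
rewrite ler_expR big_split /= lerD2l fro_sqr; apply: ler_sum => i _.
by rewrite (bigD1 i) //= lerDl sumr_ge0 // => j _; rewrite sqr_ge0.
Qed.

End Frobenius.
(** * Cauchy estimates and Lipschitz bounds for determinants *)

Section RootsOfUnity.
Variable R : realType.
Local Notation C := R[i].

Definition cis (t : R) : C := cos t +i* sin t.

Lemma cisD s t : cis (s + t) = cis s * cis t.
Proof. by rewrite /cis cosD sinD; apply/eqP; rewrite eq_complex /= addrC eqxx /= addrC mulrC [_ * cos _]mulrC. Qed.

Lemma cis0 : cis 0 = 1. Proof. by rewrite /cis cos0 sin0. Qed.

Lemma cisX t n : cis t ^+ n = cis (t * n%:R).
Proof.
elim: n => [|n IH]; first by rewrite mulr0 cis0.
by rewrite exprS IH -cisD -natr1 mulrDr mulr1 addrC.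
Qed.

Lemma nm_cis t : nm (cis t) = 1.
Proof.
apply/eqP; rewrite -(@eqrXn2 _ 2) ?nm_ge0 // expr1n nm_sqr /=.
by rewrite cos2Dsin2.
Qed.

Lemma cisN t : cis (- t) = (cis t)^-1.
Proof.
have u : cis t != 0 by rewrite -nm_eq0 nm_cis oner_eq0.
by apply: (mulfI u); rewrite -cisD subrr cis0 divff.
Qed.

Lemma cis_2pi : cis (2 * pi) = 1.
Proof. by rewrite /cis mulr_natl cos2pi sin2pi. Qed.

Lemma cis_2pin n : cis (2 * pi * n%:R) = 1.
Proof. by rewrite -cisX cis_2pi expr1n. Qed.

Lemma cis_neq1 t : 0 < t < 2 * pi -> cis t != 1.
Proof.
move=> /andP[t0 t1]; apply/eqP => /(congr1 (@complex.Re R)) /=.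
have s0 : 0 < sin (t / 2) by apply: sin_gt0_pi; rewrite divr_gt0 //= ltr_pdivrMr // mulrC.
have -> : t = t / 2 + t / 2 by rewrite -splitr.
rewrite cosD; have := cos2Dsin2 (t / 2); nra.
Qed.

Lemma cis_frac_neq1 (N k : nat) : (0 < k < N)%N -> cis (2 * pi / N%:R * k%:R) != 1.
Proof.
move=> /andP[k0 kN]; have N0 : (0 < N)%N by apply: leq_trans kN.
have N0' : 0 < N%:R :> R by rewrite ltr0n.
apply: cis_neq1; rewrite mulr_gt0 ?divr_gt0 ?mulr_gt0 ?pi_gt0 ?ltr0n //=.
by rewrite mulrAC ltr_pdivrMr // ltr_pM2l ?mulr_gt0 ?pi_gt0 // ltr_nat.
Qed.

Lemma sum_roots (N : nat) (u : C) : u != 1 -> u ^+ N = 1 -> \sum_(k < N) u ^+ k = 0.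
Proof.
move=> u1 uN; have := subrX1 u N; rewrite uN subrr => /esym/eqP.
by rewrite mulf_eq0 subr_eq0 (negPf u1) => /eqP.
Qed.

(** Orthogonality of the characters of the cyclic group of order [N]: the ratio is an [N]-th root of
    unity, and it is 1 only for [l = j]. *)
Lemma sum_cis_orth (N l j : nat) : (l < N)%N -> (j < N)%N ->
  \sum_(k < N) (cis (2 * pi / N%:R * l%:R) / cis (2 * pi / N%:R * j%:R)) ^+ k =
   N%:R *+ (l == j).
Proof.
move=> lN jN; have N0 : (0 < N)%N by apply: leq_trans lN.
have cN n : cis (2 * pi / N%:R * n%:R) ^+ N = 1.
  by rewrite cisX mulrAC divfK ?cis_2pin // pnatr_eq0 -lt0n.
have cu t : cis t != 0 by rewrite -nm_eq0 nm_cis oner_eq0.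
have [->|nlj] := eqVneq l j.
  by rewrite divff // (eq_bigr (fun=> 1)) => [|k _]; rewrite ?expr1n // sumr_const card_ord.
rewrite mulr0n; apply: sum_roots; last by rewrite exprMn exprVn !cN invr1 mulr1.
wlog ltj : l j lN jN nlj / (j < l)%N => [hw|].
  have [|lj|e] := ltngtP l j; last by rewrite e eqxx in nlj.
    move=> lj; have nu := hw j l jN lN; rewrite eq_sym in nu.
    by rewrite -invf_div invr_eq1; apply: nu.
  exact: hw.
rewrite -cisN -cisD -mulrN -mulrDr -natrB ?(ltnW ltj) //.
by apply: cis_frac_neq1; rewrite subn_gt0 ltj (leq_ltn_trans _ lN) // leq_subr.
Qed.

(** Cauchy's coefficient formula without integrals: the average of [q] over [size q] equally spaced
    points of the circle, against a character, isolates one coefficient exactly, because the degree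
    is below the number of points. *)
Lemma cauchy_coef (q : {poly C}) (rho M : R) : 0 < rho ->
  (forall z, nm z = rho -> nm q.[z] <= M) -> forall j, nm q`_j * rho ^+ j <= M.
Proof.
move=> rho0 qM j; have [jq|jq] := ltnP j (size q); last first.
  rewrite nth_default // nm0 mul0r; apply: le_trans (nm_ge0 _) (qM rho%:C _).
  by rewrite nm_real gtr0_norm.
set N := size q; have N0 : (0 < N)%N by apply: leq_trans jq.
pose w k : C := cis (2 * pi / N%:R * k%:R).
have wu k : w k != 0 by rewrite -nm_eq0 nm_cis oner_eq0.
have key : \sum_(k < N) q.[rho%:C * w k] / w j ^+ k = N%:R * (q`_j * rho%:C ^+ j).
  transitivity (\sum_(l < N) q`_l * rho%:C ^+ l * \sum_(k < N) (w l / w j) ^+ k).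
    under [RHS]eq_bigr do rewrite mulr_sumr; rewrite exchange_big /=.
    apply: eq_bigr => k _; rewrite horner_coef mulr_suml; apply: eq_bigr => l _.
    rewrite !exprMn exprVn !mulrA; congr (_ / _ ); rewrite -!mulrA; congr (_ * (_ * _)).
    by rewrite /w !cisX; congr cis; rewrite -!mulrA [k%:R * _]mulrC.
  rewrite (bigD1 (Ordinal jq)) //= [X in _ + X]big1 ?addr0 => [|l lj].
    by rewrite sum_cis_orth // eqxx mulr1n mulrC.
  by rewrite sum_cis_orth // -(inj_eq val_inj) /= in lj *; rewrite (negPf lj) mulr0.
have : nm (N%:R * (q`_j * rho%:C ^+ j)) <= N%:R * M.
  rewrite -key (le_trans (nm_sum _ _ _)) //.
  rewrite mulr_natl -[N in _ *+ N]card_ord -sumr_const; apply: ler_sum => k _.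
  rewrite nmM nmV nmX nm_cis expr1n invr1 mulr1; apply: qM.
  by rewrite nmM nm_cis mulr1 nm_real gtr0_norm.
by rewrite !nmM nmX nm_nat nm_real gtr0_norm // ler_pM2l ?ltr0n.
Qed.

(** The difference is the sum of the nonconstant coefficients; by [cauchy_coef] it is dominated by a
    geometric series of ratio at most one half. *)
Lemma cauchy_lipschitz (q : {poly C}) (rho M : R) : 2 <= rho ->
  (forall z, nm z = rho -> nm q.[z] <= M) -> nm (q.[1] - q.[0]) <= 2 / rho * M.
Proof.
move=> rho2 qM; have rho0 : 0 < rho by lra.
have qc := cauchy_coef rho0 qM.
have M0 : 0 <= M by apply: le_trans (nm_ge0 _) (qM rho%:C _); rewrite nm_real gtr0_norm.
have -> : q.[1] - q.[0] = \sum_(j < (size q).-1) q`_j.+1.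
  case E : (size q) => [|n] /=.
    by have /eqP := E; rewrite size_poly_eq0 => /eqP->; rewrite !horner0 subrr big_ord0.
  rewrite horner_coef0 horner_coef E big_ord_recl /= expr1n mulr1 [X in X - _]addrC addrK.
  by apply: eq_bigr => j _; rewrite expr1n mulr1.
apply: le_trans (nm_sum _ _ _) _.
apply: (@le_trans _ _ (\sum_(j < (size q).-1) M * rho^-1 ^+ j.+1)).
  by apply: ler_sum => j _; rewrite exprVn -/(_ / _) ler_pdivlMr ?exprn_gt0.
rewrite -mulr_sumr mulrC ler_wpM2r //.
elim: (size q).-1 => [|n IH]; first by rewrite big_ord0 divr_ge0 // ltW.
rewrite big_ord_recl /= expr1; under eq_bigr do rewrite /bump /= add1n exprS.
rewrite -mulr_sumr.
have h : rho^-1 <= 2^-1 by rewrite lef_pV2 ?posrE.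
have h0 : 0 < rho^-1 by rewrite invr_gt0.
have : rho^-1 * \sum_(i < n) rho^-1 ^+ i.+1 <= rho^-1 * (2 * rho^-1) by rewrite ler_wpM2l // ltW.
nra.
Qed.

(* Cauchy estimate for the polynomial [z |-> \det (1 + Z + z D)]: for traceless matrices
   [nm_det1D] bounds it on the circle of radius [1 / fro D] independently of [n]. *)
Lemma det_lipschitz n (Z D : 'M[C]_n) : \tr Z = 0 -> \tr D = 0 -> fro D <= 2^-1 ->
  nm (\det (1%:M + (Z + D)) - \det (1%:M + Z)) <= 2 * fro D * expR ((fro Z + 1) ^+ 2 / 2).
Proof.
move=> trZ trD Dh.
(* The radius used below is the inverse of [fro D], so [D = 0] is set aside. *)
have [D0|D0] := eqVneq (fro D) 0.
  have -> : D = 0.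
    apply/matrixP => i j; apply/eqP; rewrite mxE -nm_eq0 eq_le nm_ge0 andbT -D0.
    exact: fro_entry.
  by rewrite addr0 subrr nm0 !mulr_ge0 ?fro_ge0 ?expR_ge0.
have Dp : 0 < fro D by rewrite lt_def D0 fro_ge0.
pose q : {poly C} := \det (map_mx polyC (1%:M + Z) + 'X *: map_mx polyC D).
have qE z : q.[z] = \det (1%:M + (Z + z *: D)).
  rewrite /q -[LHS]/(horner_eval z _) -det_map_mx; congr (\det _).
  by apply/matrixP => i j; rewrite !mxE /= /horner_eval !(hornerD, hornerM, hornerX, hornerC) addrA.
have := @cauchy_lipschitz q (fro D)^-1 (expR ((fro Z + 1) ^+ 2 / 2)).
rewrite !qE scale1r scale0r addr0 invrK; apply; first by rewrite -[2]invrK lef_pV2 ?posrE ?invr_gt0.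
move=> z zE; rewrite qE; apply: le_trans (nm_det1D _) _.
  by rewrite raddfD /= mxtraceZ trZ trD mulr0 addr0.
rewrite ler_expR ler_pM2r ?invr_gt0 // ler_pXn2r ?nnegrE ?addr_ge0 ?fro_ge0 //.
by apply: le_trans (froD _ _) _; rewrite lerD2l froZ zE mulVf // gt_eqF.
Qed.

(* [1 + X Y] is a Schur complement of the matrix [[1, -X], [Y, 1]], which is the identity
   plus a traceless matrix. *)
Lemma det_prod_lipschitz n (X Y X' Y' : 'M[C]_n) (s d : R) :
  fro X <= s -> fro Y <= s -> fro (X' - X) <= d -> fro (Y' - Y) <= d -> d <= 4^-1 ->
  nm (\det (1%:M + X' *m Y') - \det (1%:M + X *m Y)) <= 4 * d * expR ((2 * s + 1) ^+ 2 / 2).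
Proof.
move=> Xs Ys Xd Yd d4.
have dE (A B : 'M[C]_n) : \det (1%:M + A *m B) = \det (1%:M + block_mx 0 (- A) B 0).
  rewrite scalar_mx_block add_block_mx !(addr0, add0r).
  have -> : block_mx 1%:M (- A) B 1%:M =
     block_mx 1%:M (- A) 0 1%:M *m block_mx (1%:M + A *m B) 0 B 1%:M :> 'M[C]_(n + n).
    rewrite mulmx_block !(mul1mx, mulmx1, mul0mx, mulmx0, mulNmx, add0r, addr0).
    by rewrite addrK.
  by rewrite det_mulmx det_ublock det_lblock !det1 !mul1r mulr1.
have tr0 (A B : 'M[C]_n) : \tr (block_mx 0 A B 0) = 0.
  by rewrite mxtrace_block !raddf0 addr0.
have s0 : 0 <= s by apply: le_trans Xs; exact: fro_ge0.
have d0 : 0 <= d by apply: le_trans Xd; exact: fro_ge0.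
(* The factor 2 is a rational substitute for the square root of 2. It turns [d <= 4^-1] into the
   bound [2^-1] that [det_lipschitz] requires. *)
have fB (A B : 'M[C]_n) c : 0 <= c -> fro A <= c -> fro B <= c -> fro (block_mx 0 A B 0) <= 2 * c.
  move=> c0 Ac Bc; rewrite -(@ler_pXn2r _ 2) ?nnegrE ?fro_ge0 ?mulr_ge0 //.
  rewrite fro_block !fro0 expr0n /= add0r addr0 exprMn.
  have := fro_ge0 A; have := fro_ge0 B; nra.
rewrite !dE.
have -> : block_mx 0 (- X') Y' 0 = block_mx 0 (- X) Y 0 + block_mx 0 (- (X' - X)) (Y' - Y) 0 :> 'M[C]_(n + n).
  by rewrite add_block_mx !addr0 opprB addrA [_ + X]addrC subrr add0r addrC subrK.
have fd := fB (- (X' - X)) (Y' - Y) d d0.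
rewrite froN in fd; have {}fd := fd Xd Yd.
have fs := fB (- X) Y s s0; rewrite froN in fs; have {}fs := fs Xs Ys.
apply: le_trans (det_lipschitz (tr0 _ _) (tr0 _ _) _) _; first by lra.
apply: ler_pM; rewrite ?mulr_ge0 ?fro_ge0 ?expR_ge0 //; first by lra.
rewrite ler_expR ler_pM2r ?invr_gt0 // ler_pXn2r ?nnegrE ?addr_ge0 ?fro_ge0 ?mulr_ge0 //.
by rewrite lerD2r.
Qed.

End RootsOfUnity.

(** * Limits expressed through the real-valued norm *)

Section Convergence.
Variable R : realType.
Local Notation C := R[i].

(** A positive element of [R[i]] has zero imaginary part, so the tolerance may be taken in [R]. *)
Lemma cvg_nmP (V : normedModType C) T (F : set_system T) (FF : Filter F) (u : T -> V) (l : V) :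
  (u x @[x --> F] --> l) <-> (forall e : R, 0 < e -> \forall x \near F, nm (u x - l) <= e).
Proof.
split=> [/cvgrPdistC_le h e e0|h].
  by have := h e%:C; rewrite ltcR => /(_ e0); apply: filterS => x; rewrite nm_le.
apply/cvgrPdistC_le => -[a b] e0.
have b0 : b = 0 by move: e0; rewrite ltcE /= => /andP[/eqP-> _].
move: e0; rewrite b0 complexr0 ltcR => a0.
by have := h a a0; apply: filterS => x; rewrite nm_le.
Qed.

Lemma cvg_nm_squeeze (V : normedModType C) T (F : set_system T) (FF : Filter F)
    (u : T -> V) (l : V) (d : T -> R) :
  (\forall x \near F, nm (u x - l) <= d x) -> d x @[x --> F] --> (0 : R) ->
  u x @[x --> F] --> l.
Proof.
move=> ud d0; apply/cvg_nmP => e e0; have /cvgrPdistC_le/(_ e e0) d1 := d0.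
move: ud d1; apply: filterS2 => x ud; rewrite subr0 => /(le_trans (ler_norm _)).
exact: le_trans.
Qed.

Lemma cvg_nm_dist (V : normedModType C) T (F : set_system T) (FF : Filter F)
    (u : T -> V) (l : V) : u x @[x --> F] --> l -> nm (u x - l) @[x --> F] --> (0 : R).
Proof.
move=> /cvg_nmP h; apply/cvgrPdistC_le => e e0; have := h e e0.
by apply: filterS => x; rewrite subr0 ger0_norm ?nm_ge0.
Qed.

Lemma cvg_nm_le (V : normedModType C) T (F : set_system T) (FF : ProperFilter F)
    (u : T -> V) (l m : V) (c : R) : u x @[x --> F] --> l ->
  (\forall x \near F, nm (u x - m) <= c) -> nm (l - m) <= c.
Proof.
move=> /cvg_nmP h uc; rewrite leNgt; apply/negP => lc.
have e0 : 0 < (nm (l - m) - c) / 2 by rewrite divr_gt0 // subr_gt0.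
have [x] := @filter_ex _ F FF _ (filterI (h _ e0) uc).
case=> h1 h2; have : nm (l - m) <= nm (u x - l) + nm (u x - m).
  by rewrite -[l - m](subrKA (u x)) (nmBC (u x)) nmD.
lra.
Qed.

Lemma cvg_realC T (F : set_system T) (FF : Filter F) (u : T -> R) (l : R) :
  u x @[x --> F] --> l -> ((u x)%:C : C^o) @[x --> F] --> (l%:C : C^o).
Proof.
move=> /cvgrPdistC_le h; apply/cvg_nmP => e e0; have := h e e0.
by apply: filterS => x; rewrite -rmorphB /= nm_real.
Qed.

Lemma cvg_ReIm T (F : set_system T) (FF : Filter F) (u : T -> C) (l : C) :
  complex.Re (u x) @[x --> F] --> complex.Re l ->
  complex.Im (u x) @[x --> F] --> complex.Im l ->
  (u x : C^o) @[x --> F] --> (l : C^o).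
Proof.
move=> hr hi; apply: (@cvg_nm_squeeze _ _ _ _ _ _
   (fun x => `|complex.Re (u x) - complex.Re l| + `|complex.Im (u x) - complex.Im l|)).
  by apply: filterE => x; apply: le_trans (nm_ReIm _) _; case: (u x) => a b; case: (l).
rewrite -[0]addr0; apply: cvgD.
  by rewrite -(@normr0 _ R) -(subrr (complex.Re l)); apply: cvg_norm; apply: cvgB => //; apply: cvg_cst.
by rewrite -(@normr0 _ R) -(subrr (complex.Im l)); apply: cvg_norm; apply: cvgB => //; apply: cvg_cst.
Qed.

Lemma cvg_bigprod I (r : seq I) (P : pred I) T (F : set_system T) (FF : Filter F)
   (u : I -> T -> C) (l : I -> C) :
  (forall i, P i -> (u i x : C^o) @[x --> F] --> (l i : C^o)) ->
  (\prod_(i <- r | P i) u i x : C^o) @[x --> F] --> (\prod_(i <- r | P i) l i : C^o).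
Proof.
move=> h; elim: r => [|a r IH].
  by rewrite big_nil; under eq_cvg do rewrite big_nil; apply: cvg_cst.
rewrite big_cons; under eq_cvg do rewrite big_cons.
by case: ifP => [Pa|_]; [apply: cvgM; [exact: h|exact: IH]|exact: IH].
Qed.

Lemma cvg_bigsum (V : normedModType C) I (r : seq I) (P : pred I) T (F : set_system T) (FF : Filter F)
   (u : I -> T -> V) (l : I -> V) :
  (forall i, P i -> u i x @[x --> F] --> l i) ->
  (\sum_(i <- r | P i) u i x) @[x --> F] --> (\sum_(i <- r | P i) l i).
Proof.
move=> h; elim: r => [|a r IH].
  by rewrite big_nil; under eq_cvg do rewrite big_nil; apply: cvg_cst.
rewrite big_cons; under eq_cvg do rewrite big_cons.
by case: ifP => [Pa|_]; [apply: cvgD; [exact: h|exact: IH]|exact: IH].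
Qed.

Lemma cvg_det n T (F : set_system T) (FF : Filter F) (u : T -> 'M[C]_n) (l : 'M[C]_n) :
  (forall i j, (u x i j : C^o) @[x --> F] --> (l i j : C^o)) ->
  (\det (u x) : C^o) @[x --> F] --> (\det l : C^o).
Proof.
move=> h; rewrite /determinant; apply: (@cvg_bigsum (C^o : normedModType C)) => s _.
apply: cvgM; first exact: cvg_cst.
by apply: cvg_bigprod => i _; exact: h.
Qed.

End Convergence.

(** * The complex exponential and its power series *)

Section ComplexExp.
Variable R : realType.
Local Notation C := R[i].

Definition pexp m (t : C) : C := \sum_(k < m) t ^+ k / k`!%:R.

(** The polar form makes additivity immediate; that it is the sum of the exponential series is
    [cvg_pexp]. *)
Definition cexp (t : C) : C := (expR (complex.Re t))%:C * cis (complex.Im t).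

Lemma cexpD s t : cexp (s + t) = cexp s * cexp t.
Proof.
case: s => a b; case: t => c d; rewrite /cexp /= expRD cisD rmorphM /=; ring.
Qed.

Lemma cexp_real a : cexp a%:C = (expR a)%:C.
Proof. by rewrite /cexp /= cis0 mulr1. Qed.

Lemma cexp0 : cexp 0 = 1. Proof. by rewrite -[0]/(0%:C) cexp_real expR0. Qed.

Lemma cexp_sum I (r : seq I) (P : pred I) (F : I -> C) :
  cexp (\sum_(i <- r | P i) F i) = \prod_(i <- r | P i) cexp (F i).
Proof. by apply: (big_morph _ cexpD cexp0). Qed.

(** Of the Cauchy product of the two partial sums, the terms of total degree below [m] form
    [pexp m (s + t)]; the others are the defect. *)
Lemma pexpM m s t : pexp m s * pexp m t - pexp m (s + t) =
  \sum_(j < m) \sum_(k < m) ((s ^+ j / j`!%:R) * (t ^+ k / k`!%:R)) *+ (m <= j + k).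
Proof.
(* The binomial formula holds in this form only for [n < m], since both indices stay below [m]. *)
have h n : (s + t) ^+ n / n`!%:R =
    \sum_(j < m) \sum_(k < m) ((s ^+ j / j`!%:R) * (t ^+ k / k`!%:R)) *+ (j + k == n)%N
  \/ (m <= n)%N.
  have [|nm] := leqP m n; [by right|left].
  have -> : \sum_(j < m) \sum_(k < m) ((s ^+ j / j`!%:R) * (t ^+ k / k`!%:R)) *+ (j + k == n)%N
     = \sum_(j < m) if (j < n.+1)%N then (s ^+ j / j`!%:R) * (t ^+ (n - j) / (n - j)`!%:R) else 0.
    apply: eq_bigr => j _; case: ifP => jn; last first.
      rewrite big1 // => k _; case: eqP => // e.
      by rewrite -e ltnS leq_addr in jn.
    have nj : (n - j < m)%N by rewrite (leq_ltn_trans (leq_subr _ _)).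
    rewrite (bigD1 (Ordinal nj)) //= subnKC // eqxx mulr1n big1 ?addr0 // => k.
    rewrite -(inj_eq val_inj) /= => kj; case: eqP => // e.
    by rewrite -e addKn eqxx in kj.
  rewrite -big_mkcond /= (big_ord_narrow nm) /= addrC exprDn mulr_suml.
  apply: eq_bigr => j _; have jn : (j <= n)%N by rewrite -ltnS ltn_ord.
  have := bin_fact jn => /(congr1 (fun x => x%:R : C)); rewrite !natrM => e.
  have f0 k : (k`!%:R : C) != 0 by rewrite pnatr_eq0 -lt0n fact_gt0.
  rewrite -e -mulr_natr; have b0 : ('C(n, j)%:R : C) != 0 by rewrite pnatr_eq0 -lt0n bin_gt0.
  have := f0 j; have := f0 (n - j)%N => h1 h2; field; rewrite ?h1 ?h2 ?b0 //.
have -> : pexp m (s + t) = \sum_(j < m) \sum_(k < m)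
     ((s ^+ j / j`!%:R) * (t ^+ k / k`!%:R)) *+ (j + k < m)%N.
  transitivity (\sum_(n < m) \sum_(j < m) \sum_(k < m)
     ((s ^+ j / j`!%:R) * (t ^+ k / k`!%:R)) *+ (j + k == n)%N).
    by apply: eq_bigr => n _; have [//|] := h n; rewrite leqNgt ltn_ord.
  rewrite exchange_big; apply: eq_bigr => j _; rewrite exchange_big; apply: eq_bigr => k _.
  case: ltnP => jk.
    rewrite (bigD1 (Ordinal jk)) //= eqxx big1 ?addr0 // => n.
    by rewrite -(inj_eq val_inj) /= eq_sym => /negPf->.
  by rewrite big1 // => n _; case: eqP => // e; rewrite e leqNgt ltn_ord in jk.
rewrite {1}/pexp {1}/pexp mulr_suml -sumrB; apply: eq_bigr => j _.
rewrite mulr_sumr -sumrB; apply: eq_bigr => k _.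
by case: ltnP; rewrite ?mulr1n ?mulr0n ?subrr ?subr0.
Qed.

Lemma nm_fact k : nm (k`!%:R : C) = k`!%:R. Proof. exact: nm_nat. Qed.

Lemma pexp_real m (a : R) : pexp m a%:C = (series (exp_coeff a) m)%:C.
Proof.
rewrite /series /= big_mkord rmorph_sum; apply: eq_bigr => k _.
by rewrite /exp_coeff /= rmorphM /= rmorphXn fmorphV rmorph_nat.
Qed.

(** The defect consists of monomials with nonnegative coefficients, so it is dominated by the defect
    at the real points [nm s] and [nm t]. That one tends to 0 because the real exponential is
    multiplicative. *)
Lemma pexpM_bound m s t : nm (pexp m s * pexp m t - pexp m (s + t)) <=
  nm (pexp m (nm s)%:C * pexp m (nm t)%:C - pexp m ((nm s)%:C + (nm t)%:C)).
Proof.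
pose c (x : R) k : R := x ^+ k / k`!%:R.
have c0 x k : 0 <= x -> 0 <= c x k by move=> x0; rewrite divr_ge0 ?exprn_ge0.
pose S := \sum_(j < m) \sum_(k < m) (c (nm s) j * c (nm t) k) *+ (m <= j + k)%N.
apply: (@le_trans _ _ S).
  rewrite pexpM; apply: le_trans (nm_sum _ _ _) _; apply: ler_sum => j _.
  apply: le_trans (nm_sum _ _ _) _; apply: ler_sum => k _.
  by case: leqP => _; rewrite ?mulr0n ?nm0 // !mulr1n !nmM !nmV !nm_fact !nmX.
suff -> : pexp m (nm s)%:C * pexp m (nm t)%:C - pexp m ((nm s)%:C + (nm t)%:C) = S%:C.
  by rewrite nm_real ler_norm.
rewrite pexpM /S rmorph_sum; apply: eq_bigr => j _; rewrite rmorph_sum; apply: eq_bigr => k _.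
by rewrite /= rmorphMn rmorphM /c /= !rmorphM /= !rmorphXn !fmorphV !rmorph_nat.
Qed.

Lemma cvg_pexp_real (a : R) : (pexp m a%:C : C^o) @[m --> \oo] --> ((expR a)%:C : C^o).
Proof.
under eq_cvg do rewrite pexp_real.
by apply: cvg_realC; exact: is_cvg_series_exp_coeff.
Qed.

Lemma cvg_pexp_im (b : R) : (pexp m (b%:C * 'i%C) : C^o) @[m --> \oo] --> (cis b : C^o).
Proof.
have e m : pexp m (b%:C * 'i%C) = series (cos_coeff b) m +i* series (sin_coeff b) m.
  rewrite /pexp /series /= !big_mkord.
  have -> : (\sum_(k < m) cos_coeff b k) +i* (\sum_(k < m) sin_coeff b k) =
     \sum_(k < m) (cos_coeff b k +i* sin_coeff b k).
    by elim/big_rec3: _ => // k x y z _ <-.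
  apply: eq_bigr => k _; rewrite /cos_coeff /sin_coeff /=.
  have -> : (k`!%:R : C)^-1 = (k`!%:R^-1)%:C by rewrite fmorphV rmorph_nat.
  rewrite exprMn -rmorphXn /=.
  (* The exponent [k.-1./2] is that of the sine coefficients; it equals [k./2] for odd [k], and for
     even [k] the factor [(odd k)%:R] removes the term. *)
  have -> : ('i%C : C) ^+ k = ((~~ odd k)%:R * (-1) ^+ k./2) +i* ((odd k)%:R * (-1) ^+ k.-1./2).
    rewrite -{1}(odd_double_half k) exprD -mul2n exprM sqr_i.
    have -> : (-1 : C) ^+ k./2 = ((-1) ^+ k./2)%:C by rewrite rmorphXn rmorphN1.
    have : odd k -> k.-1./2 = k./2.
      by case: (nat_of_ord k) => // j /= oj; rewrite uphalf_half (negPf oj).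
    case: (odd k) => /= [->//|_]; rewrite ?expr1 ?expr0 ?mul1r ?mul0r //.
    by simpc.
  rewrite -exprnP; apply/eqP; rewrite eq_complex /= !(mulr0, mul0r, subr0, addr0, add0r).
  by apply/andP; split; apply/eqP; ring.
under eq_cvg do rewrite e.
apply: cvg_ReIm => /=; rewrite ?cos.unlock ?sin.unlock.
  exact: is_cvg_series_cos_coeff.
exact: is_cvg_series_sin_coeff.
Qed.

(** The product of the partial sums at the real part and at the imaginary part converges to
    [cexp t], and it differs from the partial sum at [t] by the vanishing defect of
    [pexpM_bound]. *)
Lemma cvg_pexp (t : C) : (pexp m t : C^o) @[m --> \oo] --> (cexp t : C^o).
Proof.
set a := complex.Re t; set b := complex.Im t.
have tE : t = a%:C + b%:C * 'i%C by rewrite mulrC -complexE.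
set s2 : C := b%:C * 'i%C.
have h1 : (pexp m a%:C * pexp m s2 : C^o) @[m --> \oo] --> (cexp t : C^o).
  by apply: cvgM; [exact: cvg_pexp_real | exact: cvg_pexp_im].
have h2 : (pexp m a%:C * pexp m s2 - pexp m t : C^o) @[m --> \oo] --> (0 : C^o).
  apply: (@cvg_nm_squeeze _ _ _ _ _ _ _ (fun m => nm (pexp m (nm a%:C)%:C * pexp m (nm s2)%:C - pexp m ((nm a%:C)%:C + (nm s2)%:C) - 0))).
    by apply: nearW => m; rewrite !subr0 tE pexpM_bound.
  apply: (@cvg_nm_dist _ C^o).
  rewrite -(subrr (expR (nm a%:C) * expR (nm s2))%:C); apply: cvgB.
    by rewrite rmorphM; apply: cvgM; exact: cvg_pexp_real.
  by rewrite -expRD; under eq_cvg do rewrite -rmorphD; exact: cvg_pexp_real.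
have -> : (fun m => pexp m t) =
   (fun m => pexp m a%:C * pexp m s2 - (pexp m a%:C * pexp m s2 - pexp m t)).
  by apply/funext => m; rewrite opprB addrC subrK.
by have := cvgB h1 h2; rewrite subr0; apply.
Qed.

Lemma pexp_le (a : R) m : 0 <= a -> \sum_(k < m) a ^+ k / k`!%:R <= expR a.
Proof.
move=> a0; have -> : \sum_(k < m) a ^+ k / k`!%:R = series (exp_coeff a) m.
  by rewrite /series /= big_mkord.
apply: nondecreasing_cvgn_le; last exact: is_cvg_series_exp_coeff.
by apply/nondecreasing_seqP => k; rewrite /series /= big_nat_recr //= lerDl exp_coeff_ge0.
Qed.

Lemma cexp_near1 (w : C) : nm (cexp w - 1) <= nm w * expR (nm w).
Proof.
apply: (@cvg_nm_le _ C^o _ _ _ _ _ 1 _ (@cvg_pexp w)).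
exists 1%N => // -[//|m] _; rewrite /pexp big_ord_recl expr0 fact0 divr1 addrAC subrr add0r.
apply: le_trans (nm_sum _ _ _) _.
apply: (@le_trans _ _ (\sum_(k < m) nm w * (nm w ^+ k / k`!%:R))).
  apply: ler_sum => k _; rewrite lift0 nmM nmV nm_fact nmX exprS -mulrA.
  rewrite ler_wpM2l ?nm_ge0 // ler_wpM2l ?exprn_ge0 ?nm_ge0 // lef_pV2 ?posrE ?ltr0n ?fact_gt0 //.
  by rewrite ler_nat factS leq_pmull.
by rewrite -mulr_sumr ler_wpM2l ?nm_ge0 // pexp_le ?nm_ge0.
Qed.

End ComplexExp.
(** * The modified determinant of a matrix *)

Section ModifiedDet.
Variable R : realType.
Local Notation C := R[i].

(** This is [det ((1 - X) exp X)] in closed form, the determinant of [exp X] being the exponential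
    of the trace ([cvg_det_pexp]). *)
Definition mdet n (X : 'M[C]_n) : C := \det (1%:M - X) * cexp (\tr X).

Definition mxpexp m n (X : 'M[C]_n) : 'M[C]_n := \sum_(k < m) k`!%:R^-1 *: X ^+ k.

(* The coefficients of [((1 - t) p_m(t) - 1) / t], where [p_m] is the truncated exponential
   series of [mxpexp]. *)
Definition gcoef m k : C := (if (k.+1 < m)%N then (k.+1)`!%:R^-1 else 0) - k`!%:R^-1.

Definition mxg m n (X : 'M[C]_n) : 'M[C]_n := \sum_(k < m) gcoef m k *: X ^+ k.

Lemma mxgE m n (X : 'M[C]_n) : (0 < m)%N ->
  1%:M + X *m mxg m X = (1%:M - X) *m mxpexp m X.
Proof.
move=> m0; rewrite mulmxBl mul1mx.
have -> : mxg m X = \sum_(k < m.-1) k.+1`!%:R^-1 *: X ^+ k - mxpexp m X.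
  rewrite /mxg; under eq_bigr do rewrite scalerBl; rewrite sumrB; congr (_ - _).
  case: m m0 => // m _; rewrite big_ord_recr /= ltnn scale0r addr0.
  by apply: eq_bigr => k _; rewrite ltnS ltn_ord.
rewrite mulmxBr addrA; congr (_ - _).
case: m m0 => // m _; rewrite /mxpexp big_ord_recl /= fact0 invr1 scale1r expr0; congr (_ + _).
rewrite mulmx_sumr; apply: eq_bigr => k _.
by rewrite /bump leq0n add1n -scalemxAr exprS.
Qed.

Lemma nm_gcoef m k : nm (gcoef m k) <= (k`!%:R)^-1.
Proof.
rewrite /gcoef; case: ifP => _; last by rewrite sub0r nmN nmV nm_fact.
have -> : (k.+1)`!%:R^-1 - k`!%:R^-1 = ((k.+1)`!%:R^-1 - k`!%:R^-1 : R)%:C.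
  by rewrite rmorphB /= !fmorphV !rmorph_nat.
have h : (k.+1)`!%:R^-1 <= k`!%:R^-1 :> R.
  by rewrite lef_pV2 ?posrE ?ltr0n ?fact_gt0 // ler_nat factS leq_pmull.
have h0 : 0 <= (k.+1)`!%:R^-1 :> R by rewrite invr_ge0.
by rewrite nm_real ler0_norm; lra.
Qed.

(** This cancellation is what makes all bounds uniform in the size: a constant term would add a
    multiple of the identity matrix, whose Frobenius norm grows with [n]. *)
Lemma gcoef0 m : (1 < m)%N -> gcoef m 0 = 0.
Proof. by rewrite /gcoef => ->; rewrite subrr. Qed.

Lemma froMX n p (A : 'M[C]_(p, n)) (X : 'M[C]_n) k : fro (A *m X ^+ k) <= fro A * fro X ^+ k.
Proof.
elim: k => [|k IH]; first by rewrite expr0 mulmx1 mulr1.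
rewrite exprSr [X ^+ k * X]/(X ^+ k *m X) mulmxA.
apply: le_trans (froM _ _) _; rewrite exprSr mulrA.
by rewrite ler_wpM2r ?fro_ge0.
Qed.

Lemma fro_expB n (X X' : 'M[C]_n) s d k : fro X <= s -> fro X' <= s -> fro (X' - X) <= d ->
  fro (X' ^+ k - X ^+ k) <= k%:R * s ^+ k.-1 * d.
Proof.
move=> Xs Xs' Xd.
have s0 : 0 <= s by apply: le_trans Xs; exact: fro_ge0.
have d0 : 0 <= d by apply: le_trans Xd; exact: fro_ge0.
elim: k => [|k IH]; first by rewrite subrr fro0 !mul0r.
have -> : X' ^+ k.+1 - X ^+ k.+1 = X' *m (X' ^+ k - X ^+ k) + (X' - X) *m X ^+ k.
  by rewrite mulmxBr mulmxBl !exprS addrA subrK.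
apply: le_trans (froD _ _) _; rewrite -natr1 mulrDl mulrDl.
apply: lerD.
  case: k IH => [|k] IH; first by rewrite !expr0 subrr mulmx0 fro0 !mul0r.
  apply: le_trans (froM _ _) _; rewrite /=.
  have -> : k.+1%:R * s ^+ k.+1 * d = s * (k.+1%:R * s ^+ k * d) by rewrite exprS; ring.
  by apply: ler_pM; rewrite ?fro_ge0.
apply: le_trans (froMX _ _ _) _; rewrite mul1r mulrC.
by apply: ler_pM; rewrite ?exprn_ge0 ?fro_ge0 // lerXn2r ?nnegrE ?fro_ge0.
Qed.

(** The constant terms cancel, and what remains is dominated by the derivative of the exponential
    series at [s]. *)
Lemma fro_mxgB m n (X X' : 'M[C]_n) s d : fro X <= s -> fro X' <= s -> fro (X' - X) <= d ->
  fro (mxg m X' - mxg m X) <= d * expR s.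
Proof.
move=> Xs Xs' Xd.
have s0 : 0 <= s by apply: le_trans Xs; exact: fro_ge0.
have d0 : 0 <= d by apply: le_trans Xd; exact: fro_ge0.
rewrite /mxg -sumrB; apply: le_trans (fro_sum _ _ _) _.
apply: (@le_trans _ _ (\sum_(k < m) d * (k%:R * s ^+ k.-1 / k`!%:R))).
  apply: ler_sum => k _; rewrite -scalerBr froZ.
  rewrite mulrC [d * _]mulrC [_ / _ * d]mulrAC.
  apply: ler_pM; rewrite ?fro_ge0 ?nm_ge0 ?nm_gcoef //.
  exact: fro_expB Xs Xs' Xd.
rewrite -mulr_sumr ler_wpM2l //; apply: le_trans (pexp_le m.-1 s0).
case: m => [|m]; first by rewrite !big_ord0.
rewrite big_ord_recl /= !mul0r add0r; apply: ler_sum => k _.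
rewrite /bump /= !add1n add0n factS natrM invfM [_%:R * _]mulrC -mulrA [_%:R * (_ * _)]mulrA.
by rewrite divff ?pnatr_eq0 // mul1r.
Qed.

Lemma fro_mxg m n (X : 'M[C]_n) s : (1 < m)%N -> fro X <= s -> fro (mxg m X) <= s * expR s.
Proof.
move=> m1 Xs; have s0 : 0 <= s by apply: le_trans Xs; exact: fro_ge0.
have g0 : mxg m (0 : 'M[C]_n) = 0.
  rewrite /mxg big1 // => -[[|k] kl] _ /=; first by rewrite gcoef0 // scale0r.
  by rewrite exprS [0 * _]mul0mx scaler0.
by rewrite -[mxg m X]subr0 -g0; apply: fro_mxgB; rewrite ?fro0 ?subr0.
Qed.

(** The constant of [det_prod_lipschitz] for the factors [X] and [mxg m X]: both are bounded by
    [s * (1 + expR s)], and both vary by at most [d * (1 + expR s)]. *)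
Definition mdetK (s : R) : R := 4 * (1 + expR s) * expR ((2 * (s * (1 + expR s)) + 1) ^+ 2 / 2).

Lemma mdetK_ge0 s : 0 <= mdetK s.
Proof. by rewrite /mdetK !mulr_ge0 ?addr_ge0 ?expR_ge0. Qed.

Lemma det_mxg_lipschitz m n (X X' Y Y' : 'M[C]_n) s d : (1 < m)%N ->
  fro X <= s -> fro X' <= s -> fro Y <= s * expR s -> fro (X' - X) <= d ->
  fro (Y' - Y) <= d * expR s -> d * (1 + expR s) <= 4^-1 ->
  nm (\det (1%:M + X' *m Y') - \det (1%:M + X *m Y)) <= d * mdetK s.
Proof.
move=> m1 Xs Xs' Ys Xd Yd d4.
have s0 : 0 <= s by apply: le_trans Xs; exact: fro_ge0.
have d0 : 0 <= d by apply: le_trans Xd; exact: fro_ge0.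
have e0 := expR_ge0 s.
have := @det_prod_lipschitz R n X Y X' Y' (s * (1 + expR s)) (d * (1 + expR s)).
have -> : 4 * (d * (1 + expR s)) * expR ((2 * (s * (1 + expR s)) + 1) ^+ 2 / 2) = d * mdetK s.
  by rewrite /mdetK !mulrA [4 * d]mulrC.
by apply; rewrite // mulrDr mulr1; apply: le_trans; [exact: Xs| | exact: Ys| | exact: Xd| |exact: Yd|];
  rewrite ?lerDl ?lerDr ?mulr_ge0.
Qed.

Lemma trig_mxX n (T : 'M[C]_n) k : is_trig_mx T ->
  is_trig_mx (T ^+ k) /\ forall i, (T ^+ k) i i = T i i ^+ k.
Proof.
move=> Tt; elim: k => [|k [IH1 IH2]].
  split=> [|i]; last by rewrite expr0 mxE eqxx.
  by apply/is_trig_mxP => i j ij; rewrite mxE -val_eqE (ltn_eqF ij).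
split=> [|i].
  apply/is_trig_mxP => i j ij; rewrite exprS mxE big1 // => l _.
  have [il|li] := ltnP i l; first by rewrite (is_trig_mxP Tt) ?mul0r.
  by rewrite (is_trig_mxP IH1) ?mulr0 // (leq_ltn_trans li).
rewrite exprS mxE (bigD1 i) //= IH2 -exprS big1 ?addr0 // => l li.
have [il|] := ltnP i l; first by rewrite (is_trig_mxP Tt) ?mul0r.
rewrite leq_eqVlt => /predU1P[/val_inj e|li']; first by rewrite e eqxx in li.
by rewrite (is_trig_mxP IH1) ?mulr0.
Qed.

(** In Schur form the truncated exponential is triangular with diagonal entries [pexp m (T i i)],
    and its determinant is their product. *)
Lemma cvg_det_pexp n (X : 'M[C]_n) :
  (\det (mxpexp m X) : C^o) @[m --> \oo] --> (cexp (\tr X) : C^o).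
Proof.
have [P [T [PP Tt TE _]]] := schur_form X.
set P' := map_mx _ _ in PP TE.
have PP' : P' *m P = 1%:M by apply: mulmx1C.
have XE k : X ^+ k = P' *m T ^+ k *m P.
  elim: k => [|k IH]; first by rewrite !expr0 mulmx1 PP'.
  have eS (Y : 'M[C]_n) : Y ^+ k.+1 = Y *m Y ^+ k by exact: exprS.
  have XT : X *m P' = P' *m T by rewrite TE !mulmxA PP' mul1mx.
  by rewrite !eS IH !mulmxA XT.
have pE m : mxpexp m X = P' *m mxpexp m T *m P.
  rewrite mulmx_sumr mulmx_suml; apply: eq_bigr => k _.
  by rewrite XE -scalemxAr -scalemxAl.
have dE m : \det (mxpexp m X) = \prod_i pexp m (T i i).
  rewrite pE !det_mulmx mulrC mulrA -det_mulmx PP det1 mul1r det_trig.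
    apply: eq_bigr => i _; rewrite summxE; apply: eq_bigr => k _.
    by rewrite mxE (trig_mxX k Tt).2 mulrC.
  apply/is_trig_mxP => i j ij; rewrite summxE big1 // => k _.
  by rewrite mxE (is_trig_mxP (trig_mxX k Tt).1) ?mulr0.
under eq_cvg do rewrite dE.
have -> : \tr X = \tr T.
  by rewrite TE mxtrace_mulC mulmxA PP' mul1mx.
by rewrite /mxtrace cexp_sum; apply: cvg_bigprod => i _; exact: cvg_pexp.
Qed.

Lemma cvg_det_mxg n (X : 'M[C]_n) :
  (\det (1%:M + X *m mxg m X) : C^o) @[m --> \oo] --> (mdet X : C^o).
Proof.
have : (\det (1%:M - X) * \det (mxpexp m X) : C^o) @[m --> \oo] --> (mdet X : C^o).
  by apply: cvgM; [exact: cvg_cst | exact: cvg_det_pexp].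
apply: cvg_trans; apply: near_eq_cvg.
by exists 1%N => // m /= m1; rewrite mxgE // det_mulmx.
Qed.

Lemma mdet_lipschitz n (X X' : 'M[C]_n) s d :
  fro X <= s -> fro X' <= s -> fro (X' - X) <= d -> d * (1 + expR s) <= 4^-1 ->
  nm (mdet X' - mdet X) <= d * mdetK s.
Proof.
move=> Xs Xs' Xd d4; rewrite -[mdet X' - _]subr0.
have h : (\det (1%:M + X' *m mxg m X') - \det (1%:M + X *m mxg m X) : C^o) @[m --> \oo] -->
    (mdet X' - mdet X : C^o) by apply: cvgB; exact: cvg_det_mxg.
apply: (@cvg_nm_le _ C^o _ _ _ _ _ 0 _ h).
exists 2%N => // m /= m1; rewrite subr0; apply: (det_mxg_lipschitz m1) => //.
  exact: fro_mxg.
exact: fro_mxgB.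
Qed.

(** The corner of a product is not the product of the corners. With [P] the coordinate projection
    and [X1] the corner padded by zeros, the determinants become those of [1 + (P X) (g(X) P)] and
    [1 + X1 g(X1)], whose factors are close one by one. *)
Lemma mdet_compress n p m (X : 'M[C]_(n + p)) s d : (1 < m)%N ->
  fro X <= s -> fro (X - block_mx (ulsubmx X) 0 0 0) <= d -> d * (1 + expR s) <= 4^-1 ->
  nm (\det (1%:M + ulsubmx (X *m mxg m X)) -
      \det (1%:M + ulsubmx X *m mxg m (ulsubmx X))) <= d * mdetK s.
Proof.
pose X1 : 'M[C]_(n + p) := block_mx (ulsubmx X) 0 0 0.
rewrite -/X1 => m1 Xs Xd d4.
pose P : 'M[C]_(n + p) := block_mx 1%:M 0 0 0.
have Pfro (Y : 'M[C]_(n + p)) : fro (P *m Y) <= fro Y /\ fro (Y *m P) <= fro Y.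
  rewrite -(submxK Y) !mulmx_block !(mul1mx, mulmx1, mul0mx, mulmx0, addr0).
  rewrite -!(@ler_pXn2r _ 2 _ (fro _)) ?nnegrE ?fro_ge0 // !fro_block !fro0 expr0n /= !addr0.
  set a := fro _; set b := fro _; set c := fro _; set e := fro _.
  have := sqr_ge0 b; have := sqr_ge0 c; have := sqr_ge0 e; split; lra.
have PX1 : P *m X1 = X1 by rewrite mulmx_block !(mul1mx, mul0mx, mulmx0, addr0).
have X1P : X1 *m P = X1 by rewrite mulmx_block !(mulmx1, mul0mx, mulmx0, addr0).
have PXP (Y : 'M[C]_(n + p)) : P *m Y *m P = block_mx (ulsubmx Y) 0 0 0.
  by rewrite -{1}(submxK Y) !mulmx_block !(mul1mx, mulmx1, mul0mx, mulmx0, addr0).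
have X1s : fro X1 <= s.
  rewrite /X1 -PXP; apply: le_trans (Pfro _).2 _; exact: le_trans (Pfro _).1 _.
have X1X k : X1 ^+ k.+1 = block_mx (ulsubmx X ^+ k.+1) 0 0 0.
  elim: k => [|k IH]; first by rewrite !expr1.
  rewrite exprS IH [_ * _]mulmx_block !(mul0mx, mulmx0, addr0).
  by rewrite [ulsubmx X ^+ k.+2]exprS.
have gX1 : mxg m X1 = block_mx (mxg m (ulsubmx X)) 0 0 0.
  rewrite /mxg; elim/big_rec2: _ => [|[[|k] kl] A _ _ ->].
  - by rewrite block_mx_const.
  - by rewrite gcoef0 // !scale0r !add0r.
  - by rewrite X1X scale_block_mx add_block_mx !scaler0 !addr0.
have gP : mxg m X1 *m P = mxg m X1.
  by rewrite gX1 mulmx_block !(mulmx1, mul0mx, mulmx0, addr0).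
have d1 (Y : 'M[C]_n) : \det (1%:M + Y) = \det (1%:M + block_mx Y 0 0 0 : 'M[C]_(n + p)).
  by rewrite scalar_mx_block add_block_mx !addr0 det_ublock det1 mulr1.
rewrite !d1.
have -> : block_mx (ulsubmx (X *m mxg m X)) 0 0 0 = (P *m X) *m (mxg m X *m P).
  by rewrite -PXP !mulmxA.
have -> : block_mx (ulsubmx X *m mxg m (ulsubmx X)) 0 0 0 = X1 *m mxg m X1.
  by rewrite gX1 mulmx_block !(mul0mx, mulmx0, addr0).
apply: (det_mxg_lipschitz m1) => //; first exact: le_trans (Pfro _).1 _.
- exact: fro_mxg.
- by rewrite -{1}PX1 -mulmxBr; apply: le_trans (Pfro _).1 _.
- rewrite -{1}gP -mulmxBl; apply: le_trans (Pfro _).2 _; exact: fro_mxgB.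
Qed.

End ModifiedDet.
(** * Orthonormal systems *)

Section InnerProduct.
Variables (R : realType) (V : completeNormedModType R[i]).
Variable dot : {dot V for conjC}.
Hypothesis Hdot : is_hilbert dot.
Local Notation C := R[i].

Lemma dotDl x y z : dot (x + y) z = dot x z + dot y z.
Proof. by rewrite linearDl. Qed.

Lemma dotBl x y z : dot (x - y) z = dot x z - dot y z.
Proof. by rewrite linearBl. Qed.

Lemma dotZl a x z : dot (a *: x) z = a * dot x z.
Proof. by rewrite linearZl_LR. Qed.

Lemma dot0l z : dot 0 z = 0.
Proof. by rewrite linear0l. Qed.

Lemma dot0r z : dot z 0 = 0.
Proof. by rewrite linear0r. Qed.

Lemma dotC x y : dot x y = (dot y x)^*%C.
Proof. by rewrite (hermC dot) expr0 mul1r. Qed.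

Lemma dotDr x y z : dot z (x + y) = dot z x + dot z y.
Proof. by rewrite linearDr. Qed.

Lemma dotZr a x z : dot z (a *: x) = a^*%C * dot z x.
Proof. by rewrite linearZr_LR. Qed.

Lemma dot_suml I (r : seq I) (P : pred I) (F : I -> V) z :
  dot (\sum_(i <- r | P i) F i) z = \sum_(i <- r | P i) dot (F i) z.
Proof. by apply: (big_morph (fun x => dot x z) (fun x y => dotDl x y z) (dot0l z)). Qed.

Lemma dot_sumr I (r : seq I) (P : pred I) (F : I -> V) z :
  dot z (\sum_(i <- r | P i) F i) = \sum_(i <- r | P i) dot z (F i).
Proof. by apply: (big_morph (fun x => dot z x) (fun x y => dotDr x y z) (dot0r z)). Qed.

Lemma nm_dot x : (nm x ^+ 2)%:C = dot x x.
Proof. by rewrite rmorphXn /= nmE Hdot. Qed.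

Lemma nmD_orth x y : dot x y = 0 -> nm (x + y) ^+ 2 = nm x ^+ 2 + nm y ^+ 2.
Proof.
move=> xy; apply: complexI; rewrite rmorphD /= !nm_dot dotDl !dotDr xy [dot y x]dotC xy.
by rewrite conjc0 addr0 add0r.
Qed.

Lemma dot_CS x y : nm (dot x y) <= nm x * nm y.
Proof.
have [->|y0] := eqVneq y 0; first by rewrite dot0r !nm0 mulr0.
have ny : 0 < nm y by rewrite nm_gt0.
have dy : dot y y != 0 by rewrite -nm_dot -[0]/(0%:C) (inj_eq (@complexI R)) expf_eq0 /= gt_eqF.
pose a := dot x y / dot y y.
have h : nm x ^+ 2 = nm (x - a *: y) ^+ 2 + nm (a *: y) ^+ 2.
  by rewrite -nmD_orth ?subrK // dotZr dotBl dotZl /a divfK // subrr mulr0.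
have : nm (a *: y) ^+ 2 <= nm x ^+ 2 by rewrite h lerDr sqr_ge0.
rewrite ler_pXn2r ?nnegrE ?nm_ge0 // nmZ /a nmM nmV -nm_dot nm_real.
by rewrite ger0_norm ?sqr_ge0 // -mulrA expr2 invfM mulfVK ?gt_eqF // ler_pdivrMr.
Qed.

Lemma cvg_dotl T (F : set_system T) (FF : Filter F) (u : T -> V) l z :
  u x @[x --> F] --> l -> (dot (u x) z : C^o) @[x --> F] --> (dot l z : C^o).
Proof.
move=> ul; apply: (@cvg_nm_squeeze _ C^o _ _ _ _ _ (fun x => nm (u x - l) * nm z)).
  by apply: filterE => x; rewrite -dotBl dot_CS.
rewrite -[0](mul0r (nm z)); apply: cvgM; last exact: cvg_cst.
exact: cvg_nm_dist.
Qed.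

Definition onsys (e : nat -> V) :=
  (forall i, e i = 0 \/ nm (e i) = 1) /\ (forall i j, i != j -> dot (e i) (e j) = 0).

Lemma onb_onsys M e : onb dot M e -> onsys e.
Proof.
move=> [_ h1 h2 _]; split=> // i; have [->|e1] := h1 i; first by left.
by right; apply: complexI; rewrite nmE e1.
Qed.

Definition proj (e : nat -> V) n x : V := \sum_(i < n) dot x (e i) *: e i.

Lemma onb_cvg M e x : onb dot M e -> M x -> proj e n x @[n --> \oo] --> x.
Proof.
move=> [_ _ _ h] /h; rewrite /series /=.
by under eq_cvg do rewrite big_mkord.
Qed.

Section Ortho.
Variable e : nat -> V.
Hypothesis he : onsys e.

Lemma onsys_dot i j x : dot (dot x (e i) *: e i) (e j) = dot x (e j) *+ (i == j).
Proof.
rewrite dotZl; have [<-|ij] := eqVneq i j; last by rewrite he.2 // mulr0.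
have [->|e1] := he.1 i; first by rewrite !dot0r mulr0.
by rewrite -nm_dot e1 expr1n mulr1.
Qed.

Lemma proj_dot n j x : (j < n)%N -> dot (proj e n x) (e j) = dot x (e j).
Proof.
move=> jn; rewrite dot_suml (bigD1 (Ordinal jn)) //= onsys_dot eqxx big1 ?addr0 // => i.
by rewrite -(inj_eq val_inj) /= onsys_dot => /negPf->.
Qed.

Lemma nm_lincomb2 n (a : nat -> C) :
  nm (\sum_(i < n) a i *: e i) ^+ 2 = \sum_(i < n) nm (a i) ^+ 2 * nm (e i) ^+ 2.
Proof.
elim: n => [|n IH]; first by rewrite !big_ord0 nm0 expr0n.
rewrite !big_ord_recr /= nmD_orth ?IH ?nmZ ?exprMn //.
rewrite dot_suml big1 // => i _; rewrite dotZl dotZr he.2 ?mulr0 //.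
by rewrite neq_ltn ltn_ord.
Qed.

Lemma onsys_le1 i : nm (e i) ^+ 2 <= 1.
Proof. by have [->|->] := he.1 i; rewrite ?nm0 ?expr0n // expr1n. Qed.

Lemma nm_lincomb n (a : nat -> C) :
  nm (\sum_(i < n) a i *: e i) ^+ 2 <= \sum_(i < n) nm (a i) ^+ 2.
Proof.
rewrite nm_lincomb2; apply: ler_sum => i _; rewrite -[leRHS]mulr1 ler_wpM2l ?sqr_ge0 //.
exact: onsys_le1.
Qed.

Lemma proj_pyth n x : nm x ^+ 2 = nm (x - proj e n x) ^+ 2 + nm (proj e n x) ^+ 2.
Proof.
rewrite -nmD_orth ?subrK // dot_sumr big1 // => i _.
by rewrite dotZr dotBl proj_dot // subrr mulr0.
Qed.

Lemma nm_proj2 n x : nm (proj e n x) ^+ 2 = \sum_(i < n) nm (dot x (e i)) ^+ 2.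
Proof.
rewrite (nm_lincomb2 n (fun i => dot x (e i))); apply: eq_bigr => i _.
by have [->|->] := he.1 i; rewrite ?dot0r ?nm0 ?expr1n ?mulr1 // expr0n mulr0.
Qed.

Lemma nm_proj n x : nm (proj e n x) <= nm x.
Proof.
by rewrite -(@ler_pXn2r _ 2) ?nnegrE ?nm_ge0 // (proj_pyth n x) lerDr sqr_ge0.
Qed.

Lemma bessel n x : \sum_(i < n) nm (dot x (e i)) ^+ 2 <= nm x ^+ 2.
Proof. by rewrite -nm_proj2 (proj_pyth n x) lerDr sqr_ge0. Qed.

Lemma projB n x y : proj e n (x - y) = proj e n x - proj e n y.
Proof. by rewrite /proj -sumrB; apply: eq_bigr => i _; rewrite dotBl scalerBl. Qed.

Lemma proj_best n x y : proj e n y = y -> nm (x - proj e n x) <= nm (x - y).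
Proof.
move=> yE; have -> : x - proj e n x = (x - y) - proj e n (x - y).
  by rewrite projB yE opprB addrA subrK.
rewrite -(@ler_pXn2r _ 2) ?nnegrE ?nm_ge0 //.
by rewrite [X in _ <= X](proj_pyth n) lerDl sqr_ge0.
Qed.

Lemma projD n x y : proj e n (x + y) = proj e n x + proj e n y.
Proof. by rewrite /proj -big_split; apply: eq_bigr => i _; rewrite dotDl scalerDl. Qed.

Lemma projZ n a x : proj e n (a *: x) = a *: proj e n x.
Proof. by rewrite /proj scaler_sumr; apply: eq_bigr => i _; rewrite dotZl scalerA. Qed.

Lemma proj_onsys n i : proj e n (e i) = e i *+ (i < n).
Proof.
have h j : dot (e i) (e j) *: e j = e i *+ (i == j).
  have [<-|ij] := eqVneq i j; last by rewrite he.2 // scale0r.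
  have [->|e1] := he.1 i; first by rewrite scaler0.
  by rewrite -nm_dot e1 expr1n scale1r.
rewrite /proj; under eq_bigr do rewrite h.
case: ltnP => ni; last by rewrite big1 // => j _; rewrite gtn_eqF // (leq_trans (ltn_ord j)).
rewrite (bigD1 (Ordinal ni)) //= eqxx big1 ?addr0 // => j.
by rewrite -(inj_eq val_inj) /= eq_sym => /negPf->.
Qed.

Lemma proj_lincomb n m (a : nat -> C) : (n <= m)%N ->
  proj e m (\sum_(i < n) a i *: e i) = \sum_(i < n) a i *: e i.
Proof.
move=> nm; elim: n nm => [|n IH] nm.
  by rewrite big_ord0 /proj big1 // => i _; rewrite dot0l scale0r.
by rewrite big_ord_recr /= projD projZ IH ?(ltnW nm) // proj_onsys nm.
Qed.

Lemma proj_proj n m x : (n <= m)%N -> proj e m (proj e n x) = proj e n x.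
Proof. exact: (proj_lincomb (fun i => dot x (e i))). Qed.

End Ortho.

Definition gs_step (d : nat -> V) (s : seq V) : seq V :=
  let y := d (size s) - \sum_(v <- s) dot (d (size s)) v *: v in
  rcons s (`|y|^-1 *: y).

(** Each vector depends on all earlier ones, so the recursion runs over the lists of the vectors
    found so far. *)
Lemma gram_schmidt_rec (d : nat -> V) : exists e : nat -> V, forall n,
  e n = `|d n - proj e n (d n)|^-1 *: (d n - proj e n (d n)).
Proof.
pose s n := iter n (gs_step d) [::].
have sz n : size (s n) = n by elim: n => //= n IH; rewrite size_rcons IH.
pose e n := nth 0 (s n.+1) n.
have snth n i : (i < n)%N -> nth 0 (s n) i = e i.
  elim: n => // n IH; rewrite ltnS leq_eqVlt => /predU1P[->//|ni].
  by rewrite [s n.+1]/(gs_step d (s n)) nth_rcons sz ni IH.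
exists e => n.
have -> : proj e n (d n) = \sum_(v <- s n) dot (d n) v *: v.
  rewrite (big_nth 0) sz big_mkord; apply: eq_bigr => i _.
  by rewrite snth.
by rewrite {1}/e [s n.+1]/(gs_step d (s n)) nth_rcons sz ltnn eqxx.
Qed.

Lemma gram_schmidt (d : nat -> V) : exists2 e : nat -> V, onsys e &
  (forall n k, (k < n)%N -> proj e n (d k) = d k) /\
  forall M : set V, M 0 -> (forall x y, M x -> M y -> M (x + y)) ->
  (forall (a : C) x, M x -> M (a *: x)) -> (forall n, M (d n)) -> forall n, M (e n).
Proof.
have [e eE] := gram_schmidt_rec d.
pose y n := d n - proj e n (d n).
have e01 n : e n = 0 \/ nm (e n) = 1.
  rewrite eE -/(y n); have [->|y0] := eqVneq (y n) 0; first by left; rewrite scaler0.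
  by right; rewrite nmZ nmV /nm normr_id -/(nm _) mulVf // nm_eq0.
have orth n : forall j i, (i < j)%N -> (j < n)%N -> dot (e j) (e i) = 0.
  elim: n => // n IH j i ij; rewrite ltnS leq_eqVlt => /predU1P[jn|jn]; last exact: IH.
  rewrite jn in ij *; pose e' k := if (k < n)%N then e k else 0.
  have he' : onsys e'.
    split=> [k|k l kl]; first by rewrite /e'; case: ifP => _; [exact: e01 | left].
    rewrite /e'; case: ifP => kn; last by rewrite dot0l.
    case: ifP => ln; last by rewrite dot0r.
    have [lk|lk|lk] := ltngtP l k; last by rewrite lk eqxx in kl.
      exact: IH.
    by rewrite dotC IH // conjc0.
  have pe x : proj e n x = proj e' n x.
    by apply: eq_bigr => k _; rewrite /e' ltn_ord.
  have ei : e i = e' i by rewrite /e' ij.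
  by rewrite [e n]eE pe dotZl dotBl ei proj_dot // subrr mulr0.
have he : onsys e.
  split=> // i j; rewrite neq_ltn => /orP[ij|ij].
    by rewrite dotC (orth j.+1) // conjc0.
  exact: orth ij (ltnSn i).
exists e => //; split=> [n k kn|M M0 MD MZ Md n].
  have dk : d k = proj e k (d k) + `|y k| *: e k.
    rewrite [e k]eE -/(y k) scalerA; have [y0|y0] := eqVneq (y k) 0.
      by rewrite y0 scaler0 addr0; apply/eqP; rewrite -subr_eq0 -/(y k) y0.
    by rewrite divff ?normr_eq0 // scale1r /y addrC subrK.
  by rewrite [in LHS]dk projD projZ proj_onsys // kn proj_proj ?(ltnW kn).
have MN x : M x -> M (- x) by move=> Mx; rewrite -scaleN1r; exact: MZ.
have Msum m (F : nat -> V) : (forall i, (i < m)%N -> M (F i)) -> M (\sum_(i < m) F i).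
  elim: m => [|m IH] h; first by rewrite big_ord0.
  by rewrite big_ord_recr /=; apply: (MD); [apply: IH => i im; apply: h; exact: ltnW | exact: h].
have [m] := ubnP n; elim: m n => // m IH n nm; rewrite eE; apply: (MZ); apply: (MD) => //.
apply: MN; apply: (Msum n (fun i => dot (d n) (e i) *: e i)) => i im; apply: MZ; apply: IH.
exact: leq_trans im _.
Qed.

(** Gram-Schmidt is run on an enumeration of [D]. Density then gives convergence of the projections,
    since a projection is the best approximation from its span. *)
Lemma onb_exists (M D : set V) : M 0 -> (forall x y, M x -> M y -> M (x + y)) ->
  (forall (a : C) x, M x -> M (a *: x)) ->
  countable D -> D `<=` M -> M `<=` closure D -> exists e, onb dot M e.
Proof.
move=> M0 MD MZ /countable_injP[f finj] DM MclD.
(* An index that enumerates no point of [D] yields 0, which only creates a padding vector. *)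
pose d n := xget 0 [set x | D x /\ f x = n].
have Md n : M (d n) by rewrite /d; case: xgetP => [x _ [/DM]|].
have Dd x : D x -> d (f x) = x.
  move=> Dx; rewrite /d; case: xgetP => [z _ [Dz fz]|/(_ x)]; last by case.
  by apply: finj => //; exact/mem_set.
have [e he [ed eM]] := gram_schmidt d.
exists e; split=> //.
- exact: eM.
- by move=> i; have [->|e1] := he.1 i; [left|right; rewrite -nmE e1].
- by case: he.
move=> x Mx; have -> : series (fun i => dot x (e i) *: e i) = fun n => proj e n x.
  by apply/funext => n; rewrite /series /= big_mkord.
apply/cvg_nmP => eps eps0.
have epsC : 0 < (eps%:C : C) by rewrite ltcR.
have [z [Dz]] := MclD x Mx _ (nbhsx_ballx x _ epsC).
rewrite -ball_normE /= nm_lt => /ltW zx.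
exists (f z).+1 => // n /= fn; rewrite nmBC; apply: le_trans zx; apply: proj_best => //.
by rewrite -(Dd z Dz) ed.
Qed.

End InnerProduct.

(** * Cauchy criteria *)

Section RealSequences.
Variable R : realType.

Lemma bounded_nondecreasing_cauchy (S : nat -> R) (B : R) :
  (forall m n, (m <= n)%N -> S m <= S n) -> (forall n, S n <= B) ->
  forall eps, 0 < eps -> exists n0, forall n m, (n0 <= n)%N -> (n <= m)%N -> S m - S n <= eps.
Proof.
move=> Smono SB eps eps0.
have cS : cvgn S.
  apply: nondecreasing_is_cvgn; first by move=> m n; exact: Smono.
  by exists B => _ [n _ <-].
have [n0 _ hn0] := (cvgrPdistC_le _ _).1 cS eps eps0.
exists n0 => n m n0n nm.
have Sm : S m <= limn S by apply: nondecreasing_cvgn_le => // i j; exact: Smono.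
have := hn0 n n0n; rewrite ler_norml => /andP[h _].
by rewrite lerBlDr; apply: le_trans Sm _; move: h; rewrite lerNl opprB lerBlDr.
Qed.

Lemma cvgn_nm_cauchy (V : completeNormedModType R[i]) (u : nat -> V) :
  (forall eps : R, 0 < eps -> exists n0, forall n, (n0 <= n)%N -> nm (u n - u n0) <= eps) ->
  cvgn u.
Proof.
move=> h; apply: cauchy_cvg; apply: cauchy_exP => -[eps eps'] epsC.
have eps'0 : eps' = 0 by move: epsC; rewrite ltcE /= => /andP[/eqP->].
move: epsC; rewrite eps'0 complexr0 ltcR => eps0.
have [n0 hn0] := h (eps / 2) (divr_gt0 eps0 (ltr0Sn _ _)).
exists (u n0); exists n0 => // n /= n0n; rewrite -ball_normE /= nm_lt nmBC.
by apply: le_lt_trans (hn0 n n0n) _; rewrite ltr_pdivrMr // ltr_pMr // ltr1n.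
Qed.

Lemma cauchy_complex_cvg (u : nat -> R[i]) :
  (forall eps : R, 0 < eps -> exists n0, forall n, (n0 <= n)%N -> nm (u n - u n0) <= eps) ->
  exists l : R[i], (u n : R[i]^o) @[n --> \oo] --> (l : R[i]^o).
Proof.
move=> h.
have cvgp (p : R[i] -> R) : (forall x y, `|p x - p y| <= nm (x - y)) -> cvgn (p \o u).
  move=> hp; apply: cauchy_cvg; apply: cauchy_exP => eps eps0.
  have [n0 hn0] := h (eps / 2) (divr_gt0 eps0 (ltr0Sn _ _)).
  exists (p (u n0)); exists n0 => // n /= n0n; rewrite -ball_normE /=.
  rewrite distrC; apply: le_lt_trans (hp _ _) _; apply: le_lt_trans (hn0 n n0n) _.
  by rewrite ltr_pdivrMr // ltr_pMr // ltr1n.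
have /cvgp cr (x y : R[i]) : `|complex.Re x - complex.Re y| <= nm (x - y).
  by apply: le_trans (nm_Re _); case: x y => a b [c d].
have /cvgp ci (x y : R[i]) : `|complex.Im x - complex.Im y| <= nm (x - y).
  by apply: le_trans (nm_Im _); case: x y => a b [c d].
by exists (limn (@complex.Re R \o u) +i* limn (@complex.Im R \o u)); exact: cvg_ReIm.
Qed.

End RealSequences.

(** * Finite sections of Hilbert-Schmidt operators *)

Section HilbertSchmidt.
Variables (R : realType) (V : completeNormedModType R[i]).
Variable dot : {dot V for conjC}.
Hypothesis Hdot : is_hilbert dot.
Local Notation C := R[i].
Local Notation onsys := (onsys dot).
Local Notation proj := (proj dot).

(** Bounds on finite partial sums make sense for every operator and every sequence of vectors,
    without a finiteness hypothesis on [hs_norm2]. *)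
Definition hsb (e : nat -> V) (T : V -> V) (c : R) :=
  forall n, \sum_(k < n) nm (T (e k)) ^+ 2 <= c ^+ 2.

Lemma hilbert_schmidt_hsb T : hilbert_schmidt dot T -> hsb (get (onb dot setT)) T (hs_norm dot T).
Proof.
move=> [_ fT] n; rewrite /hs_norm sqr_sqrtr; last first.
  by apply: fine_ge0; apply: nneseries_ge0 => k _ _; rewrite lee_fin sqr_ge0.
rewrite -lee_fin fineK; last first.
  rewrite fin_numE -ltey fT andbT -ltNye; apply: lt_le_trans (ltNyr 0) _.
  by apply: nneseries_ge0 => k _ _; rewrite lee_fin sqr_ge0.
apply: le_trans (nneseries_lim_ge n _); last by move=> k _; rewrite lee_fin sqr_ge0.
by rewrite big_mkord sumEFin.
Qed.

(** An arbitrary bound [c] makes the extended sum finite; only then does [fine] return its true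
    value, so that [hs_norm] is itself a bound. *)
Lemma hsb_norm T c : hsb (get (onb dot setT)) T c ->
  hsb (get (onb dot setT)) T (hs_norm dot T).
Proof.
move=> hT n.
have fT : (hs_norm2 dot T < +oo)%E.
  apply: (@le_lt_trans _ _ (c ^+ 2)%:E); last by rewrite ltry.
  apply: lime_le; first by apply: is_cvg_nneseries => k _ _; rewrite lee_fin sqr_ge0.
  by apply: nearW => m; rewrite big_mkord sumEFin lee_fin.
rewrite /hs_norm sqr_sqrtr; last first.
  by apply: fine_ge0; apply: nneseries_ge0 => k _ _; rewrite lee_fin sqr_ge0.
rewrite -lee_fin fineK; last first.
  rewrite fin_numE -ltey fT andbT -ltNye; apply: lt_le_trans (ltNyr 0) _.
  by apply: nneseries_ge0 => k _ _; rewrite lee_fin sqr_ge0.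
apply: le_trans (nneseries_lim_ge n _); last by move=> k _; rewrite lee_fin sqr_ge0.
by rewrite big_mkord sumEFin.
Qed.

Lemma hsb_triangle e T1 T2 T c1 c2 : 0 <= c1 -> 0 <= c2 ->
  (forall k, nm (T (e k)) <= nm (T1 (e k)) + nm (T2 (e k))) ->
  hsb e T1 c1 -> hsb e T2 c2 -> hsb e T (c1 + c2).
Proof.
move=> c10 c20 hT h1 h2 n.
rewrite -(l2_le (fun k : 'I_n => nm (T (e k)))) ?addr_ge0 //.
apply: (@le_trans _ _ (l2 (fun k : 'I_n => nm (T1 (e k))) + l2 (fun k : 'I_n => nm (T2 (e k))))).
  by apply: l2_triangle => k; rewrite nm_ge0 hT.
by apply: lerD; rewrite l2_le.
Qed.

Lemma hsb_comp e T1 T2 c b : 0 <= b -> (forall k, nm (T2 (e k)) <= b * nm (T1 (e k))) ->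
  hsb e T1 c -> hsb e T2 (b * c).
Proof.
move=> b0 hb h n; rewrite exprMn; apply: le_trans (ler_wpM2l (sqr_ge0 b) (h n)).
rewrite mulr_sumr; apply: ler_sum => k _; rewrite -exprMn.
by rewrite lerXn2r ?nnegrE ?mulr_ge0 ?nm_ge0.
Qed.

Section Compression.
Variables (M : set V) (e : nat -> V) (T : V -> V) (c : R).
Hypotheses (Me : onb dot M e) (c0 : 0 <= c).
Hypotheses (linT : linear T) (conT : continuous T) (MT : forall x, M x -> M (T x)).
Hypothesis hT : hsb e T c.
Let he : onsys e := onb_onsys Me.
HB.instance Definition _ := GRing.isLinear.Build C V V *:%R T linT.

Definition cmp n : 'M[C]_n := \matrix_(i < n, j < n) dot (T (e j)) (e i).

Lemma fro_cmp n : fro (cmp n) <= c.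
Proof.
rewrite fro_le // exchange_big /=; apply: le_trans (hT n); apply: ler_sum => j _.
apply: le_trans (bessel Hdot he n (T (e j))); apply: ler_sum => i _; by rewrite mxE.
Qed.

Lemma ulsubmx_cmp n p : ulsubmx (cmp (n + p)) = cmp n.
Proof. by apply/matrixP => i j; rewrite !mxE. Qed.

(** The sections are nested, so the difference consists of the entries of the larger one outside the
    corner. With monotone boundedness this makes the sections a Cauchy family ([cmp_tail]). *)
Lemma fro_cmp_sub n p : fro (cmp (n + p) - block_mx (cmp n) 0 0 0) ^+ 2 =
  fro (cmp (n + p)) ^+ 2 - fro (cmp n) ^+ 2.
Proof.
rewrite -{1 2}(submxK (cmp (n + p))) ulsubmx_cmp.
have -> : - block_mx (cmp n) 0 0 0 = block_mx (- cmp n) 0 0 0 :> 'M[C]_(n + p).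
  by rewrite opp_block_mx !oppr0.
rewrite add_block_mx subrr !addr0 !fro_block fro0 expr0n /= add0r; ring.
Qed.

Lemma fro_cmp_mono m n : (m <= n)%N -> fro (cmp m) ^+ 2 <= fro (cmp n) ^+ 2.
Proof.
by move=> mn; rewrite -subr_ge0 -(subnKC mn) -fro_cmp_sub sqr_ge0.
Qed.

Lemma cmp_tail eps : 0 < eps -> exists n0, forall n p, (n0 <= n)%N ->
  fro (cmp (n + p) - block_mx (cmp n) 0 0 0) <= eps.
Proof.
move=> eps0; have eps2 : 0 < eps ^+ 2 by rewrite exprn_gt0.
have [] := @bounded_nondecreasing_cauchy R (fun n => fro (cmp n) ^+ 2) (c ^+ 2) fro_cmp_mono _ _ eps2.
  by move=> n; rewrite lerXn2r ?nnegrE ?fro_ge0 ?fro_cmp.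
move=> n0 hn0; exists n0 => n p n0n.
have eps0' := ltW eps0.
rewrite -(@ler_pXn2r _ 2) ?nnegrE ?fro_ge0 // fro_cmp_sub.
by apply: hn0 => //; rewrite leq_addr.
Qed.

Lemma M_iter k x : M x -> M (iter k T x).
Proof. by move=> Mx; elim: k => //= k; exact: MT. Qed.

(** Column [j] of the [l]-th power of a section, read as a vector, arises from [e j] by alternating
    [T] with the projection on the section. Continuity of [T] and convergence of the projections on
    [M] give the limit by induction on [l]. *)
Lemma cvg_cmpX n k (i j : 'I_n) : (0 < k)%N ->
  (ulsubmx (cmp (n + p) ^+ k) i j : C^o) @[p --> \oo] --> (dot (iter k T (e j)) (e i) : C^o).
Proof.
move=> k0; have [eM _ _ _] := Me.
pose y l p := \sum_(a < n + p) (cmp (n + p) ^+ l) a (lshift p j) *: e a.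
have yS l p : y l.+1 p = proj e (n + p) (T (y l p)).
  rewrite /y /proj; apply: eq_bigr => a _; congr (_ *: _).
  rewrite linear_sum dot_suml exprS mxE; apply: eq_bigr => b _.
  by rewrite linearZ dotZl !mxE mulrC.
have cy l : y l p @[p --> \oo] --> iter l T (e j).
  elim: l => [|l IH].
    have -> : y 0%N = fun=> e j; last exact: cvg_cst.
    apply/funext => p; rewrite /y (bigD1 (lshift p j)) //= mxE eqxx scale1r big1 ?addr0 // => a.
    by rewrite mxE => /negPf->; rewrite scale0r.
  have Mx := M_iter l.+1 (eM j).
  have Ty : T (y l p) @[p --> \oo] --> T (iter l T (e j)).
    by apply: (cvg_comp _ _ IH); exact: conT.
  have pc : proj e (n + p) (iter l.+1 T (e j)) @[p --> \oo] --> iter l.+1 T (e j).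
    have := onb_cvg Me Mx; rewrite -(cvg_shiftn n) => h.
    have -> : (fun p => proj e (n + p) (iter l.+1 T (e j))) = (fun p => proj e (p + n) (iter l.+1 T (e j))).
      by apply/funext => p; rewrite addnC.
    exact: h.
  under eq_cvg do rewrite yS.
  apply: (@cvg_nm_squeeze _ _ _ _ _ _ _ (fun p => nm (T (y l p) - T (iter l T (e j))) +
     nm (proj e (n + p) (iter l.+1 T (e j)) - iter l.+1 T (e j)))).
    apply: nearW => p; rewrite -[X in nm (X - _)](subrK (proj e (n + p) (iter l.+1 T (e j)))).
    rewrite -addrA; apply: le_trans (nmD _ _) _; rewrite lerD2r -projB.
    exact: nm_proj.
  by rewrite -[0]addr0; apply: cvgD; apply: cvg_nm_dist.
(* A padding vector makes row [i] of every positive power zero, in agreement with the limit; the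
   zeroth power would have the entry 1 on the diagonal. *)
have [ei|ei] := he.1 i.
  rewrite ei dot0r; have -> : (fun p => ulsubmx (cmp (n + p) ^+ k) i j) = fun=> 0; last exact: cvg_cst.
  apply/funext => p; case: k k0 => // k _; rewrite !mxE exprS mxE big1 // => a _.
  by rewrite !mxE /= ei dot0r mul0r.
have -> : (fun p => ulsubmx (cmp (n + p) ^+ k) i j) = (fun p => dot (y k p) (e i)).
  apply/funext => p; rewrite !mxE /y dot_suml (bigD1 (lshift p i)) //= big1 ?addr0.
    by rewrite dotZl -nm_dot // ei expr1n mulr1.
  move=> a; rewrite -(inj_eq val_inj) /= => ai.
  by rewrite dotZl he.2 ?mulr0.
exact: cvg_dotl.
Qed.

Definition opexpn m x : V := \sum_(k < m) (k`!%:R : C)^-1 *: iter k T x.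

Definition opg m x : V := \sum_(k < m) gcoef R m k *: iter k.+1 T x.

Lemma opgE m x : (0 < m)%N -> opg m x = opexpn m x - T (opexpn m x) - x.
Proof.
case: m => // m _; rewrite /opg; under eq_bigr do rewrite scalerBl.
have -> : T (opexpn m.+1 x) = \sum_(k < m.+1) (k`!%:R : C)^-1 *: iter k.+1 T x.
  by rewrite /opexpn linear_sum; apply: eq_bigr => k _; rewrite linearZ.
rewrite sumrB /opexpn.
rewrite [X in X - _]big_ord_recr /= ltnn scale0r addr0.
rewrite [X in _ = X - _ - _]big_ord_recl /= fact0 invr1 scale1r [RHS]addrAC [x + _]addrC addrK.
by congr (_ - _); apply: eq_bigr => k _; rewrite ltnS ltn_ord /bump leq0n add1n.
Qed.

Lemma op_norm_bound : exists2 b : R, 0 <= b & forall x, nm (T x) <= b * nm x.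
Proof.
have [b b0 hb] : exists2 b : R, 0 < b & forall x, nm x <= b^-1 -> nm (T x) <= 1.
  have /cvg_nmP/(_ 1 ltr01) : T x @[x --> (0 : V)] --> T 0 by exact: conT.
  rewrite linear0.
  move=> /nbhs_ballP[[d d'] /= d0 hd].
  have d'0 : d' = 0 by move: d0; rewrite ltcE /= => /andP[/eqP->].
  move: d0 hd; rewrite d'0 complexr0 ltcR => d0 hd.
  exists (2 / d); rewrite ?divr_gt0 // => x xd.
  have := hd x; rewrite subr0; apply; rewrite -ball_normE /= sub0r normrN nm_lt.
  by apply: le_lt_trans xd _; rewrite invf_div ltr_pdivrMr // ltr_pMr // ltr1n.
exists b => [|x]; first exact: ltW.
have [->|x0] := eqVneq x 0; first by rewrite linear0 !nm0 mulr0.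
have nx : 0 < nm x by rewrite nm_gt0.
have := hb (((b * nm x)^-1)%:C *: x).
have b0' := ltW b0.
rewrite linearZ /= !nmZ nm_real ger0_norm ?invr_ge0 ?mulr_ge0 ?nm_ge0 //.
rewrite invfM -mulrA mulVf ?gt_eqF // mulr1 lexx => /(_ isT).
by rewrite -invfM mulrC ler_pdivrMr ?mulr_gt0 // mul1r.
Qed.

Lemma cvg_opexpn x : opexpn m x @[m --> \oo] --> op_exp T x.
Proof.
have [b b0 hb] := op_norm_bound.
have hbk k : nm (iter k T x) <= b ^+ k * nm x.
  elim: k => [|k IH]; first by rewrite mul1r.
  by apply: le_trans (hb _) _; rewrite exprS -mulrA ler_wpM2l.
have se : series (fun k => (k`!%:R : C)^-1 *: iter k T x) = fun m => opexpn m x.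
  by apply/funext => m; rewrite /series /= big_mkord.
rewrite /op_exp se.
suff : cvgn (fun m => opexpn m x) by [].
apply: cvgn_nm_cauchy => eps eps0.
pose S m : R := (\sum_(k < m) b ^+ k / k`!%:R) * nm x.
have SD m n : (m <= n)%N -> nm (opexpn n x - opexpn m x) <= S n - S m.
  move=> /subnKC <-; move: (n - m)%N => p.
  rewrite /opexpn /S !big_split_ord /= addrAC subrr add0r mulrDl [X in _ <= X]addrAC subrr add0r.
  apply: le_trans (nm_sum _ _ _) _; rewrite mulr_suml; apply: ler_sum => k _.
  by rewrite nmZ nmV nm_fact [_ / _]mulrC -mulrA ler_wpM2l ?invr_ge0.
have Smono m n : (m <= n)%N -> S m <= S n.
  by move=> mn; rewrite -subr_ge0; apply: le_trans (nm_ge0 _) (SD _ _ mn).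
have SB n : S n <= expR b * nm x by rewrite ler_wpM2r ?nm_ge0 // pexp_le.
have [n0 hn0] := bounded_nondecreasing_cauchy Smono SB eps0.
by exists n0 => m n0m; apply: le_trans (SD _ _ n0m) _; exact: hn0.
Qed.

Definition opK x := op_exp T x - T (op_exp T x) - x.

Lemma cvg_opg x : opg m x @[m --> \oo] --> opK x.
Proof.
have : opexpn m x - T (opexpn m x) - x @[m --> \oo] --> opK x.
  apply: cvgB; last exact: cvg_cst.
  apply: cvgB; first exact: cvg_opexpn.
  apply: (cvg_comp _ _ (@cvg_opexpn x)); exact: conT.
apply: cvg_trans; apply: near_eq_cvg.
by exists 1%N => // m /= m1; rewrite opgE.
Qed.

(** With the exponential cut at degree [m], the matrix on the left is the limit over [p] of corners
    in sections of size [n + p], where [mdet_compress] applies. The bound is uniform in [p] and [m],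
    so it survives both limits. *)
Lemma fredholm_matrix_near n d : (forall p, fro (cmp (n + p) - block_mx (cmp n) 0 0 0) <= d) ->
  d * (1 + expR c) <= 4^-1 ->
  nm (\det (\matrix_(i < n, j < n) ((i == j)%:R + dot (opK (e j)) (e i))) - mdet (cmp n)) <=
    d * mdetK c.
Proof.
move=> hd d4.
have h1 m : (1 < m)%N -> nm (\det (\matrix_(i < n, j < n) ((i == j)%:R + dot (opg m (e j)) (e i))) -
     \det (1%:M + cmp n *m mxg m (cmp n))) <= d * mdetK c.
  move=> m1.
  have lim1 : (\det (1%:M + ulsubmx (cmp (n + p) *m mxg m (cmp (n + p)))) : C^o) @[p --> \oo] -->
     (\det (\matrix_(i < n, j < n) ((i == j)%:R + dot (opg m (e j)) (e i))) : C^o).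
    apply: cvg_det => i j; rewrite [X in _ --> X]mxE.
    have -> : (fun p => (1%:M + ulsubmx (cmp (n + p) *m mxg m (cmp (n + p)))) i j) =
      (fun p => (i == j)%:R + \sum_(k < m) gcoef R m k * ulsubmx (cmp (n + p) ^+ k.+1) i j).
      apply/funext => p; set X := cmp (n + p).
      have -> : X *m mxg m X = \sum_(k < m) gcoef R m k *: X ^+ k.+1.
        by rewrite mulmx_sumr; apply: eq_bigr => k _; rewrite -scalemxAr exprS.
      rewrite mxE; congr (_ + _); first by rewrite mxE.
      by rewrite !mxE summxE; apply: eq_bigr => k _; rewrite !mxE.
    apply: cvgD; first exact: cvg_cst.
    rewrite dot_suml; apply: (@cvg_bigsum _ C^o) => k _.
    rewrite dotZl; apply: cvgM; [exact: cvg_cst | exact: cvg_cmpX].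
  apply: (@cvg_nm_le _ C^o _ _ _ _ _ _ _ lim1); apply: nearW => p.
  have := @mdet_compress R n p m (cmp (n + p)) c d m1 (fro_cmp _).
  by rewrite ulsubmx_cmp; apply.
have lim2 : (\det (\matrix_(i < n, j < n) ((i == j)%:R + dot (opg m (e j)) (e i))) -
     \det (1%:M + cmp n *m mxg m (cmp n)) : C^o) @[m --> \oo] -->
   (\det (\matrix_(i < n, j < n) ((i == j)%:R + dot (opK (e j)) (e i))) - mdet (cmp n) : C^o).
  apply: cvgB; last exact: cvg_det_mxg.
  apply: cvg_det => i j; rewrite [X in _ --> X]mxE.
  have -> : (fun m => (\matrix_(i, j) ((i == j)%:R + dot (opg m (e j)) (e i))) i j) =
     (fun m => (i == j)%:R + dot (opg m (e j)) (e i)) by apply/funext => m; rewrite mxE.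
  by apply: cvgD; [exact: cvg_cst | apply: cvg_dotl => //; exact: cvg_opg].
rewrite -[X in nm X]subr0; apply: (@cvg_nm_le _ C^o _ _ _ _ _ _ _ lim2).
by exists 2%N => // m /= m1; rewrite subr0; exact: h1.
Qed.

Lemma mdet_cmp_near n p d : fro (cmp (n + p) - block_mx (cmp n) 0 0 0) <= d ->
  d * (1 + expR c) <= 4^-1 -> nm (mdet (cmp (n + p)) - mdet (cmp n)) <= d * mdetK c.
Proof.
move=> hd d4.
have -> : mdet (cmp n) = mdet (block_mx (cmp n) 0 0 0 : 'M[C]_(n + p)).
  rewrite /mdet mxtrace_block raddf0 addr0; congr (_ * _).
  rewrite scalar_mx_block.
  have -> : - block_mx (cmp n) 0 0 0 = block_mx (- cmp n) 0 0 0 :> 'M[C]_(n + p).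
    by rewrite opp_block_mx !oppr0.
  by rewrite add_block_mx !addr0 det_ublock det1 mulr1.
apply: mdet_lipschitz; rewrite ?fro_cmp //.
apply: le_trans (fro_cmp n); rewrite -(@ler_pXn2r _ 2) ?nnegrE ?fro_ge0 //.
by rewrite fro_block !fro0 expr0n /= !addr0.
Qed.

(** One [d] serves both the smallness condition of the Lipschitz bounds and the requested
    precision. *)
Lemma small_scale eps : 0 < eps -> exists2 d : R, 0 < d &
  d * (1 + expR c) <= 4^-1 /\ d * mdetK c <= eps.
Proof.
move=> eps0; have k0 := mdetK_ge0 c; have e0 := expR_ge0 c.
have a0 : 0 < 4 * (1 + expR c) by rewrite mulr_gt0 // ltr_pwDl.
have b0 : 0 < 1 + mdetK c by rewrite ltr_pwDl.
exists (Num.min (4 * (1 + expR c))^-1 (eps / (1 + mdetK c))).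
  by rewrite lt_min invr_gt0 a0 divr_gt0.
split.
  apply: (@le_trans _ _ ((4 * (1 + expR c))^-1 * (1 + expR c))).
    by rewrite ler_wpM2r ?addr_ge0 // ge_min lexx.
  by rewrite invfM mulfVK // gt_eqF // ltr_pwDl.
apply: (@le_trans _ _ (eps / (1 + mdetK c) * mdetK c)).
  by rewrite ler_wpM2r // ge_min lexx orbT.
by rewrite mulrAC ler_pdivrMr // ler_pM2l // lerDr.
Qed.

Lemma cvg_mdet_cmp : exists l : C, (mdet (cmp n) : C^o) @[n --> \oo] --> (l : C^o).
Proof.
apply: cauchy_complex_cvg => eps eps0.
have [d d0 [d1 d2]] := small_scale eps0; have [n0 hn0] := cmp_tail d0.
exists n0 => n n0n; apply: le_trans d2; rewrite -(subnKC n0n); apply: mdet_cmp_near => //.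
exact: hn0.
Qed.

Lemma fredholm_mdet l : (mdet (cmp n) : C^o) @[n --> \oo] --> (l : C^o) ->
  ((\det (\matrix_(i < n, j < n) ((i == j)%:R + dot (opK (e j)) (e i))) : C^o) @[n --> \oo]) --> (l : C^o).
Proof.
move=> ml; apply/cvg_nmP => eps eps0.
have eps2 : 0 < eps / 2 by rewrite divr_gt0.
have [d d0 [d1 d2]] := small_scale eps2; have [n0 hn0] := cmp_tail d0.
have /cvg_nmP/(_ _ eps2) hml := ml; apply: filterS2 hml (nbhs_infty_ge n0) => n h n0n; rewrite -[X in nm (X - _)](subrK (mdet (cmp n))) -addrA.
apply: le_trans (nmD _ _) _; rewrite [eps]splitr lerD //.
by apply: le_trans d2; apply: fredholm_matrix_near => // p; exact: hn0.
Qed.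

End Compression.

(* det2 without trace class operators: both sides are limits of finite sections, compared
   through the Lipschitz bound on a larger section. *)
Lemma det2_cmp M T c : (exists e, onb dot M e) -> 0 <= c -> bounded_op T ->
  (forall x, M x -> M (T x)) -> hsb (get (onb dot M)) T c ->
  (mdet (cmp (get (onb dot M)) T n) : C^o) @[n --> \oo] --> (det2 dot M T : C^o).
Proof.
move=> [e0 /getI Me] c0 [linT conT] MT hT.
have [l hl] := cvg_mdet_cmp Me c0 hT.
rewrite (_ : det2 dot M T = l) //; apply: cvg_lim => //.
exact: (fredholm_mdet Me c0 linT conT MT hT hl).
Qed.

End HilbertSchmidt.
(** * Change of frame *)

Section Frame.
Variables (R : realType) (V : completeNormedModType R[i]).
Variable dot : {dot V for conjC}.
Hypothesis Hdot : is_hilbert dot.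
Local Notation C := R[i].
Local Notation proj := (proj dot).

Lemma cvg_nm T (F : set_system T) (FF : Filter F) (W : normedModType C) (u : T -> W) l :
  u x @[x --> F] --> l -> nm (u x) @[x --> F] --> nm l.
Proof.
move=> /cvg_nmP h; apply/cvgrPdistC_le => eps eps0; have := h eps eps0; apply: filterS => x.
apply: le_trans; rewrite ler_norml.
have := nmD (l - u x) (u x); have := nmD (u x - l) l; rewrite !subrK [nm (l - _)]nmBC.
lra.
Qed.

Lemma cvg_sum_nm2 T (F : set_system T) (FF : Filter F) (W : normedModType C) n
    (u : 'I_n -> T -> W) (l : 'I_n -> W) :
  (forall i, u i x @[x --> F] --> l i) ->
  \sum_(i < n) nm (u i x) ^+ 2 @[x --> F] --> \sum_(i < n) nm (l i) ^+ 2.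
Proof.
move=> h; elim: n u l h => [|n IH] u l h.
  by rewrite big_ord0; under eq_cvg do rewrite big_ord0; exact: cvg_cst.
rewrite big_ord_recr; under eq_cvg do rewrite big_ord_recr.
by apply: cvgD; [apply: IH => i; exact: h | apply: cvgM; exact: cvg_nm].
Qed.

Lemma cvg_cexp T (F : set_system T) (FF : Filter F) (u : T -> C) (l : C) :
  (u x : C^o) @[x --> F] --> (l : C^o) -> (cexp (u x) : C^o) @[x --> F] --> (cexp l : C^o).
Proof.
move=> ul; have d0 := @cvg_nm_dist _ C^o _ _ FF _ _ ul.
apply: (@cvg_nm_squeeze _ C^o _ _ _ _ _ (fun x => nm (cexp l) * (nm (u x - l) * expR (nm (u x - l))))).
  apply: filterE => x; have -> : cexp (u x) - cexp l = cexp l * (cexp (u x - l) - 1).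
    by rewrite mulrBr mulr1 -cexpD [l + _]addrC subrK.
  by rewrite nmM ler_wpM2l ?nm_ge0 // cexp_near1.
rewrite -(mulr0 (nm (cexp l))); apply: cvgM; first exact: cvg_cst.
rewrite -(mul0r (expR 0)); apply: cvgM => //.
by apply: continuous_cvg => //; exact: continuous_expR.
Qed.

Lemma cvg_mdet n T (F : set_system T) (FF : Filter F) (u : T -> 'M[C]_n) (l : 'M[C]_n) :
  (forall i j, (u x i j : C^o) @[x --> F] --> (l i j : C^o)) ->
  (mdet (u x) : C^o) @[x --> F] --> (mdet l : C^o).
Proof.
move=> h; apply: cvgM.
  apply: cvg_det => i j; rewrite !mxE.
  have -> : (fun x => (1%:M - u x) i j) = (fun x => (1%:M : 'M[C]_n) i j - u x i j).
    by apply/funext => x; rewrite !mxE.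
  by rewrite mxE; apply: cvgB; [exact: cvg_cst | exact: h].
by apply: cvg_cexp; apply: (@cvg_bigsum _ C^o) => i _; exact: h.
Qed.

(** Sylvester's identity, from two factorizations of the block matrix [[[1, X], [Y, 1]]]. It
    replaces a frame matrix of growing size by one of fixed size in [cvg_frame_cut]. *)
Lemma mdet_mulC m n (X : 'M[C]_(m, n)) (Y : 'M[C]_(n, m)) : mdet (X *m Y) = mdet (Y *m X).
Proof.
rewrite /mdet mxtrace_mulC; congr (_ * _).
have h1 : block_mx 1%:M X Y 1%:M = block_mx 1%:M 0 Y 1%:M *m block_mx 1%:M X 0 (1%:M - Y *m X).
  by rewrite mulmx_block !(mul1mx, mulmx1, mul0mx, mulmx0, addr0) addrC subrK.
have h2 : block_mx 1%:M X Y 1%:M = block_mx (1%:M - X *m Y) X 0 1%:M *m block_mx 1%:M 0 Y 1%:M.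
  by rewrite mulmx_block !(mul1mx, mulmx1, mul0mx, mulmx0, addr0, add0r) subrK.
have := congr1 determinant h2; rewrite {}h1 !det_mulmx !det_lblock !det_ublock !det1 !mul1r !mulr1.
by move=> ->.
Qed.

Section Dual.
Variables (e : nat -> V) (g : nat -> V) (n0 : nat) (K : R).
Hypotheses (Me : onb dot setT e) (K0 : 0 <= K).
Hypothesis g_bound : forall m (a : nat -> C),
  nm (\sum_(j < n0 + m) a j *: g j) ^+ 2 <= K * \sum_(j < n0 + m) nm (a j) ^+ 2.
Let he : onsys dot e := onb_onsys Me.

(* By duality: test the functional [phi x = \sum_k dot x (e k) * p k] on the sum of
   the [(phi (g j))^* *: g j]. *)
Lemma functional_bound M m (p : nat -> C) :
  \sum_(j < n0 + m) nm (\sum_(k < M) dot (g j) (e k) * p k) ^+ 2 <= K * \sum_(k < M) nm (p k) ^+ 2.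
Proof.
pose phi x := \sum_(k < M) dot x (e k) * p k.
have phiS (a : nat -> C) : phi (\sum_(j < n0 + m) a j *: g j) = \sum_(j < n0 + m) a j * phi (g j).
  rewrite /phi; under [RHS]eq_bigr do rewrite mulr_sumr; rewrite exchange_big /=.
  apply: eq_bigr => k _; rewrite dot_suml mulr_suml; apply: eq_bigr => j _.
  by rewrite dotZl mulrA.
set t := \sum_(j < n0 + m) _; set q := \sum_(k < M) _.
have t0 : 0 <= t by apply: sumr_ge0 => j _; exact: sqr_ge0.
have q0 : 0 <= q by apply: sumr_ge0 => j _; exact: sqr_ge0.
pose x := \sum_(j < n0 + m) (phi (g j))^*%C *: g j.
have phix : phi x = t%:C.
  rewrite /x (phiS (fun j => (phi (g j))^*%C)) rmorph_sum; apply: eq_bigr => j _.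
  by rewrite mulrC nm_conjM.
have x2 : nm x ^+ 2 <= K * t.
  apply: le_trans (g_bound m (fun j => (phi (g j))^*%C)) _.
  by rewrite ler_wpM2l // ler_sum // => j _; rewrite nm_conj.
have tle : t <= nm x * l2 (fun k : 'I_M => nm (p k)).
  rewrite -[t]ger0_norm // -nm_real -phix; apply: le_trans (nm_sum _ _ _) _.
  under eq_bigr do rewrite nmM; apply: le_trans (l2_CS _ _) _.
  rewrite ler_wpM2r ?l2_ge0 // l2_le ?nm_ge0 //; exact: bessel.
have l2q : l2 (fun k : 'I_M => nm (p k)) ^+ 2 = q by rewrite l2_sqr.
have [->|tn0] := eqVneq t 0; first by rewrite mulr_ge0.
have tp : 0 < t by rewrite lt_def tn0.
rewrite -(ler_pM2l tp) -expr2; apply: (@le_trans _ _ ((nm x * l2 (fun k : 'I_M => nm (p k))) ^+ 2)).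
  by rewrite lerXn2r ?nnegrE ?mulr_ge0 ?nm_ge0 ?l2_ge0.
by rewrite exprMn l2q mulrA [t * K]mulrC ler_wpM2r.
Qed.

Variables (B : V -> V) (b : R).
Hypotheses (linB : linear B) (conB : continuous B) (hB : hsb e B b).
HB.instance Definition _ := GRing.isLinear.Build C V V *:%R B linB.

(** After truncating before and after [B], the sum splits into functionals [x |-> dot (B x) (e l)],
    each controlled by [functional_bound]; the truncations are then removed one at a time. *)
Lemma hsb_dual m : \sum_(j < n0 + m) nm (B (g j)) ^+ 2 <= K * b ^+ 2.
Proof.
have h1 M L : \sum_(j < n0 + m) nm (proj e L (B (proj e M (g j)))) ^+ 2 <= K * b ^+ 2.
  under eq_bigr do rewrite nm_proj2 //.
  rewrite exchange_big /=.
  apply: (@le_trans _ _ (\sum_(l < L) K * \sum_(k < M) nm (dot (B (e k)) (e l)) ^+ 2)).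
    apply: ler_sum => l _; apply: le_trans (functional_bound M m (fun k => dot (B (e k)) (e l))).
    apply: ler_sum => j _; rewrite lerXn2r ?nnegrE ?nm_ge0 //.
    rewrite /proj linear_sum dot_suml le_eqVlt; apply/orP; left; apply/eqP; congr nm.
    by apply: eq_bigr => k _; rewrite linearZ dotZl.
  rewrite -mulr_sumr ler_wpM2l // exchange_big /=; apply: le_trans (hB M).
  by apply: ler_sum => k _; exact: bessel.
have h2 M : \sum_(j < n0 + m) nm (B (proj e M (g j))) ^+ 2 <= K * b ^+ 2.
  apply: (cvgr_to_le (F := \oo) (f := fun L => \sum_(j < n0 + m) nm (proj e L (B (proj e M (g j)))) ^+ 2)).
    by apply: cvg_sum_nm2 => j; exact: (onb_cvg Me).
  exact: nearW.
apply: (cvgr_to_le (F := \oo) (f := fun M => \sum_(j < n0 + m) nm (B (proj e M (g j))) ^+ 2)).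
  apply: cvg_sum_nm2 => j.
  have h : proj e M (g j) @[M --> \oo] --> g j by exact: (onb_cvg Me).
  by apply: (cvg_comp _ _ h); exact: conB.
exact: nearW.
Qed.

End Dual.

Section FrameInvariance.
Variables (e : nat -> V) (A : V -> V) (c : R).
Hypotheses (Me : onb dot setT e) (c0 : 0 <= c).
Hypotheses (linA : linear A) (conA : continuous A) (hA : hsb e A c).
HB.instance Definition _ := GRing.isLinear.Build C V V *:%R A linA.
Let he : onsys dot e := onb_onsys Me.

(** The cut operator has finite rank, so its frame matrices factor through [n] coordinates, while
    the remainder is small in Hilbert-Schmidt norm ([hsb_tail]). *)
Definition cut n x := A (proj e n x).

Lemma cut_linear n : linear (cut n).
Proof. by move=> a x y; rewrite /cut projD projZ linearP. Qed.

Lemma proj_continuous n : continuous (proj e n).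
Proof.
move=> x; apply/cvg_nmP => eps eps0.
have /cvg_nmP/(_ eps eps0) := @cvg_id _ (nbhs x).
by apply: filterS => y; apply: le_trans; rewrite -projB; exact: nm_proj.
Qed.

Lemma cut_continuous n : continuous (cut n).
Proof. by move=> x; apply: continuous_comp; [exact: proj_continuous | exact: conA]. Qed.

Lemma cut_e n k : cut n (e k) = A (e k) *+ (k < n).
Proof. by rewrite /cut proj_onsys // raddfMn. Qed.

Lemma hsb_cut n : hsb e (cut n) c.
Proof.
move=> N; apply: le_trans (hA N); apply: ler_sum => k _; rewrite cut_e.
by case: ltnP; rewrite ?mulr1n // mulr0n nm0 expr0n sqr_ge0.
Qed.

Lemma hsb_tail eps : 0 < eps -> exists n1, forall n, (n1 <= n)%N ->
  hsb e (fun x => A x - cut n x) eps.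
Proof.
move=> eps0; pose S n := \sum_(k < n) nm (A (e k)) ^+ 2.
have Smono m n : (m <= n)%N -> S m <= S n.
  move=> /subnKC <-; rewrite /S big_split_ord /= lerDl sumr_ge0 // => k _; exact: sqr_ge0.
have eps2 : 0 < eps ^+ 2 by rewrite exprn_gt0.
have [n1 hn1] := bounded_nondecreasing_cauchy Smono hA eps2.
exists n1 => n n1n N.
have h k : nm (A (e k) - cut n (e k)) ^+ 2 = nm (A (e k)) ^+ 2 *+ (n <= k).
  rewrite cut_e; case: ltnP; rewrite ?mulr1n ?subrr ?nm0 ?expr0n ?mulr0n //.
  by rewrite subr0.
under eq_bigr do rewrite h.
have [Nn|nN] := leqP N n.
  rewrite big1 ?sqr_ge0 // => k _; rewrite leqNgt (leq_trans (ltn_ord k)) //.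
apply: le_trans (hn1 n N n1n (ltnW nN)).
rewrite -(subnKC (ltnW nN)) /S !big_split_ord /=.
rewrite big1 => [|k _]; last by rewrite leqNgt ltn_ord.
by rewrite add0r addrAC subrr add0r; apply: ler_sum => k _; rewrite leq_addr.
Qed.

Variables (n0 : nat) (g : nat -> V) (ga : nat -> V -> C) (K : R).
Hypotheses (K0 : 0 <= K).
Hypothesis g_bound : forall m (a : nat -> C),
  nm (\sum_(j < n0 + m) a j *: g j) ^+ 2 <= K * \sum_(j < n0 + m) nm (a j) ^+ 2.
Hypothesis ga_bound : forall m x, \sum_(i < n0 + m) nm (ga i x) ^+ 2 <= K * nm x ^+ 2.
Hypothesis gaD : forall i x y, ga i (x + y) = ga i x + ga i y.
Hypothesis gaZ : forall i a x, ga i (a *: x) = a * ga i x.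
Hypothesis ga_rec : forall x, \sum_(i < n0 + m) ga i x *: g i @[m --> \oo] --> x.

(** The sizes [n0 + m] leave room for a leading block of fixed size, later occupied by a basis of
    the range of the projection. *)
Definition frame_mx (B : V -> V) m : 'M[C]_(n0 + m) := \matrix_(i, j) ga i (B (g j)).

Lemma fro_frame_mx B b m : 0 <= b -> linear B -> continuous B -> hsb e B b ->
  fro (frame_mx B m) <= K * b.
Proof.
move=> b0 linB conB hB; rewrite fro_le ?mulr_ge0 // exchange_big /= exprMn expr2 -mulrA.
apply: le_trans (ler_wpM2l K0 (hsb_dual Me K0 g_bound linB conB hB m)).
rewrite mulr_sumr; apply: ler_sum => j _; apply: le_trans (ga_bound m _).
by apply: ler_sum => i _; rewrite mxE.
Qed.

Lemma ga0 i : ga i 0 = 0.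
Proof. by rewrite -[0 in LHS](scale0r (0 : V)) gaZ mul0r. Qed.

Lemma ga_sum i I (r : seq I) (P : pred I) (F : I -> V) :
  ga i (\sum_(k <- r | P k) F k) = \sum_(k <- r | P k) ga i (F k).
Proof. by apply: (big_morph (ga i) (gaD i) (ga0 i)). Qed.

(** The frame matrix is a product [Y X] through [n] coordinates. After [mdet_mulC] the product [X Y]
    has fixed size, and its entries converge by the reconstruction property of the frame. *)
Lemma cvg_frame_cut n :
  (mdet (frame_mx (cut n) m) : C^o) @[m --> \oo] --> (mdet (cmp dot e A n) : C^o).
Proof.
pose X m : 'M[C]_(n, n0 + m) := \matrix_(k, j) dot (g j) (e k).
pose Y m : 'M[C]_(n0 + m, n) := \matrix_(i, k) ga i (A (e k)).
have -> : (fun m => mdet (frame_mx (cut n) m)) = (fun m => mdet (X m *m Y m)).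
  apply/funext => m; rewrite mdet_mulC; congr mdet; apply/matrixP => i j; rewrite !mxE.
  rewrite /cut /proj linear_sum ga_sum; apply: eq_bigr => k _.
  by rewrite linearZ gaZ !mxE mulrC.
apply: cvg_mdet => i j.
have -> : (fun m => (X m *m Y m) i j) = (fun m => dot (\sum_(l < n0 + m) ga l (A (e j)) *: g l) (e i)).
  apply/funext => m; rewrite mxE dot_suml; apply: eq_bigr => l _.
  by rewrite dotZl !mxE mulrC.
by rewrite mxE; apply: cvg_dotl => //; exact: ga_rec.
Qed.

(** A three-term estimate: passing from [A] to [cut n] costs little uniformly in [m], by the
    Lipschitz bound at radius [K * c]; for fixed [n] the frame limit is [cvg_frame_cut]. *)
Lemma frame_mdet l : (mdet (cmp dot e A n) : C^o) @[n --> \oo] --> (l : C^o) ->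
  (mdet (frame_mx A m) : C^o) @[m --> \oo] --> (l : C^o).
Proof.
move=> Al; apply/cvg_nmP => eps eps0.
have eps3 : 0 < eps / 3 by rewrite divr_gt0.
have [d d0 [d1 d2]] := small_scale (K * c) eps3.
have K1 : 0 < 1 + K by rewrite ltr_pwDl.
have b0 : 0 < d / (1 + K) by rewrite divr_gt0.
have [n1 hn1] := hsb_tail b0.
have /cvg_nmP/(_ _ eps3) Al3 := Al.
have [n [ln n1n]] := @filter_ex _ \oo _ _ (filterI Al3 (nbhs_infty_ge n1)).
have /cvg_nmP/(_ _ eps3) := @cvg_frame_cut n; apply: filterS => m hm.
have lin2 : linear (fun x => A x - cut n x).
  by move=> a x y; rewrite linearP cut_linear scalerBr opprD addrACA.
have con2 : continuous (fun x => A x - cut n x).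
  by move=> x; apply: cvgB; [exact: conA | exact: cut_continuous].
have h1 : nm (mdet (frame_mx A m) - mdet (frame_mx (cut n) m)) <= eps / 3.
  apply: le_trans d2; apply: mdet_lipschitz => //.
  - exact: (fro_frame_mx m c0 (@cut_linear n) (@cut_continuous n) (@hsb_cut n)).
  - exact: fro_frame_mx.
  - have -> : frame_mx A m - frame_mx (cut n) m = frame_mx (fun x => A x - cut n x) m.
      by apply/matrixP => i j; rewrite !mxE gaD -[- cut n _]scaleN1r gaZ mulN1r.
    apply: le_trans (fro_frame_mx m (ltW b0) lin2 con2 (hn1 n n1n)) _.
    by rewrite mulrCA ger_pMr // ler_pdivrMr // mul1r lerDr.
set x := mdet (frame_mx A m) in h1 *; set y := mdet (frame_mx _ m) in h1 hm.
set z := mdet (cmp _ _ _ _) in hm ln.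
have -> : x - l = (x - y) + ((y - z) + (z - l)) by rewrite !addrA !subrK.
have := nmD (x - y) ((y - z) + (z - l)); have := nmD (y - z) (z - l).
by move: h1 hm ln; lra.
Qed.

End FrameInvariance.

End Frame.
(** * Block decomposition along a projection *)

Section BlockDeterminant.
Variables (R : realType) (V : completeNormedModType R[i]).
Variable dot : {dot V for conjC}.
Hypothesis Hdot : is_hilbert dot.
Local Notation C := R[i].
Local Notation proj := (proj dot).

Definition compl (P : V -> V) (x : V) := x - P x.

Lemma det2_lipschitz M T T' s d : (exists e, onb dot M e) -> 0 <= s -> 0 <= d ->
  bounded_op T -> bounded_op T' -> (forall x, M x -> M (T x)) -> (forall x, M x -> M (T' x)) ->
  hsb (get (onb dot M)) T s -> hsb (get (onb dot M)) T' s ->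
  hsb (get (onb dot M)) (fun x => T' x - T x) d -> d * (1 + expR s) <= 4^-1 ->
  nm (det2 dot M T' - det2 dot M T) <= d * mdetK s.
Proof.
move=> exM s0 d0 bT bT' MT MT' hT hT' hd d4.
have [e0 /getI Me] := exM.
have h : (mdet (cmp dot (get (onb dot M)) T' n) - mdet (cmp dot (get (onb dot M)) T n) : C^o) @[n --> \oo]
   --> (det2 dot M T' - det2 dot M T : C^o).
  by apply: cvgB; exact: (det2_cmp Hdot exM s0).
rewrite -[X in nm X]subr0; apply: (@cvg_nm_le _ C^o _ _ _ _ _ _ _ h).
apply: nearW => n; rewrite subr0; apply: mdet_lipschitz => //.
- exact: (fro_cmp Hdot Me).
- exact: (fro_cmp Hdot Me).
have -> : cmp dot (get (onb dot M)) T' n - cmp dot (get (onb dot M)) T n =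
   cmp dot (get (onb dot M)) (fun x => T' x - T x) n.
  by apply/matrixP => i j; rewrite !mxE dotBl.
exact: (fro_cmp Hdot Me).
Qed.

Variables (A P : V -> V) (c : R).
Hypotheses (exV : exists e, onb dot setT e) (c0 : 0 <= c) (bA : bounded_op A).
Hypothesis hA : hsb (get (onb dot setT)) A c.
Hypotheses (bP : bounded_op P) (PP : forall x, P (P x) = P x).
Local Notation Q := (compl P).
Hypothesis exM : exists e, onb dot (range Q) e.
HB.instance Definition _ := GRing.isLinear.Build C V V *:%R A bA.1.
HB.instance Definition _ := GRing.isLinear.Build C V V *:%R P bP.1.

Lemma compl_linear : linear Q.
Proof. by move=> a x y; rewrite /compl linearP scalerBr opprD addrACA. Qed.
HB.instance Definition _ := GRing.isLinear.Build C V V *:%R Q compl_linear.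

Lemma AD x y : A (x + y) = A x + A y.
Proof. by rewrite linearD. Qed.

Lemma complD x y : Q (x + y) = Q x + Q y.
Proof. by rewrite linearD. Qed.

Lemma compl_continuous : continuous Q.
Proof. by move=> x; apply: cvgB; [exact: cvg_id | exact: bP.2]. Qed.

Lemma rangeQP x : range Q x <-> P x = 0.
Proof.
split=> [[y _ <-]|Px]; first by rewrite /compl linearB /= PP subrr.
by exists x; rewrite // /compl Px subr0.
Qed.

Lemma rangeQ_id x : range Q x -> Q x = x.
Proof. by move=> /rangeQP; rewrite /compl => ->; rewrite subr0. Qed.

Lemma bounded_QAQ : bounded_op (Q \o A \o Q).
Proof.
split=> [a x y|x]; first by rewrite /= !linearP.
apply: continuous_comp; first exact: compl_continuous.
by apply: continuous_comp; [exact: bA.2 | exact: compl_continuous].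
Qed.

Local Notation e' := (get (onb dot (range Q))).
Lemma compl_onb : onb dot (range Q) e'.
Proof. by have [e0 /getI] := exM. Qed.

Lemma compl_onb_id k : Q (e' k) = e' k.
Proof. by apply: rangeQ_id; case: compl_onb. Qed.

(** An orthonormal basis of a subspace satisfies the frame bound with constant 1, so [hsb_dual]
    transfers the Hilbert-Schmidt bound without loss. *)
Lemma hsb_compl T t : linear T -> continuous T -> 0 <= t ->
  hsb (get (onb dot setT)) T t -> hsb e' T t.
Proof.
move=> linT conT t0 hT n; have [e0 /getI Me] := exV.
rewrite -[t ^+ 2]mul1r; apply: (@hsb_dual _ _ _ Hdot _ _ 0 1 Me ler01 _ _ _ linT conT hT n).
by move=> m a; rewrite mul1r; apply: nm_lincomb => //; exact: onb_onsys compl_onb.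
Qed.

Variables (n0 : nat) (b : 'I_n0 -> V) (be : 'I_n0 -> V -> C) (kb : R).
Hypotheses (kb0 : 0 <= kb) (be_bound : forall i x, nm (be i x) <= kb * nm x).
Hypothesis beD : forall i x y, be i (x + y) = be i x + be i y.
Hypothesis beZ : forall i a x, be i (a *: x) = a * be i x.
Hypothesis P_be : forall x, P x = \sum_i be i x *: b i.

(* The basis [b] of [range P] followed by an orthonormal basis of [range Q], with the
   corresponding coordinates. *)
Definition bframe (j : nat) : V := if insub j is Some i then b i else e' (j - n0)%N.
Definition bcoord (j : nat) (x : V) : C := if insub j is Some i then be i x else dot (Q x) (e' (j - n0)%N).
Local Notation g := bframe.
Local Notation ga := bcoord.

Lemma bframe_l (j : 'I_n0) : g j = b j.
Proof. by rewrite /bframe valK. Qed.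

Lemma bframe_r k : g (n0 + k)%N = e' k.
Proof. by rewrite /bframe insubF ?addKn // ltnNge leq_addr. Qed.

Lemma bcoord_l (j : 'I_n0) x : ga j x = be j x.
Proof. by rewrite /bcoord valK. Qed.

Lemma bcoord_r k x : ga (n0 + k)%N x = dot (Q x) (e' k).
Proof. by rewrite /bcoord insubF ?addKn // ltnNge leq_addr. Qed.

Lemma nmD2 (x y : V) : nm (x + y) ^+ 2 <= 2 * nm x ^+ 2 + 2 * nm y ^+ 2.
Proof.
have := nmD x y; have := nm_ge0 x; have := nm_ge0 y; have := nm_ge0 (x + y).
by have := sqr_ge0 (nm x - nm y); nra.
Qed.

Local Notation G := (\sum_i nm (b i) ^+ 2).

Lemma bframe_bound m (a : nat -> C) :
  nm (\sum_(j < n0 + m) a j *: g j) ^+ 2 <= (2 * G + 2) * \sum_(j < n0 + m) nm (a j) ^+ 2.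
Proof.
rewrite !big_split_ord /=; under eq_bigr do rewrite bframe_l.
under [X in nm (_ + X)]eq_bigr do rewrite bframe_r.
apply: le_trans (nmD2 _ _) _.
have h1 : nm (\sum_(i < n0) a i *: b i) ^+ 2 <= G * \sum_(i < n0) nm (a i) ^+ 2.
  rewrite mulrC; apply: le_trans (cauchy_schwarz_sum _ _).
  have S0 : 0 <= \sum_(i < n0) nm (a i) * nm (b i).
    by apply: sumr_ge0 => i _; rewrite mulr_ge0 ?nm_ge0.
  rewrite lerXn2r ?nnegrE ?nm_ge0 //.
  by apply: le_trans (nm_sum _ _ _) _; apply: ler_sum => i _; rewrite nmZ.
have h2 := nm_lincomb Hdot (onb_onsys compl_onb) m (fun k => a (n0 + k)%N).
have G0 : 0 <= G by apply: sumr_ge0 => i _; exact: sqr_ge0.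
move: h1 h2; set x := nm _ ^+ 2; set y := nm _ ^+ 2; set s := \sum_(i < n0) nm (a i) ^+ 2; set t := \sum_(i < m) _; set q := G in G0 *.
have s0 : 0 <= s by apply: sumr_ge0 => i _; exact: sqr_ge0.
have t0 : 0 <= t by apply: sumr_ge0 => i _; exact: sqr_ge0.
by nra.
Qed.

Lemma compl_bound : exists2 kq : R, 0 <= kq & forall x, nm (Q x) <= kq * nm x.
Proof. exact: op_norm_bound compl_linear compl_continuous. Qed.

Lemma bcoord_bound : exists2 k : R, 0 <= k & forall m x, \sum_(i < n0 + m) nm (ga i x) ^+ 2 <= k * nm x ^+ 2.
Proof.
have [kq kq0 hq] := compl_bound.
exists (n0%:R * kb ^+ 2 + kq ^+ 2) => [|m x]; first by rewrite addr_ge0 ?mulr_ge0 ?sqr_ge0.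
rewrite big_split_ord /= mulrDl; apply: lerD.
  rewrite -mulrA -exprMn mulr_natl -[n0 in _ *+ n0]card_ord -sumr_const; apply: ler_sum => i _.
  by rewrite /= bcoord_l lerXn2r ?nnegrE ?mulr_ge0 ?nm_ge0.
under eq_bigr do rewrite bcoord_r; apply: le_trans (bessel Hdot (onb_onsys compl_onb) m (Q x)) _.
by rewrite -exprMn lerXn2r ?nnegrE ?mulr_ge0 ?nm_ge0.
Qed.

Lemma bcoord_rec x : \sum_(i < n0 + m) ga i x *: g i @[m --> \oo] --> x.
Proof.
have -> : (fun m => \sum_(i < n0 + m) ga i x *: g i) = (fun m => P x + proj e' m (Q x)).
  apply/funext => m; rewrite big_split_ord /= P_be; congr (_ + _).
    by apply: eq_bigr => i _; rewrite bcoord_l bframe_l.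
  by apply: eq_bigr => i _; rewrite bcoord_r bframe_r.
suff h : P x + proj e' m (Q x) @[m --> \oo] --> P x + Q x.
  by move: h; rewrite (_ : P x + Q x = x) // /compl addrC subrK.
apply: cvgD; first exact: cvg_cst.
by apply: (onb_cvg compl_onb); exists x.
Qed.

Lemma bcoordD i x y : ga i (x + y) = ga i x + ga i y.
Proof. by rewrite /bcoord; case: insub => [j|]; rewrite ?beD // linearD dotDl. Qed.

Lemma bcoordZ i a x : ga i (a *: x) = a * ga i x.
Proof. by rewrite /bcoord; case: insub => [j|]; rewrite ?beZ // linearZ dotZl. Qed.

Lemma block_frame_cvg :
  (mdet (frame_mx n0 g ga A m) : C^o) @[m --> \oo] --> (det2 dot setT A : C^o).
Proof.
have [k k0 hk] := bcoord_bound; have [e0 /getI Me] := exV.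
have G0 : 0 <= G by apply: sumr_ge0 => i _; exact: sqr_ge0.
have K0 : 0 <= 2 * G + 2 + k by rewrite !addr_ge0 ?mulr_ge0.
apply: (frame_mdet Hdot Me c0 bA.1 bA.2 hA K0) => [m a|m x||||].
- apply: le_trans (bframe_bound m a) _; rewrite ler_wpM2r ?lerDl //.
  by apply: sumr_ge0 => i _; exact: sqr_ge0.
- apply: le_trans (hk m x) _; rewrite ler_wpM2r ?sqr_ge0 // lerDr.
  by rewrite addr_ge0 ?mulr_ge0.
- exact: bcoordD.
- exact: bcoordZ.
- exact: bcoord_rec.
- exact: (det2_cmp Hdot exV c0 bA _ hA).
Qed.

Lemma fro_block_frame : exists2 k : R, 0 <= k & forall m, fro (frame_mx n0 g ga A m) <= k.
Proof.
have [k k0 hk] := bcoord_bound; have [e0 /getI Me] := exV.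
have G0 : 0 <= G by apply: sumr_ge0 => i _; exact: sqr_ge0.
have K0 : 0 <= 2 * G + 2 + k by rewrite !addr_ge0 ?mulr_ge0.
exists ((2 * G + 2 + k) * c) => [|m]; first exact: mulr_ge0.
apply: (fro_frame_mx Hdot Me K0) => //; [| |exact: bA.1|exact: bA.2].
- move=> j a; apply: le_trans (bframe_bound j a) _; rewrite ler_wpM2r ?lerDl //.
  by apply: sumr_ge0 => i _; exact: sqr_ge0.
- move=> j x; apply: le_trans (hk j x) _; rewrite ler_wpM2r ?sqr_ge0 // lerDr.
  by rewrite addr_ge0 ?mulr_ge0.
Qed.

Variable w : 'I_n0 -> V.
Hypothesis Pw : forall j, P (w j) = 0.
Hypothesis Aw : forall j, Q (A (b j + w j)) = w j.

Lemma be0 i : be i 0 = 0.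
Proof. by rewrite -[0 in LHS](scale0r (0 : V)) beZ mul0r. Qed.

Lemma be_sum i I (r : seq I) (p : pred I) (F : I -> V) :
  be i (\sum_(k <- r | p k) F k) = \sum_(k <- r | p k) be i (F k).
Proof. by apply: (big_morph (be i) (beD i) (be0 i)). Qed.

Lemma cvg_be i T (F : set_system T) (FF : Filter F) (u : T -> V) l :
  u x @[x --> F] --> l -> (be i (u x) : C^o) @[x --> F] --> (be i l : C^o).
Proof.
move=> ul; apply: (@cvg_nm_squeeze _ C^o _ _ _ _ _ (fun x => kb * nm (u x - l))).
  by apply: filterE => x; rewrite -mulN1r -beZ -beD scaleN1r.
rewrite -(mulr0 kb); apply: cvgM; first exact: cvg_cst.
exact: cvg_nm_dist.
Qed.

Definition blk_a : 'M[C]_n0 := \matrix_(i, j) be i (A (b j)).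
Definition blk_s : 'M[C]_n0 := \matrix_(i, j) ((i == j)%:R - be i (A (b j + w j))).
Definition blk_b m : 'M[C]_(n0, m) := \matrix_(i, j) be i (A (e' j)).
Definition blk_c m : 'M[C]_(m, n0) := \matrix_(i, j) dot (Q (A (b j))) (e' i).
Definition blk_d m : 'M[C]_m := cmp dot e' (Q \o A \o Q) m.
Definition blk_w m : 'M[C]_(m, n0) := \matrix_(i, j) dot (w j) (e' i).
(** The matrix for which [1 - blk_X m] is [1] minus the frame matrix, times the column operation
    [[[1, 0], [blk_w m, 1]]]. Since [blk_w m] holds only finitely many coordinates of [w], the lower
    left block is small rather than zero; [blk_Y m] is the exactly triangular companion. *)
Definition blk_X m : 'M[C]_(n0 + m) := block_mx (blk_a + blk_b m *m blk_w m) (blk_b m) (blk_c m - (1%:M - blk_d m) *m blk_w m) (blk_d m).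
Definition blk_Y m : 'M[C]_(n0 + m) := block_mx (1%:M - blk_s) (blk_b m) 0 (blk_d m).

Lemma frame_block m : frame_mx n0 g ga A m = block_mx blk_a (blk_b m) (blk_c m) (blk_d m).
Proof.
rewrite -[LHS]submxK; congr block_mx; apply/matrixP => i j; rewrite !mxE.
- by rewrite bcoord_l bframe_l.
- by rewrite bcoord_l bframe_r.
- by rewrite bcoord_r bframe_l.
- by rewrite bcoord_r bframe_r /= compl_onb_id.
Qed.

(** The column operation has determinant 1, but it changes the trace, and with it the exponential
    factor of [mdet]. *)
Lemma mdet_blk_X m : mdet (blk_X m) = mdet (frame_mx n0 g ga A m) * cexp (\tr (blk_b m *m blk_w m)).
Proof.
rewrite frame_block /mdet /blk_X !mxtrace_block raddfD /= -mulrA -cexpD.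
rewrite [\tr blk_a + \tr (blk_d m) + _]addrAC; congr (_ * _).
pose U : 'M[C]_(n0 + m) := block_mx 1%:M 0 (blk_w m) 1%:M.
have dU : \det U = 1 by rewrite det_lblock !det1 mulr1.
transitivity (\det (1%:M - block_mx blk_a (blk_b m) (blk_c m) (blk_d m)) * \det U); last by rewrite dU mulr1.
rewrite -det_mulmx; congr (\det _).
rewrite scalar_mx_block.
have oB (x : 'M[C]_n0) y z (t : 'M[C]_m) : - block_mx x y z t = block_mx (- x) (- y) (- z) (- t).
  by rewrite opp_block_mx.
rewrite !oB !add_block_mx !add0r /U mulmx_block !(mulmx1, mulmx0, add0r).
congr block_mx; first by rewrite opprD addrA mulNmx.
by rewrite opprB addrC.
Qed.

Lemma mdet_blk_Y m : mdet (blk_Y m) = \det blk_s * cexp (\tr (1%:M - blk_s)) * mdet (blk_d m).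
Proof.
rewrite /mdet /blk_Y mxtrace_block cexpD scalar_mx_block.
have -> : - block_mx (1%:M - blk_s) (blk_b m) 0 (blk_d m) = block_mx (- (1%:M - blk_s)) (- blk_b m) 0 (- blk_d m).
  by rewrite opp_block_mx oppr0.
rewrite add_block_mx !addr0 det_ublock opprB addrC subrK; ring.
Qed.

Lemma cvg_projw j : proj e' m (w j) @[m --> \oo] --> w j.
Proof. by apply: (onb_cvg compl_onb); apply/rangeQP; exact: Pw. Qed.

Lemma bw_entry m i j : (blk_b m *m blk_w m) i j = be i (A (proj e' m (w j))).
Proof.
rewrite mxE /proj linear_sum be_sum; apply: eq_bigr => k _.
by rewrite linearZ beZ !mxE mulrC.
Qed.

Lemma cvg_Aprojw j : A (proj e' m (w j)) @[m --> \oo] --> A (w j).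
Proof. by apply: (cvg_comp _ _ (@cvg_projw j)); exact: bA.2. Qed.

Lemma cvg_tr_bw : (\tr (blk_b m *m blk_w m) : C^o) @[m --> \oo] --> (\tr (1%:M - blk_s) - \tr blk_a : C^o).
Proof.
rewrite -raddfB /=; apply: (@cvg_bigsum _ C^o) => i _.
under eq_cvg do rewrite bw_entry.
have -> : (1%:M - blk_s - blk_a) i i = be i (A (w i)) by rewrite !mxE AD beD; ring.
by apply: cvg_be; exact: cvg_Aprojw.
Qed.

Lemma lower_entry m i j : (blk_c m - (1%:M - blk_d m) *m blk_w m) i j =
  dot (Q (A (b j + proj e' m (w j))) - w j) (e' i).
Proof.
have dw : (blk_d m *m blk_w m) i j = dot (Q (A (proj e' m (w j)))) (e' i).
  rewrite mxE /proj linear_sum linear_sum dot_suml; apply: eq_bigr => k _.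
  by rewrite !mxE linearZ linearZ dotZl mulrC /= compl_onb_id.
rewrite mulmxBl mul1mx opprB [LHS]mxE [X in _ + X]mxE dw !mxE AD complD.
by rewrite (dotBl _ (Q (A (b j)) + _) (w j)) (dotDl _ (Q (A (b j)))) addrA.
Qed.

(** Each column of the lower left block lists coordinates of one vector, which tends to 0 by the
    equation [Aw]. Bessel's inequality bounds the column at once, although its length grows with
    [m]. *)
Lemma fro_blk_XY eps : 0 < eps -> \forall m \near \oo, fro (blk_X m - blk_Y m) <= eps.
Proof.
move=> eps0.
pose u m := \sum_i \sum_(j < n0) nm (be i (A (proj e' m (w j))) - be i (A (w j))) ^+ 2 +
   \sum_j nm (Q (A (b j + proj e' m (w j))) - w j) ^+ 2.
have cu : u m @[m --> \oo] --> (0 : R).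
  rewrite -[0]addr0; apply: cvgD.
    have e0 : \sum_(i < n0) \sum_(j < n0) (nm (0 : C)) ^+ 2 = 0 by rewrite nm0 expr0n big1 // => i _; rewrite big1.
    rewrite -[X in _ --> X]e0; apply: (cvg_big (op := +%R)) => [|i _]; first exact: add_continuous.
    apply: (@cvg_sum_nm2 _ _ _ _ C^o) => j.
    rewrite -(subrr (be i (A (w j)))); apply: cvgB; last exact: cvg_cst.
    by apply: cvg_be; exact: cvg_Aprojw.
  have e0 : \sum_(j < n0) (nm (0 : V)) ^+ 2 = 0 by rewrite nm0 expr0n big1.
  rewrite -[X in _ --> X]e0; apply: cvg_sum_nm2 => j.
  suff h2 : Q (A (b j + proj e' m (w j))) @[m --> \oo] --> Q (A (b j + w j)).
    rewrite Aw in h2; rewrite -(subrr (w j)); apply: cvgB; [exact: h2 | exact: cvg_cst].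
  have h : A (b j + proj e' m (w j)) @[m --> \oo] --> A (b j + w j).
    rewrite AD; under eq_cvg do rewrite AD.
    by apply: cvgD; [exact: cvg_cst | exact: cvg_Aprojw].
  by apply: (cvg_comp _ _ h); exact: compl_continuous.
have eps2 : 0 < eps ^+ 2 by rewrite exprn_gt0.
have /cvgrPdistC_le/(_ _ eps2) := cu; apply: filterS => m; rewrite subr0 => um.
rewrite -(@ler_pXn2r _ 2) ?nnegrE ?fro_ge0 //; last exact: ltW.
apply: le_trans (le_trans (ler_norm _) um).
have -> : blk_X m - blk_Y m = block_mx (blk_a + blk_b m *m blk_w m - (1%:M - blk_s)) 0
    (blk_c m - (1%:M - blk_d m) *m blk_w m) 0.
  by rewrite opp_block_mx add_block_mx !subrr subr0.
rewrite fro_block !fro0 expr0n /= !addr0 !fro_sqr; apply: lerD.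
  apply: ler_sum => i _; apply: ler_sum => j _.
  rewrite [(_ - (1%:M - blk_s)) i j]mxE [(blk_a + _) i j]mxE bw_entry !mxE AD beD.
  set x1 := be i (A (b j)); set y1 := be i _; set z1 := be i _; set dl := _%:R.
  by have -> : x1 + y1 - (dl - (dl - (x1 + z1))) = y1 - z1 by ring.
rewrite exchange_big /=; apply: ler_sum => j _.
under eq_bigr do rewrite lower_entry.
exact: (bessel Hdot (onb_onsys compl_onb) m (Q (A (b j + proj e' m (w j))) - w j)).
Qed.

(** The limit of [mdet (blk_Y m)] carries the exponential of the trace of [1%:M - blk_s]; undoing
    the trace change of the column operation cancels it and leaves the trace of the uncorrected
    block [blk_a]. *)
Lemma block_det : det2 dot setT A =
  det2 dot (range Q) (Q \o A \o Q) * cexp (\sum_i be i (A (b i))) *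
  \det (\matrix_(i, j) ((i == j)%:R - be i (A (b j + w j)))).
Proof.
have [kq kq0 hq] := compl_bound.
have hQA : hsb e' (Q \o A \o Q) (kq * c).
  apply: (@hsb_comp _ _ _ A) => // [k|]; first by rewrite /= compl_onb_id.
  exact: (hsb_compl bA.1 bA.2 c0 hA).
have MQ x : range Q x -> range Q ((Q \o A \o Q) x) by move=> _; exists (A (Q x)).
have cd : (mdet (blk_d m) : C^o) @[m --> \oo] --> (det2 dot (range Q) (Q \o A \o Q) : C^o).
  exact: (det2_cmp Hdot exM (mulr_ge0 kq0 c0) bounded_QAQ MQ hQA).
have cY : (mdet (blk_Y m) : C^o) @[m --> \oo] -->
    (\det blk_s * cexp (\tr (1%:M - blk_s)) * det2 dot (range Q) (Q \o A \o Q) : C^o).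
  under eq_cvg do rewrite mdet_blk_Y.
  by apply: cvgM; [exact: cvg_cst | exact: cd].
have [k k0 hk] := fro_block_frame.
have hY m : fro (blk_Y m) <= fro (1%:M - blk_s) + k.
  rewrite -(@ler_pXn2r _ 2) ?nnegrE ?addr_ge0 ?fro_ge0 //.
  rewrite /blk_Y fro_block fro0 expr0n /= add0r.
  have : fro (frame_mx n0 g ga A m) ^+ 2 <= k ^+ 2 by rewrite lerXn2r ?nnegrE ?fro_ge0.
  rewrite frame_block fro_block; have := fro_ge0 (1%:M - blk_s).
  have := sqr_ge0 (fro blk_a); have := sqr_ge0 (fro (blk_c m)); nra.
have cX : (mdet (blk_X m) : C^o) @[m --> \oo] -->
    (\det blk_s * cexp (\tr (1%:M - blk_s)) * det2 dot (range Q) (Q \o A \o Q) : C^o).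
  apply/cvg_nmP => eps eps0; have eps2 : 0 < eps / 2 by rewrite divr_gt0.
  have [d d0 [d1 d2]] := small_scale (fro (1%:M - blk_s) + k + 1) eps2.
  have dp : 0 < Num.min d 1 by rewrite lt_min d0 ltr01.
  have /cvg_nmP/(_ _ eps2) := cY; have := fro_blk_XY dp; apply: filterS2 => m hXY hY2.
  have [hXY1 hXY2] : fro (blk_X m - blk_Y m) <= d /\ fro (blk_X m - blk_Y m) <= 1.
    by move: hXY; rewrite le_min => /andP[].
  rewrite -[X in nm (X - _)](subrK (mdet (blk_Y m))) -addrA [eps]splitr.
  apply: le_trans (nmD _ _) _; apply: lerD => //; apply: le_trans d2.
  apply: mdet_lipschitz => //; first by rewrite (le_trans (hY m)) // lerDl.
  by rewrite -[blk_X m](subrK (blk_Y m)) addrC; apply: le_trans (froD _ _) _; exact: lerD.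
have cF : (mdet (blk_X m) * cexp (- \tr (blk_b m *m blk_w m)) : C^o) @[m --> \oo] -->
    (\det blk_s * cexp (\tr (1%:M - blk_s)) * det2 dot (range Q) (Q \o A \o Q) *
     cexp (- (\tr (1%:M - blk_s) - \tr blk_a)) : C^o).
  apply: cvgM; first exact: cX.
  by apply: cvg_cexp; apply: (@cvgN _ C^o); exact: cvg_tr_bw.
have eF : (fun m => mdet (blk_X m) * cexp (- \tr (blk_b m *m blk_w m))) = (fun m => mdet (frame_mx n0 g ga A m)).
  by apply/funext => m; rewrite mdet_blk_X -mulrA -cexpD subrr cexp0 mulr1.
rewrite eF in cF.
rewrite (cvg_unique _ block_frame_cvg cF) //.
have -> : \sum_i be i (A (b i)) = \tr blk_a by apply: eq_bigr => i _; rewrite mxE.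
rewrite -/blk_s opprB [_ - \tr (1%:M - blk_s)]addrC cexpD.
have e1 : cexp (\tr (1%:M - blk_s)) * cexp (- \tr (1%:M - blk_s)) = 1.
  by rewrite -cexpD subrr cexp0.
set p := cexp (\tr (1%:M - blk_s)) in e1 *; set q := cexp (- _) in e1 *.
transitivity (\det blk_s * det2 dot (range Q) (Q \o A \o Q) * cexp (\tr blk_a) * (p * q)); first by ring.
by rewrite e1; ring.
Qed.

End BlockDeterminant.

(** * Riemann sums of Lipschitz functions *)

Section RiemannSums.
Variable R : realType.
Local Notation mu := (@lebesgue_measure R).

Lemma continuous_integrable_segment (g : R -> R) a b : continuous g ->
  mu.-integrable `[a, b] (EFin \o g).
Proof.
move=> cg; apply: continuous_compact_integrable; first exact: segment_compact.
exact: continuous_subspaceT.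
Qed.

(** The mean value theorem applied to the primitive of [g]. *)
Lemma integral_mean (g : R -> R) a x y : continuous g -> 0 <= x -> x <= y -> y <= a ->
  exists2 c, x <= c <= y &
   (\int[mu]_(t in `[0, y]) g t - \int[mu]_(t in `[0, x]) g t)%R = g c * (y - x).
Proof.
move=> cg x0 xy ya; have a0 : 0 <= a by rewrite (le_trans x0) // (le_trans xy).
have [||c] := @MVT_segment R (fun x => \int[mu]_(t in `[0, x]) g t)%R g x y xy.
- move=> z; rewrite in_itv /= => /andP[xz zy].
  have z0 : 0 < z by apply: le_lt_trans xz.
  have [] := @continuous_FTC1 R g (BLeft 0) z (z + 1) (ltr_pwDr ltr01 (lexx z)).
  + exact: continuous_integrable_segment.
  + by rewrite /= lte_fin.
  + exact: cg.
  by move=> dz <-; rewrite derive1E; exact: derivableP.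
- have := parameterized_integral_continuous a0 (continuous_integrable_segment 0 a cg).
  apply: continuous_subspaceW => t /=; rewrite !in_itv /= => /andP[xt ty].
  by rewrite (le_trans x0 xt) (le_trans ty ya).
- by rewrite in_itv /= => cxy h; exists c.
Qed.

Lemma riemann_sum (g : R -> R) (a L : R) n (t : nat -> R) : 0 < a -> 0 <= L ->
  (forall x y, `|x - y| <= a -> `|g x - g y| <= L * `|x - y|) -> (0 < n)%N ->
  (forall k, (k < n)%N -> a / n%:R * k%:R <= t k <= a / n%:R * k.+1%:R) ->
  `|\int[mu]_(x in `[0, a]) g x - a / n%:R * \sum_(k < n) g (t k)|%R <= L * a ^+ 2 / n%:R.
Proof.
move=> a0 L0 gL n0 ht; set h := a / n%:R.
have nR : 0 < n%:R :> R by rewrite ltr0n.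
have h0 : 0 < h by rewrite divr_gt0.
have nh : h * n%:R = a by rewrite divfK // gt_eqF.
have cg : continuous g.
  move=> x; apply/cvgrPdistC_le => eps eps0.
  have d0 : 0 < Num.min a (eps / (L + 1)) by rewrite lt_min a0 divr_gt0 // ltr_wpDl.
  exists (Num.min a (eps / (L + 1))) => //= y /=; rewrite lt_min distrC => /andP[ya ye].
  apply: le_trans (gL y x (ltW ya)) _.
  apply: (@le_trans _ _ (L * (eps / (L + 1)))); first by rewrite ler_wpM2l // ltW.
  by rewrite mulrA ler_pdivrMr ?ltr_wpDl // mulrC ler_pM2l // lerDl.
pose F x := (\int[mu]_(t in `[0, x]) g t)%R.
have F0 : F 0 = 0 by rewrite /F set_itv1 Rintegral_set1.
have -> : (\int[mu]_(x in `[0, a]) g x)%R = \sum_(k < n) (F (h * k.+1%:R) - F (h * k%:R)).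
  rewrite -(big_mkord xpredT (fun k => F (h * k.+1%:R) - F (h * k%:R))).
  by rewrite telescope_sumr // mulr0 F0 subr0 nh.
rewrite mulr_sumr -sumrB; apply: le_trans (ler_norm_sum _ _ _) _.
have -> : L * a ^+ 2 / n%:R = \sum_(k < n) L * h ^+ 2.
  rewrite sumr_const card_ord -mulr_natr /h; field.
  by rewrite gt_eqF.
apply: ler_sum => k _.
have kh : h * k%:R <= h * k.+1%:R by rewrite ler_wpM2l ?ler_nat // ltW.
have ka : h * k.+1%:R <= a by rewrite -nh ler_wpM2l ?ler_nat // ltW.
have [|c /andP[c1 c2] ->] := integral_mean cg _ kh ka; first by rewrite mulr_ge0 // ltW.
have hk : h * k.+1%:R - h * k%:R = h by rewrite -mulrBr -natr1 addrAC subrr add0r mulr1.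
have -> : L * h ^+ 2 = h * (L * h) by ring.
rewrite hk mulrC -mulrBr normrM (gtr0_norm h0) ler_pM2l //.
have /andP[t1 t2] := ht k (ltn_ord k).
have ct : `|c - t k| <= h by rewrite ler_norml; move: hk; rewrite -/h in t1 t2; lra.
have a0' := ltW a0; have ha : h <= a by rewrite /h ler_pdivrMr // ler_peMr // ler1n.
apply: le_trans (gL c (t k) (le_trans ct ha)) _.
by rewrite ler_wpM2l.
Qed.

(** Composing [g] with the clamp to [[0, a]] gives a function that is Lipschitz on the whole line,
    as [riemann_sum] requires, and has the same integral and sums. *)
Lemma riemann_sum_itv (g : R -> R) (a L : R) n (t : nat -> R) : 0 < a -> 0 <= L ->
  (forall x y, 0 <= x <= a -> 0 <= y <= a -> `|g x - g y| <= L * `|x - y|) -> (0 < n)%N ->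
  (forall k, (k < n)%N -> a / n%:R * k%:R <= t k <= a / n%:R * k.+1%:R) ->
  `|\int[mu]_(x in `[0, a]) g x - a / n%:R * \sum_(k < n) g (t k)|%R <= L * a ^+ 2 / n%:R.
Proof.
move=> a0 L0 gL n0 ht; have a0' := ltW a0.
pose clamp (x : R) := Num.max 0 (Num.min a x).
have c_itv x : 0 <= clamp x <= a by rewrite le_max lexx ge_max a0' ge_min lexx.
have c_id x : 0 <= x <= a -> clamp x = x.
  by move=> /andP[x0 xa]; rewrite /clamp (min_idPr xa) (max_idPr x0).
have c_lip x y : `|clamp x - clamp y| <= `|x - y|.
  wlog xy : x y / x <= y => [hw|].
    by have [/hw//|/ltW/hw] := leP x y; rewrite distrC [`|y - x|]distrC.
  rewrite distrC [`|x - y|]distrC [`|y - x|]ger0_norm ?subr_ge0 // /clamp !maxEle !minEle.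
  case: (lerP a y) => h1; case: (lerP a x) => h2; rewrite ?a0';
    case: (lerP 0 y) => h3; case: (lerP 0 x) => h4; rewrite ler_norml; lra.
have tk k : (k < n)%N -> 0 <= t k <= a.
  move=> kn; have /andP[t1 t2] := ht k kn; apply/andP; split.
    by apply: le_trans t1; rewrite mulr_ge0 ?divr_ge0.
  apply: le_trans t2 _; rewrite mulrAC ler_pdivrMr ?ltr0n ?(leq_ltn_trans _ kn) //.
  by rewrite ler_wpM2l // ler_nat.
have := @riemann_sum (g \o clamp) a L n t a0 L0 _ n0 ht.
have -> : (\int[mu]_(x in `[0, a]) (g \o clamp) x)%R = (\int[mu]_(x in `[0, a]) g x)%R.
  by apply: eq_Rintegral => x /set_mem; rewrite /= in_itv /= => /c_id ->.
under eq_bigr => k _ do rewrite /= c_id ?tk //.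
apply => x y _ /=; apply: le_trans (gL _ _ (c_itv x) (c_itv y)) _.
exact: ler_wpM2l.
Qed.

Lemma cis_lipschitz (s t : R) : nm (cis s - cis t) <= `|s - t| * expR `|s - t|.
Proof.
have -> : cis s - cis t = cis t * (cis (s - t) - 1).
  by rewrite mulrBr mulr1 -cisD [t + _]addrC subrK.
have -> : cis (s - t) = cexp (0 +i* (s - t)) by rewrite /cexp /= expR0 mul1r.
rewrite nmM nm_cis mul1r; apply: le_trans (cexp_near1 _) _.
have -> // : nm (0 +i* (s - t)) = `|s - t|.
have -> : 0 +i* (s - t) = 'i%C * (s - t)%:C by simpc.
rewrite nmM nm_real; suff -> : nm ('i%C : R[i]) = 1 by rewrite mul1r.
by have := nm_cis (pi / 2 : R); rewrite /cis cos_pihalf sin_pihalf.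
Qed.

End RiemannSums.

(** * The Riesz projection *)

Section RieszProjection.
Variables (R : realType) (V : completeNormedModType R[i]).
Variable dot : {dot V for conjC}.
Hypothesis Hdot : is_hilbert dot.
Local Notation C := R[i].
Variables (A P : V -> V) (lam : C) (r : R).
Hypotheses (bA : bounded_op A) (r_iso : isolating_radius A lam r).
Hypothesis P_riesz : riesz_projection dot A lam r P.
HB.instance Definition _ := GRing.isLinear.Build C V V *:%R A bA.1.

Let r0 : 0 < r := r_iso.1.

Definition circ t : C := lam + r%:C * cis t.

Definition resv t := resolvent A (circ t).

Lemma resvP t : is_resolvent A (circ t) (resv t).
Proof.
apply: getPex; apply: contrapT => nres.
have := r_iso.2 (circ t) nres; rewrite /circ addrAC subrr add0r.
rewrite nm_le nmM nm_cis mulr1 nm_real (gtr0_norm r0) lexx => /(_ isT).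
move=> /eqP; rewrite -subr_eq0 addrAC subrr add0r -nm_eq0 nmM nm_cis mulr1 nm_real.
by rewrite (gtr0_norm r0) gt_eqF.
Qed.

Lemma resv_linear t : linear (resv t).
Proof. by have [[]] := resvP t. Qed.
HB.instance Definition _ t := GRing.isLinear.Build C V V *:%R (resv t) (resv_linear t).

Lemma resvD t x y : resv t (x + y) = resv t x + resv t y.
Proof. by rewrite (linearD (resv t)). Qed.

Lemma resvZ t a x : resv t (a *: x) = a *: resv t x.
Proof. by rewrite linearZ. Qed.

Lemma resvK t x : resv t (A x - circ t *: x) = x.
Proof. by have [_ ->] := resvP t. Qed.

Lemma resvA t x : A (resv t x) - circ t *: resv t x = x.
Proof. by have [_ _ ->] := resvP t. Qed.

Lemma resv_comm t x : resv t (A x) = A (resv t x).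
Proof.
have := resvK t x; rewrite linearB linearZ /= => /eqP; rewrite subr_eq => /eqP->.
by rewrite -{1}(resvA t x) subrK.
Qed.

Lemma resv_identity s t x :
  resv s x - resv t x = (circ s - circ t) *: resv s (resv t x).
Proof.
rewrite -{1}(resvA t x).
have -> : A (resv t x) - circ t *: resv t x =
  (A (resv t x) - circ s *: resv t x) + (circ s - circ t) *: resv t x.
  by rewrite scalerBl addrA subrK.
by rewrite resvD resvK resvZ addrAC subrr add0r.
Qed.

Lemma circ_lipschitz s t : nm (circ s - circ t) <= r * (`|s - t| * expR `|s - t|).
Proof.
rewrite /circ opprD addrACA subrr add0r -mulrBr nmM nm_real (gtr0_norm r0).
by rewrite ler_pM2l // cis_lipschitz.
Qed.

(** Compactness of the parameter interval: by the resolvent identity a bound [b] at [t] gives the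
    bound [2 * b] at all nearby parameters. *)
Lemma resv_bound : exists2 c : R, 0 <= c & forall t x, 0 <= t <= 2 * pi -> nm (resv t x) <= c * nm x.
Proof.
have [+ _] := @compact_near_coveringP R `[0, 2 * pi].
move=> /(_ (@segment_compact _ _ _)) cover.
have cov : \forall c \near +oo, `[0, 2 * pi] `<=` [set t | forall x, nm (resv t x) <= c * nm x].
  apply: (cover R (pinfty_nbhs R) (fun c t => forall x, nm (resv t x) <= c * nm x)) => t _.
  have [[_ conT] _ _] := resvP t.
  have [b b0 hb] := op_norm_bound (resv_linear t) conT.
  have e0 := expR_gt0 (1 : R).
  have B0 : 0 < 2 * r * expR 1 * (b + 1) by rewrite !mulr_gt0 // ltr_wpDl.
  (* The radius makes [nm (circ t - circ s) * b] at most one half; the minimum with 1 keeps the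
     exponential factor below [expR 1]. *)
  have d0 : 0 < Num.min 1 (2 * r * expR 1 * (b + 1))^-1 by rewrite lt_min ltr01 invr_gt0.
  exists (ball t (Num.min 1 (2 * r * expR 1 * (b + 1))^-1), [set c | 2 * b <= c]).
    split; first exact: nbhsx_ballx.
    exact: nbhs_pinfty_ge (num_real _).
  move=> [s c] /= [ts bc] x.
  have /andP[ts1 ts2] : (`|t - s| <= 1) && (`|t - s| <= (2 * r * expR 1 * (b + 1))^-1).
    by rewrite -le_min; exact: ltW ts.
  have ex : expR `|t - s| <= expR 1 by rewrite ler_expR.
  have dz : nm (circ t - circ s) * b <= 2^-1.
    apply: (@le_trans _ _ (r * ((2 * r * expR 1 * (b + 1))^-1 * expR 1) * (b + 1))).
      apply: ler_pM; rewrite ?nm_ge0 ?lerDl //.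
      apply: le_trans (circ_lipschitz t s) _; rewrite ler_pM2l //.
      by apply: ler_pM; rewrite ?expR_ge0.
    rewrite le_eqVlt; apply/orP; left; apply/eqP; field.
    by rewrite !gt_eqF // ltr_wpDl.
  have h : nm (resv s x) <= b * nm x + 2^-1 * nm (resv s x).
    have e : resv s x = resv t x - (circ t - circ s) *: resv t (resv s x).
      by rewrite -resv_identity opprB addrC subrK.
    rewrite [X in nm X <= _]e.
    apply: le_trans (nmB _ _) _; apply: lerD => //; rewrite nmZ.
    apply: le_trans (ler_wpM2l (nm_ge0 _) (hb _)) _.
    by rewrite mulrA; apply: ler_wpM2r; rewrite ?nm_ge0.
  have : 2 * b * nm x <= c * nm x by rewrite ler_wpM2r ?nm_ge0.
  lra.
have [c [cpos hc]] := filter_ex (filterI (nbhs_pinfty_ge (num_real 0)) cov).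
by exists c => // t x t01; apply: hc; rewrite /= in_itv.
Qed.

Lemma resv_lipschitz (c : R) s t x : 0 <= c ->
  (forall t x, 0 <= t <= 2 * pi -> nm (resv t x) <= c * nm x) ->
  0 <= s <= 2 * pi -> 0 <= t <= 2 * pi ->
  nm (resv s x - resv t x) <= r * expR (2 * pi) * c ^+ 2 * `|s - t| * nm x.
Proof.
move=> c0 hc hs ht; rewrite resv_identity nmZ.
have st : `|s - t| <= 2 * pi.
  by move: hs ht => /andP[s0 s1] /andP[t0 t1]; rewrite ler_norml; lra.
have -> : r * expR (2 * pi) * c ^+ 2 * `|s - t| * nm x =
   (r * (`|s - t| * expR (2 * pi))) * (c * (c * nm x)) by ring.
apply: ler_pM; rewrite ?nm_ge0 //.
  apply: le_trans (circ_lipschitz s t) _; rewrite ler_pM2l // ler_wpM2l //.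
  by rewrite ler_expR.
apply: le_trans (hc _ _ hs) _; apply: ler_wpM2l => //; exact: hc.
Qed.

Definition node (th : R) n k : R := th + 2 * pi / n%:R * k%:R.

(* Trapezoidal rule for the Riesz projection, with nodes shifted by [th].  In terms of
   [B = (A - lam) / r] it is [(I - exp(- i n th) B ^ n)^-1], see [tproj_inv]. *)
Definition tproj th n x : V :=
  - (n%:R^-1 *: \sum_(k < n) (r%:C * cis (node th n k)) *: resv (node th n k) x).

(** A Riemann sum for the reduced resolvent, the contour integral of [(A - zeta)^-1 / (zeta - lam)]
    divided by [2 pi i]. *)
Definition tres th n x : V := n%:R^-1 *: \sum_(k < n) resv (node th n k) x.

Lemma node_itv th n k : 0 <= th <= 2 * pi / n%:R -> (k < n)%N ->
  2 * pi / n%:R * k%:R <= node th n k <= 2 * pi / n%:R * k.+1%:R.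
Proof.
move=> /andP[th0 th1] kn; rewrite /node.
have -> : 2 * pi / n%:R * k.+1%:R = 2 * pi / n%:R + 2 * pi / n%:R * k%:R :> R.
  by rewrite -[k.+1%:R]natr1 mulrDr mulr1 addrC.
by rewrite lerDr th0 lerD2r.
Qed.

Lemma node_itv0 th n k : 0 <= th <= 2 * pi / n%:R -> (k < n)%N -> 0 <= node th n k <= 2 * pi.
Proof.
move=> hth kn; have /andP[h1 h2] := node_itv hth kn.
have p0 : 0 <= 2 * pi :> R by rewrite mulr_ge0 ?pi_ge0.
apply/andP; split.
  by apply: le_trans h1; rewrite mulr_ge0 ?divr_ge0.
apply: le_trans h2 _; rewrite mulrAC ler_pdivrMr ?ltr0n ?(leq_ltn_trans _ kn) //.
by rewrite ler_wpM2l // ler_nat.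
Qed.

(** Matrix elements of the sum are Riemann sums of a Lipschitz integrand, with error proportional to
    [nm x * nm y]. Taking for [y] the vector [P x - tproj th n x] turns this weak estimate into one
    in norm. *)
Lemma tproj_near : exists2 K : R, 0 <= K & forall th n x, (0 < n)%N ->
  0 <= th <= 2 * pi / n%:R -> nm (P x - tproj th n x) <= K / n%:R * nm x.
Proof.
have [c c0 hc] := resv_bound.
pose E := expR (2 * pi : R); have E0 : 0 < E by exact: expR_gt0.
have p0 : 0 < (pi : R) by exact: pi_gt0.
pose L := r * E * c ^+ 2 * r + c * r * E.
have L0 : 0 <= L by rewrite addr_ge0 ?mulr_ge0 ?sqr_ge0 ?(ltW r0) ?(ltW E0).
exists (4 * pi * L) => [|th n x n0 hth]; first by rewrite !mulr_ge0 // ltW.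
have nR : 0 < n%:R :> R by rewrite ltr0n.
suff key y : nm (dot (P x - tproj th n x) y) <= 4 * pi * L / n%:R * nm x * nm y.
  set v := P x - tproj th n x; have := key v; rewrite -/v -nm_dot // nm_real ger0_norm ?sqr_ge0 //.
  have [->|v0] := eqVneq v 0.
    by rewrite nm0 => _; rewrite !mulr_ge0 ?invr_ge0 ?nm_ge0 // ltW.
  by rewrite expr2 ler_pM2r // nm_gt0.
pose h t := dot (resv t x) y * ('i%C * (r%:C * cis t)).
pose M := L * nm x * nm y.
have M0 : 0 <= M by rewrite !mulr_ge0 ?nm_ge0.
have hL s t : 0 <= s <= 2 * pi -> 0 <= t <= 2 * pi -> nm (h s - h t) <= M * `|s - t|.
  move=> hs ht.
  have st : `|s - t| <= 2 * pi.
    by move: hs ht => /andP[s0 s1] /andP[t0 t1]; rewrite ler_norml; lra.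
  have ni : nm ('i%C : C) = 1.
    by have := nm_cis (pi / 2 : R); rewrite /cis cos_pihalf sin_pihalf.
  have -> : h s - h t = dot (resv s x - resv t x) y * ('i%C * (r%:C * cis s)) +
      dot (resv t x) y * ('i%C * (r%:C * (cis s - cis t))).
    by rewrite /h dotBl; ring.
  apply: le_trans (nmD _ _) _; rewrite !nmM !ni !mul1r nm_cis mulr1 nm_real (gtr0_norm r0).
  have -> : M * `|s - t| = (r * E * c ^+ 2 * `|s - t| * nm x) * nm y * r +
      (c * nm x) * nm y * (r * (`|s - t| * E)) by rewrite /M /L; ring.
  apply: lerD.
    apply: ler_wpM2r; first exact: ltW.
    apply: le_trans (dot_CS Hdot _ _) _; apply: ler_wpM2r; rewrite ?nm_ge0 //.
    exact: resv_lipschitz.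
  apply: ler_pM; rewrite ?nm_ge0 ?mulr_ge0 ?nm_ge0 ?(ltW r0) //.
    apply: le_trans (dot_CS Hdot _ _) _; apply: ler_wpM2r; rewrite ?nm_ge0 //.
    exact: hc.
  rewrite ler_pM2l //; apply: le_trans (cis_lipschitz _ _) _.
  by rewrite ler_wpM2l // ler_expR.
have tn k : (k < n)%N -> 2 * pi / n%:R * k%:R <= node th n k <= 2 * pi / n%:R * k.+1%:R.
  exact: node_itv.
have pp0 : 0 < 2 * pi :> R by rewrite mulr_gt0.
pose S := \sum_(k < n) h (node th n k).
pose I := cintegral 0 (2 * pi) h.
have eP : dot (P x) y = - (2 * pi%:C * 'i%C)^-1 * I by exact: P_riesz.
have eT : dot (tproj th n x) y = - (2 * pi%:C * 'i%C)^-1 * ((2 * pi / n%:R)%:C * S).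
  rewrite /tproj -scaleN1r !dotZl // dot_suml /S !mulr_sumr; apply: eq_bigr => k _.
  rewrite dotZl /h.
  have -> : (2 * pi / n%:R)%:C = 2 * pi%:C / n%:R :> C.
    by rewrite !rmorphM /= fmorphV /= !(rmorph_nat (real_complex R)).
  have i0 : ('i%C : C) != 0 by rewrite eq_complex /= oner_eq0 andbF.
  have pC0 : (pi%:C : C) != 0 by rewrite eq_complex /= gt_eqF.
  have nC0 : (n%:R : C) != 0 by rewrite pnatr_eq0 -lt0n.
  move: i0 pC0 nC0; move: ('i%C) (pi%:C) (n%:R) (_ * cis _) (dot _ _) => i p N q D i0 pC0 nC0.
  by field; rewrite i0 pC0 nC0.
have ReL (s t : C) : complex.Re s - complex.Re t = complex.Re (s - t) by case: s => a b; case: t.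
have ImL (s t : C) : complex.Im s - complex.Im t = complex.Im (s - t) by case: s => a b; case: t.
have Resum (F : 'I_n -> C) : complex.Re (\sum_(k < n) F k) = \sum_(k < n) complex.Re (F k).
  by apply: (big_morph (@complex.Re R) (id1 := 0) (op1 := +%R)) => [[a b] [a' b']|].
have Imsum (F : 'I_n -> C) : complex.Im (\sum_(k < n) F k) = \sum_(k < n) complex.Im (F k).
  by apply: (big_morph (@complex.Im R) (id1 := 0) (op1 := +%R)) => [[a b] [a' b']|].
have ReZ (a : R) (z : C) : complex.Re (a%:C * z) = a * complex.Re z.
  by case: z => u v /=; rewrite mul0r subr0.
have ImZ (a : R) (z : C) : complex.Im (a%:C * z) = a * complex.Im z.
  by case: z => u v /=; rewrite mul0r addr0.
have hRI : nm (I - (2 * pi / n%:R)%:C * S) <= 2 * (M * (2 * pi) ^+ 2 / n%:R).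
  apply: le_trans (nm_ReIm _) _; set X := M * _ / _; have -> : 2 * X = X + X by ring.
  apply: lerD.
    have := @riemann_sum_itv R (fun t => complex.Re (h t)) (2 * pi) M n (node th n) pp0 M0 _ n0 tn.
    rewrite -ReL ReZ /S Resum; apply => s t hs ht.
    by rewrite ReL; apply: le_trans (nm_Re _) (hL _ _ hs ht).
  have := @riemann_sum_itv R (fun t => complex.Im (h t)) (2 * pi) M n (node th n) pp0 M0 _ n0 tn.
  rewrite -ImL ImZ /S Imsum; apply => s t hs ht.
  by rewrite ImL; apply: le_trans (nm_Im _) (hL _ _ hs ht).
rewrite dotBl eP eT -mulrBr nmM nmN nmV !nmM nm_nat nm_real (gtr0_norm p0).
have -> : nm ('i%C : C) = 1.
  by have := nm_cis (pi / 2 : R); rewrite /cis cos_pihalf sin_pihalf.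
rewrite mulr1 mulrC ler_pdivrMr //; apply: le_trans hRI _.
rewrite le_eqVlt; apply/orP; left; apply/eqP; rewrite /M; ring.
Qed.

Definition shiftA x := A x - lam *: x.

Lemma shiftA_linear : linear shiftA.
Proof.
move=> a x y; rewrite /shiftA linearP scalerDr scalerA mulrC -scalerA.
by rewrite scalerBr opprD addrACA.
Qed.
HB.instance Definition _ := GRing.isLinear.Build C V V *:%R shiftA shiftA_linear.

Lemma resv_shift t x : resv t (shiftA x - (r%:C * cis t) *: x) = x.
Proof. by rewrite -[RHS](resvK t x) /shiftA /circ scalerDl opprD addrA. Qed.

Lemma resv_shiftC t x : resv t (shiftA x) = shiftA (resv t x).
Proof. by rewrite /shiftA -scaleN1r resvD !resvZ resv_comm scaleN1r. Qed.

(** The geometric sum for [(B ^ n - rho ^ n) / (B - rho)] with [B = shiftA]. *)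
Lemma resv_geometric t n x (rho := r%:C * cis t) :
  resv t (iter n shiftA x - rho ^+ n *: x) = \sum_(j < n) rho ^+ (n.-1 - j) *: iter j shiftA x.
Proof.
elim: n => [|n IH]; first by rewrite big_ord0 expr0 scale1r subrr -[0 in LHS](scale0r (0 : V)) resvZ scale0r.
have -> : iter n.+1 shiftA x - rho ^+ n.+1 *: x =
  (shiftA (iter n shiftA x) - rho *: iter n shiftA x) + rho *: (iter n shiftA x - rho ^+ n *: x).
  by rewrite scalerBr scalerA -exprS addrA subrK.
rewrite resvD resvZ IH resv_shift big_ord_recr /= subnn expr0 scale1r addrC; congr (_ + _).
rewrite scaler_sumr; apply: eq_bigr => j _; rewrite scalerA -exprS; congr (_ ^+ _ *: _).
by case: n j {IH} => [[]//|n] j /=; rewrite subSn // -ltnS ltn_ord.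
Qed.

Lemma tproj_linear th n : linear (tproj th n).
Proof.
move=> a x y; rewrite /tproj scalerN -opprD; congr (- _).
rewrite scalerA mulrC -scalerA -scalerDr; congr (_ *: _).
rewrite scaler_sumr -big_split; apply: eq_bigr => k _.
by rewrite resvD resvZ scalerDr !scalerA [a * _]mulrC.
Qed.
HB.instance Definition _ th n := GRing.isLinear.Build C V V *:%R (tproj th n) (tproj_linear th n).

Lemma tproj_comm th n x : tproj th n (shiftA x) = shiftA (tproj th n x).
Proof.
have sN y : shiftA (- y) = - shiftA y by exact: linearN.
have sZ a y : shiftA (a *: y) = a *: shiftA y by rewrite linearZ.
rewrite /tproj sN sZ [shiftA (\sum_(k < n) _)]linear_sum; congr (- _); congr (_ *: _).
by apply: eq_bigr => k _; rewrite resv_shiftC -sZ.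
Qed.

Lemma tres_shift th n x : (0 < n)%N -> shiftA (tres th n x) = x - tproj th n x.
Proof.
move=> n0; have nC0 : (n%:R : C) != 0 by rewrite pnatr_eq0 -lt0n.
rewrite /tres /tproj linearZ /= linear_sum opprK.
apply: (scalerI nC0); rewrite scalerDr !scalerA divff // !scale1r.
rewrite scaler_nat -[n in x *+ n]card_ord -sumr_const -big_split; apply: eq_bigr => k _ /=.
by rewrite -resv_shiftC -{2}(resv_shift (node th n k) x) -scaleN1r resvD !resvZ scaleN1r subrK.
Qed.

Definition powA n x := (r%:C ^+ n)^-1 *: iter n shiftA x.

(** All nodes share the same [n]-th power [rho ^ n], so the geometric sums can be added. Summing
    [rho ^ (n - j)] over the nodes gives 0 for [0 < j < n], and only [j = 0] remains. *)
Lemma tproj_inv th n x : (0 < n)%N ->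
  tproj th n (x - (cis (th * n%:R))^-1 *: powA n x) = x.
Proof.
move=> n0; have nC0 : (n%:R : C) != 0 by rewrite pnatr_eq0 -lt0n.
have rC0 : (r%:C : C) != 0 by rewrite eq_complex /= gt_eqF.
have cu t : cis t != 0 :> C by rewrite -nm_eq0 nm_cis oner_eq0.
set sg := cis (th * n%:R).
have sg0 : sg != 0 by exact: cu.
pose rho k := r%:C * cis (node th n k).
have rhon k : rho k ^+ n = sg * r%:C ^+ n.
  rewrite /rho exprMn cisX mulrC /node mulrDl cisD; congr (_ * _).
  rewrite -[RHS]mulr1 -/sg; congr (_ * _).
  by rewrite mulrAC divfK ?cis_2pin // pnatr_eq0 -lt0n.
have key : tproj th n (iter n shiftA x - (sg * r%:C ^+ n) *: x) = - ((sg * r%:C ^+ n) *: x).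
  rewrite /tproj; congr (- _).
  have -> : \sum_(k < n) (r%:C * cis (node th n k)) *: resv (node th n k) (iter n shiftA x - (sg * r%:C ^+ n) *: x)
     = \sum_(k < n) \sum_(j < n) rho k ^+ (n - j) *: iter j shiftA x.
    apply: eq_bigr => k _; rewrite -(rhon k) resv_geometric scaler_sumr; apply: eq_bigr => j _.
    rewrite scalerA -exprS; congr (_ ^+ _ *: _).
    by rewrite -subSn ?prednK // -ltnS prednK.
  rewrite exchange_big /= (bigD1 (Ordinal n0)) //= [X in _ + X]big1 ?addr0 => [|j].
    have -> : \sum_(i < n) rho i ^+ (n - 0) *: x = n%:R *: ((sg * r%:C ^+ n) *: x).
      rewrite (eq_bigr (fun=> (sg * r%:C ^+ n) *: x)) => [|k _]; last by rewrite subn0 rhon.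
      by rewrite sumr_const card_ord scaler_nat.
    by rewrite [LHS]scalerA mulVf // scale1r.
  rewrite -(inj_eq val_inj) /= -lt0n => j0; rewrite -scaler_suml.
  have -> : \sum_(k < n) rho k ^+ (n - j) =
     (r%:C * cis th) ^+ (n - j) * \sum_(k < n) (cis (2 * pi / n%:R * (n - j)%:R)) ^+ k.
    rewrite mulr_sumr; apply: eq_bigr => k _; rewrite /rho /node cisD mulrA exprMn; congr (_ * _).
    by rewrite !cisX; congr cis; ring.
  rewrite sum_roots ?mulr0 ?scale0r //.
    by apply: cis_frac_neq1; rewrite subn_gt0 ltn_ord /= -subn_gt0 subKn // ltnW.
  by rewrite cisX mulrAC divfK ?cis_2pin // pnatr_eq0 -lt0n.
have -> : x - sg^-1 *: powA n x = - (sg * r%:C ^+ n)^-1 *: (iter n shiftA x - (sg * r%:C ^+ n) *: x).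
  rewrite scalerBr !scaleNr opprK [_^-1 *: (_ *: x)]scalerA mulVf ?scale1r ?mulf_neq0 ?expf_neq0 //.
  by rewrite addrC /powA scalerA invfM.
by rewrite linearZ /= key scaleNr scalerN opprK scalerA mulVf ?scale1r ?mulf_neq0 ?expf_neq0.
Qed.

Lemma linear_bound_continuous (T : V -> V) b : linear T -> (forall x, nm (T x) <= b * nm x) ->
  continuous T.
Proof.
move=> linT hb x; apply: (@cvg_nm_squeeze _ _ _ _ _ _ _ (fun y => b * nm (y - x))).
  apply: nearW => y; have -> : T y - T x = T (y - x).
    by rewrite -scaleN1r addrC -linT addrC scaleN1r.
  exact: hb.
rewrite -(mulr0 b); apply: cvgM; first exact: cvg_cst.
by apply: cvg_nm_dist; exact: cvg_id.
Qed.

Lemma cvg_tproj x : tproj 0 n x @[n --> \oo] --> P x.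
Proof.
have [K K0 hK] := tproj_near.
apply: (@cvg_nm_squeeze _ _ _ _ _ _ _ (fun n => K * nm x * n%:R^-1)).
  exists 1%N => // n /= n0; rewrite nmBC mulrAC; apply: hK => //.
  by rewrite lexx divr_ge0 // mulr_ge0 ?pi_ge0.
rewrite -(mulr0 (K * nm x)); apply: cvgM; first exact: cvg_cst.
by rewrite -cvg_shiftS; exact: cvg_harmonic.
Qed.

Lemma riesz_linear : linear P.
Proof.
move=> a x y; have h : tproj 0 n (a *: x + y) @[n --> \oo] --> a *: P x + P y.
  under eq_cvg do rewrite tproj_linear.
  apply: cvgD; last exact: cvg_tproj.
  by apply: cvgZl_tmp; exact: cvg_tproj.
exact: (@cvg_unique _ (@norm_hausdorff _ V) _ _ _ _ (@cvg_tproj _) h).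
Qed.

Lemma riesz_bound : exists2 b : R, 0 <= b & forall x, nm (P x) <= b * nm x.
Proof.
have [K K0 hK] := tproj_near; have [c c0 hc] := resv_bound.
have r0' := ltW r0; have p0 : 0 <= pi :> R := pi_ge0 R.
exists (K + r * c) => [|x]; first by rewrite addr_ge0 ?mulr_ge0.
rewrite -[P x](subrK (tproj 0 1 x)) mulrDl; apply: le_trans (nmD _ _) _; apply: lerD.
  apply: le_trans (hK 0 1%N x _ _) _; rewrite ?divr1 //.
  by rewrite lexx mulr_ge0.
rewrite /tproj big_ord1 invr1 scale1r nmN nmZ nmM nm_cis mulr1 nm_real (gtr0_norm r0) -mulrA.
rewrite ler_pM2l //; apply: hc; rewrite /node mulr0 addr0 lexx /=.
by rewrite mulr_ge0.
Qed.

Lemma riesz_bounded : bounded_op P.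
Proof.
have [b b0 hb] := riesz_bound.
by split; [exact: riesz_linear | exact: linear_bound_continuous riesz_linear hb].
Qed.

Lemma tproj_commA th n x : tproj th n (A x) = A (tproj th n x).
Proof.
have := tproj_comm th n x; rewrite /shiftA (linearB (tproj th n)) linearZ /=.
by move/eqP; rewrite -subr_eq0 opprB addrA subrK subr_eq0 => /eqP.
Qed.

Lemma riesz_comm x : P (A x) = A (P x).
Proof.
have h : tproj 0 n (A x) @[n --> \oo] --> A (P x).
  under eq_cvg do rewrite tproj_commA.
  by apply: (cvg_comp _ _ (@cvg_tproj x)); exact: bA.2.
exact: (@cvg_unique _ (@norm_hausdorff _ V) _ _ _ _ (@cvg_tproj _) h).
Qed.

Lemma powA_linear n : linear (powA n).
Proof.
move=> a x y; rewrite /powA.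
have -> : iter n shiftA (a *: x + y) = a *: iter n shiftA x + iter n shiftA y.
  by elim: n => //= n ->; rewrite linearP.
by rewrite scalerDr !scalerA mulrC.
Qed.
HB.instance Definition _ n := GRing.isLinear.Build C V V *:%R (powA n) (powA_linear n).

Lemma tproj_powA th n m x : tproj th n (powA m x) = powA m (tproj th n x).
Proof.
rewrite /powA linearZ; congr (_ *: _).
by elim: m => //= m IH; rewrite tproj_comm IH.
Qed.

Lemma powA_double n x : powA (n + n) x = powA n (powA n x).
Proof.
rewrite /powA iterD; set y := iter n shiftA x; rewrite exprD invfM -scalerA; congr (_ *: _).
have sZ a z : shiftA (a *: z) = a *: shiftA z by rewrite linearZ.
have -> m a z : iter m shiftA (a *: z) = a *: iter m shiftA z by elim: m => //= m ->; rewrite sZ.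
by [].
Qed.

(* [1 - t ^ 2 = (1 - t) (1 + t)] for [t = B ^ n]; in the limit it makes [P] idempotent. *)
Lemma tproj_double n x : (0 < n)%N ->
  tproj 0 (n + n) x = tproj 0 n (tproj (pi / n%:R) n x).
Proof.
move=> n0; have nn0 : (0 < n + n)%N by rewrite addn_gt0 n0.
have i0 m y : (0 < m)%N -> tproj 0 m (y - powA m y) = y.
  by move=> m0; have := tproj_inv 0 y m0; rewrite mul0r cis0 invr1 scale1r.
(* The shift [pi / n] makes the phase [cis pi = -1], which turns the difference into a sum. *)
have i1 y : tproj (pi / n%:R) n (y + powA n y) = y.
  have := tproj_inv (pi / n%:R) y n0; rewrite divfK ?pnatr_eq0 -?lt0n //.
  by rewrite /cis cospi sinpi -[-1 +i* 0]/((-1)%:C) rmorphN1 invrN1 scaleN1r opprK.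
set u := tproj (pi / n%:R) n x; set v := tproj 0 n u.
have tD th y z : tproj th n (y + z) = tproj th n y + tproj th n z by rewrite linearD.
have tB th y z : tproj th n (y - z) = tproj th n y - tproj th n z by rewrite linearB.
have eu : u + powA n u = x by rewrite /u -tproj_powA -tD i1.
have ev : v - powA n v = u by rewrite /v -tproj_powA -tB i0.
rewrite -eu -{1}ev -[in powA n u]ev linearB /= -powA_double addrA subrK.
exact: i0.
Qed.

(** By [tproj_double] the sum with [2 n] nodes is a composition of two sums with [n] nodes; all
    three approximate [P] with error of order [1 / n]. *)
Lemma riesz_idem x : P (P x) = P x.
Proof.
have [K K0 hK] := tproj_near; have [b b0 hb] := riesz_bound.
have hpi n : (0 < n)%N -> (0 : R) <= pi / n%:R <= 2 * pi / n%:R.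
  move=> n0; rewrite divr_ge0 ?pi_ge0 //= ler_pM2r ?invr_gt0 ?ltr0n //.
  by rewrite ler_peMl ?pi_ge0 // ler1n.
have h0 n : 0 <= (0 : R) <= 2 * pi / n%:R by rewrite lexx divr_ge0 // mulr_ge0 ?pi_ge0.
have c2 : tproj 0 (n + n) x @[n --> \oo] --> P (P x).
  apply: (@cvg_nm_squeeze _ _ _ _ _ _ _ (fun n => (K * (K + b) + b * K) * nm x * n%:R^-1)).
    exists 1%N => // n /= n0; rewrite tproj_double //; set u := tproj (pi / n%:R) n x.
    have nR : 1 <= n%:R :> R by rewrite ler1n.
    have Kn : K / n%:R <= K by rewrite ler_pdivrMr ?ltr0n // ler_peMr.
    have h1 : nm (P x - u) <= K / n%:R * nm x by apply: hK => //; exact: hpi.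
    have hu : nm u <= (K + b) * nm x.
      have -> : u = P x - (P x - u) by rewrite opprB addrC subrK.
      apply: le_trans (nmB _ _) _; rewrite mulrDl addrC lerD //.
      by apply: le_trans h1 _; rewrite ler_wpM2r ?nm_ge0.
    have h2 : nm (P u - tproj 0 n u) <= K / n%:R * nm u by apply: hK.
    have h3 : nm (P (P x) - P u) <= b * (K / n%:R * nm x).
      have -> : P (P x) - P u = P (P x - u).
        by rewrite -scaleN1r addrC -riesz_linear addrC scaleN1r.
      by apply: le_trans (hb _) _; rewrite ler_wpM2l.
    have -> : tproj 0 n u - P (P x) = - ((P (P x) - P u) + (P u - tproj 0 n u)).
      by rewrite addrA subrK opprB.
    rewrite nmN; apply: le_trans (nmD _ _) _.
    have h4 : K / n%:R * nm u <= K / n%:R * ((K + b) * nm x).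
      by rewrite ler_wpM2l // divr_ge0.
    have -> : (K * (K + b) + b * K) * nm x / n%:R =
      b * (K / n%:R * nm x) + K / n%:R * ((K + b) * nm x) by ring.
    by apply: lerD h3 _; apply: le_trans h2 h4.
  rewrite -(mulr0 ((K * (K + b) + b * K) * nm x)); apply: cvgM; first exact: cvg_cst.
  by rewrite -cvg_shiftS; exact: cvg_harmonic.
have c3 : tproj 0 (n + n) x @[n --> \oo] --> P x.
  have := @cvg_tproj x; apply: cvg_trans; move=> S [N _ hN]; exists N => // n /= Nn.
  by apply: hN => /=; rewrite (leq_trans Nn) // leq_addr.
exact: (@cvg_unique _ (@norm_hausdorff _ V) _ _ _ _ c2 c3).
Qed.

(** On an eigenvector the positive powers of [shiftA] vanish, so [tproj_inv] says that every
    trapezoidal sum fixes it. *)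
Lemma riesz_fixed x : A x = lam *: x -> P x = x.
Proof.
move=> Ax; have s0 : shiftA 0 = 0 by exact: linear0.
have h n : (0 < n)%N -> tproj 0 n x = x.
  move=> n0; have := tproj_inv 0 x n0.
  rewrite mul0r cis0 invr1 scale1r /powA; case: n n0 => // n _.
  rewrite iterSr {2}/shiftA Ax subrr.
  have -> : iter n shiftA 0 = 0 by elim: n => //= n ->.
  by rewrite scaler0 subr0.
have c : tproj 0 n x @[n --> \oo] --> x.
  by apply/cvg_nmP => eps eps0; exists 1%N => // n /= /h ->; rewrite subrr nm0 ltW.
exact: (@cvg_unique _ (@norm_hausdorff _ V) _ _ _ _ (@cvg_tproj _) c).
Qed.

(** Inside the circle, isolation leaves only [mu = 0]. Outside, the trapezoidal sum acts on [x] as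
    [(1 - (mu / r) ^ n)^-1], which tends to 0 and contradicts [P x = x]. *)
Lemma riesz_eigen (mu : C) x : A x - lam *: x = mu *: x -> P x = x -> x != 0 -> mu = 0.
Proof.
move=> Bx Px x0; have [K K0 hK] := tproj_near.
have nx : 0 < nm x by rewrite nm_gt0.
have [mur|mur] := leP (nm mu) r.
  have sp : spectrum A (lam + mu).
    move=> [B [[linB _] B1 _]]; have := B1 x.
    rewrite scalerDl opprD addrA Bx subrr => e.
    by have := linB (-1) 0 0; rewrite scaler0 addr0 scaleN1r addNr e => /eqP; rewrite (negPf x0).
  have := r_iso.2 _ sp; rewrite addrAC subrr add0r nm_le => /(_ mur) /eqP.
  by rewrite -subr_eq0 addrAC subrr add0r => /eqP.
exfalso; pose q := nm mu / r; have q1 : 1 < q by rewrite ltr_pdivlMr // mul1r.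
(* This size gives [(n - K) (q - 1) > 1]. Bernoulli's inequality [q ^ n - 1 >= n (q - 1)] and the
   error [K / n] then force [nm x < nm x]. *)
pose n := (Num.truncn (K + (q - 1)^-1)).+1.
have n0 : (0 < n)%N by [].
have hn : K + (q - 1)^-1 < n%:R by rewrite /n truncnS_gt.
have powx : powA n x = (mu / r%:C) ^+ n *: x.
  rewrite /powA; have -> : iter n shiftA x = mu ^+ n *: x.
    elim: n {n0 hn} => [|m IH]; first by rewrite expr0 scale1r.
    by rewrite /= IH linearZ /= /shiftA Bx scalerA -exprSr.
  by rewrite scalerA expr_div_n mulrC.
have e : (1 - (mu / r%:C) ^+ n) *: tproj 0 n x = x.
  have := tproj_inv 0 x n0; rewrite mul0r cis0 invr1 scale1r powx => e; rewrite -{2}e.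
  by rewrite -{2}[x]scale1r -scalerBl linearZ.
have h1 : nm x * (1 - K / n%:R) <= nm (tproj 0 n x).
  have := hK 0 n x n0; rewrite Px lexx divr_ge0 ?mulr_ge0 ?pi_ge0 // => /(_ isT) h.
  have := nmD (x - tproj 0 n x) (tproj 0 n x); rewrite subrK; lra.
have h2 : q ^+ n - 1 <= nm (1 - (mu / r%:C) ^+ n).
  have := nmD (1 - (mu / r%:C) ^+ n) (-1); rewrite addrAC subrr add0r !nmN nm1 nmX nmM nmV.
  by rewrite nm_real (gtr0_norm r0) -/q; lra.
have h3 : n%:R * (q - 1) <= q ^+ n - 1.
  elim: n {n0 hn powx e h1 h2} => [|m IH]; first by rewrite mul0r expr0 subrr.
  have : 1 <= q ^+ m by rewrite exprn_ege1 // ltW.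
  by rewrite exprS -natr1; nra.
have nR : 0 < n%:R :> R by rewrite ltr0n.
have q0 : 0 < q - 1 by rewrite subr_gt0.
have qi : 0 < (q - 1)^-1 by rewrite invr_gt0.
have h4 : 1 < (n%:R - K) * (q - 1) by rewrite -ltr_pdivrMr // mul1r ltrBrDl.
have h5 : (q ^+ n - 1) * (nm x * (1 - K / n%:R)) <= nm x.
  rewrite -{2}e nmZ; apply: ler_pM => //.
    by rewrite subr_ge0 exprn_ege1 // ltW.
  rewrite mulr_ge0 ?nm_ge0 // subr_ge0 ler_pdivrMr // mul1r; lra.
have h6 : n%:R * (q - 1) * (nm x * (1 - K / n%:R)) <= nm x.
  apply: le_trans h5; rewrite ler_wpM2r // mulr_ge0 ?nm_ge0 // subr_ge0 ler_pdivrMr // mul1r; lra.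
have e7 : n%:R * (q - 1) * (nm x * (1 - K / n%:R)) = nm x * ((n%:R - K) * (q - 1)).
  by field; rewrite gt_eqF.
by move: h6; rewrite e7 -{2}[nm x]mulr1 ler_pM2l // leNgt h4.
Qed.

(** The residual of [tres 0 n] is minus the trapezoidal sum, which is within [K / n] of [P x = 0]. A
    finite number of nodes is enough for the Neumann argument in [corrector]. *)
Lemma riesz_near_inverse eps : 0 < eps -> exists2 S : V -> V, linear S &
  (exists2 b : R, 0 <= b & forall x, nm (S x) <= b * nm x) /\
  forall x, P x = 0 -> nm (A (S x) - lam *: S x - x) <= eps * nm x.
Proof.
move=> eps0; have [K K0 hK] := tproj_near; have [c c0 hc] := resv_bound.
pose n := (Num.truncn (K / eps)).+1.
have n0 : (0 < n)%N by [].
have hn : K / eps < n%:R by rewrite /n truncnS_gt.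
have nR : 0 < n%:R :> R by rewrite ltr0n.
have h0 : 0 <= (0 : R) <= 2 * pi / n%:R by rewrite lexx divr_ge0 // mulr_ge0 ?pi_ge0.
exists (tres 0 n).
  move=> a x y; rewrite /tres scalerA mulrC -scalerA -scalerDr; congr (_ *: _).
  rewrite scaler_sumr -big_split; apply: eq_bigr => k _.
  by rewrite resvD resvZ.
split.
  exists c => // x; rewrite /tres nmZ nmV nm_nat ler_pdivrMl // mulr_natl -[n in _ *+ n]card_ord -sumr_const.
  apply: le_trans (nm_sum _ _ _) _; apply: ler_sum => k _; apply: hc.
  exact: node_itv0.
move=> x Px; have := tres_shift 0 x n0; rewrite {1}/shiftA => ->.
rewrite addrAC subrr add0r nmN; have := hK 0 n x n0 h0; rewrite Px sub0r nmN => h.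
apply: le_trans h _; rewrite ler_wpM2r ?nm_ge0 // ler_pdivrMr // mulrC.
by rewrite -ler_pdivrMr // ltW.
Qed.

End RieszProjection.
(** Deleting row [i] and column [i.+1] maps the superdiagonal onto the superdiagonal, so a minor at
    an entry 1 is again in nilpotent Jordan form. *)
Lemma bump_succ_eq (i a b : nat) : (bump i.+1 b == (bump i a).+1) = (b == a.+1).
Proof.
by rewrite /bump; case: (leqP i a) => ha; case: (leqP i.+1 b) => hb; rewrite ?add1n ?add0n; lia.
Qed.

(** * Determinants of perturbed Jordan matrices *)

Section JordanStriking.
Variable K : fieldType.

Definition rowhas n (J : 'M[K]_n) (i : 'I_n) := [exists j, J i j == 1].

(* What is left of [J + z X] at [z = 0] once [z] is factored out of the rows of [J]
   without an entry 1. *)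
Definition mixmx n (J X : 'M[K]_n) : 'M[K]_n :=
  \matrix_(i, j) if rowhas J i then J i j else X i j.

Lemma jordan_one n (J : 'M[K]_n) i j : nilpotent_jordan J -> J i j == 1 -> j = i.+1 :> nat.
Proof.
move=> Jn J1; have := Jn i j; case: (eqVneq (j : nat) i.+1) => // _.
by rewrite (eqP J1) oner_eq0.
Qed.

Lemma jordan_zero_row n (J : 'M[K]_n) i : nilpotent_jordan J -> ~~ rowhas J i -> forall j, J i j = 0.
Proof.
move=> Jn /existsPn Ji j; have := Jn i j; case: ifP => _ /=; last by move/eqP.
by rewrite (negPf (Ji j)) orbF => /eqP.
Qed.

Lemma jordan_row n (J : 'M[K]_n) i j k : nilpotent_jordan J -> J i j == 1 -> k != j -> J i k = 0.
Proof.
move=> Jn J1 kj; have := Jn i k; rewrite -(jordan_one Jn J1) (inj_eq val_inj) (negPf kj).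
by move/eqP.
Qed.

Lemma nu_rows n (J : 'M[K]_n) : nilpotent_jordan J -> nu J = #|[pred i | rowhas J i]|.
Proof.
move=> Jn; rewrite /nu -(@card_in_imset _ _ (@fst 'I_n 'I_n)).
  apply: eq_card => i; rewrite !inE; apply/imsetP/existsP => [[[a b]] |[j Jij]].
    by rewrite inE /= => Jab ->; exists b.
  by exists (i, j).
move=> [a b] [c d]; rewrite !inE /= => J1 J2 ac; move: J2; rewrite -ac => J2.
by congr (_, _); apply: val_inj; rewrite /= (jordan_one Jn J1) (jordan_one Jn J2).
Qed.

Lemma nu_cols n (J : 'M[K]_n) : nilpotent_jordan J -> nu J = #|[pred j | [exists i, J i j == 1]]|.
Proof.
move=> Jn; rewrite /nu -(@card_in_imset _ _ (@snd 'I_n 'I_n)).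
  apply: eq_card => i; rewrite !inE; apply/imsetP/existsP => [[[a b]] |[j Jij]].
    by rewrite inE /= => Jab ->; exists a.
  by exists (j, i).
move=> [a b] [c d]; rewrite !inE /= => J1 J2 bd; congr (_, _) => //; apply: val_inj.
have h1 := jordan_one Jn J1; have h2 := jordan_one Jn J2.
by apply/eqP; rewrite -eqSS /= -h1 -h2 bd.
Qed.

Lemma size_filter_enum n (p : pred 'I_n) : size [seq i <- enum 'I_n | ~~ p i] = (n - #|p|)%N.
Proof.
have -> : #|p| = count p (enum 'I_n) by rewrite -sum1_card -sum1_count big_enum_cond; exact: eq_bigl.
by rewrite size_filter -[X in (X - _)%N](size_enum_ord n) -(count_predC p (enum 'I_n)) addKn; apply: eq_count.
Qed.

Lemma size_kept_rows n (J : 'M[K]_n) : nilpotent_jordan J -> size (kept_rows J) = (n - nu J)%N.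
Proof. by move=> Jn; rewrite nu_rows // -size_filter_enum. Qed.

Lemma size_kept_cols n (J : 'M[K]_n) : nilpotent_jordan J -> size (kept_cols J) = (n - nu J)%N.
Proof. by move=> Jn; rewrite nu_cols // -size_filter_enum. Qed.

(** Both lists are strictly increasing and have the same members. *)
Lemma filter_enum_lift n (h : 'I_n.+1) (p : pred 'I_n.+1) : ~~ p h ->
  [seq i <- enum 'I_n.+1 | p i] = [seq lift h i | i <- enum 'I_n & p (lift h i)].
Proof.
move=> ph; pose lt m (i j : 'I_m) := (i < j)%N.
have ltT m : transitive (lt m) by move=> x y z; exact: ltn_trans.
have s m : sorted (@lt m) (enum 'I_m).
  change (sorted (relpre (val : 'I_m -> nat) ltn) (enum 'I_m)).
  by rewrite -sorted_map val_enum_ord iota_ltn_sorted.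
apply: (@irr_sorted_eq _ (@lt n.+1)); first exact: ltT.
- by move=> i; rewrite /lt ltnn.
- exact: sorted_filter (ltT _) _ _ (s _).
- have ss : sorted (@lt n) [seq i <- enum 'I_n | p (lift h i)] by exact: sorted_filter (ltT _) _ _ (s _).
  rewrite sorted_map; apply: sub_sorted ss => i j; rewrite /lt /= /bump => ij.
  by case: (leqP h i) => hi; case: (leqP h j) => hj; lia.
move=> i; rewrite mem_filter mem_enum andbT; apply/idP/mapP => [pi|[j]].
  case: (unliftP h i) => [j e|e]; last by rewrite e (negPf ph) in pi.
  by exists j => //; rewrite mem_filter mem_enum -e pi.
by rewrite mem_filter => /andP[pj _] ->.
Qed.

(** A size [p] independent of [J] spares the induction in [det_struck] a cast between the types
    indexed by [n - nu J]. *)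
Definition subdet p n (X : 'M[K]_n) (rs cs : seq 'I_n) : K :=
  \det (\matrix_(k < p, l < p)
    if (onth rs k, onth cs l) is (Some i, Some j) then X i j else 0).

(** Induction on the number of entries 1. A row of [mixmx J X] carrying such an entry has no other
    nonzero entry; its column is the next index, so every expansion contributes the sign [-1]. *)
Lemma det_struck n (J X : 'M[K]_n) : nilpotent_jordan J ->
  \det (mixmx J X) = (-1) ^+ nu J * \det (struck J X).
Proof.
move=> Jn; rewrite -[\det (struck J X)]/(subdet (n - nu J) X (kept_rows J) (kept_cols J)).
move E : (nu J) => v; elim: v n J X Jn E => [|v IH] n J X Jn E.
  have J0 i j : (J i j == 1) = false.
    by have := card0_eq E (i, j); rewrite !inE.
  have rh i : rowhas J i = false by apply/existsP => -[j]; rewrite J0.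
  have kr : kept_rows J = enum 'I_n.
    apply/all_filterP/allP => i _; apply/existsPn => j; by rewrite J0.
  have kc : kept_cols J = enum 'I_n.
    apply/all_filterP/allP => i _; apply/existsPn => j; by rewrite J0.
  rewrite expr0 mul1r kr kc subn0; congr (\det _); apply/matrixP => i j; rewrite !mxE rh.
  have on (k : 'I_n) : onth (enum 'I_n) k = Some k.
    case e : (onth (enum 'I_n) k) => [x|]; first by rewrite -(@onth_nth _ k _ _ _ e) nth_ord_enum.
    by have := onthTE (enum 'I_n) k; rewrite e size_enum_ord ltn_ord.
  by rewrite !on.
have [[i0 j0] /= J1] : exists p : 'I_n * 'I_n, J p.1 p.2 == 1.
  by have /card_gt0P[p pJ] : (0 < nu J)%N; [rewrite E | exists p].
case: n J X Jn E i0 j0 J1 => [|n] J X Jn E i0 j0 J1; first by case: i0 {J1}.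
have ji := jordan_one Jn J1.
pose J' := row' i0 (col' j0 J); pose X' := row' i0 (col' j0 X).
have J'n : nilpotent_jordan J'.
  move=> a b; rewrite !mxE; have := Jn (lift i0 a) (lift j0 b).
  suff -> : (lift j0 b == (lift i0 a).+1 :> nat) = (b == a.+1 :> nat) by [].
  by rewrite /= ji bump_succ_eq.
have Jcol a : J (lift i0 a) j0 == 1 = false.
  apply/negP => /(jordan_one Jn); rewrite ji => /succn_inj e.
  by have := neq_lift i0 a; rewrite -val_eqE => /negP; apply; apply/eqP.
have Jrow b : J i0 (lift j0 b) == 1 = false.
  have kj : lift j0 b != j0 by rewrite eq_sym neq_lift.
  by rewrite (jordan_row Jn J1 kj) eq_sym oner_eq0.
have rh a : rowhas J (lift i0 a) = rowhas J' a.
  apply/existsP/existsP => [[k Jk]|[k]]; last by rewrite !mxE => Jk; exists (lift j0 k).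
  case: (unliftP j0 k) => [b e|e]; last by rewrite e Jcol in Jk.
  by exists b; rewrite !mxE -e.
have ch b : [exists i, J i (lift j0 b) == 1] = [exists i, J' i b == 1].
  apply/existsP/existsP => [[k Jk]|[k]]; last by rewrite !mxE => Jk; exists (lift i0 k).
  case: (unliftP i0 k) => [a e|e]; last by rewrite e Jrow in Jk.
  by exists a; rewrite !mxE -e.
have kr : kept_rows J = map (lift i0) (kept_rows J').
  rewrite /kept_rows (@filter_enum_lift n i0); first by congr map; apply: eq_filter => a; rewrite -/(rowhas J _) rh.
  by rewrite negbK; apply/existsP; exists j0.
have kc : kept_cols J = map (lift j0) (kept_cols J').
  rewrite /kept_cols (@filter_enum_lift n j0); first by congr map; apply: eq_filter => a; rewrite ch.
  by rewrite negbK; apply/existsP; exists i0.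
(* Counting the kept rows, which correspond under [lift i0], gives the number of entries 1 of the
   minor. *)
have sz : (n.+1 - nu J = n - nu J')%N by rewrite -!size_kept_rows // kr size_map.
have nuJ' : nu J' = v.
  have : (nu J <= n.+1)%N by rewrite nu_rows // -[n.+1 in leqRHS]card_ord max_card.
  have : (nu J' <= n)%N by rewrite nu_rows // -[n in leqRHS]card_ord max_card.
  by move: sz; rewrite E; lia.
have szv : (n.+1 - v.+1 = n - v)%N by rewrite subSS.
have mixi k : mixmx J X i0 k = (k == j0)%:R.
  rewrite mxE ifT; last by apply/existsP; exists j0.
  by have [->|kj] := eqVneq k j0; [exact/eqP | rewrite (jordan_row Jn J1)].
rewrite (expand_det_row _ i0) (bigD1 j0) //= big1 ?addr0 => [|k /negPf kj]; last first.
  by rewrite mixi kj mul0r.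
have mJ' : row' i0 (col' j0 (mixmx J X)) = mixmx J' X'.
  by apply/matrixP => a b; rewrite !mxE rh.
rewrite mixi eqxx mul1r /cofactor mJ' (IH _ _ _ J'n nuJ') ji addnS addnn exprS.
rewrite -signr_odd odd_double expr0 mulr1 exprS -mulrA; congr (_ * (_ * _)).
rewrite kr kc subSS; congr (\det _); apply/matrixP => k l; rewrite !mxE !onth_map.
by case: (onth _ k) => //= a; case: (onth _ l) => //= b; rewrite !mxE.
Qed.

Lemma det_jordanD n (J X : 'M[K]_n) (z : K) : nilpotent_jordan J ->
  \det (J + z *: X) = z ^+ (n - nu J) *
    \det (\matrix_(i, j) (if rowhas J i then J i j + z * X i j else X i j)).
Proof.
move=> Jn; pose d : 'rV[K]_n := \row_i (if rowhas J i then 1 else z).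
have -> : J + z *: X = diag_mx d *m \matrix_(i, j) (if rowhas J i then J i j + z * X i j else X i j).
  apply/matrixP => i j; rewrite mul_diag_mx !mxE; case: ifPn => Ji; first by rewrite mul1r.
  by rewrite (jordan_zero_row Jn Ji) add0r.
rewrite det_mulmx det_diag; congr (_ * _).
under eq_bigr do rewrite mxE -if_neg.
rewrite -big_mkcond prodr_const /=; congr (_ ^+ _).
have e := cardC [pred i | rowhas J i]; rewrite card_ord -nu_rows // in e.
by rewrite -[X in (X - _)%N]e addKn; apply: eq_card => i; rewrite !inE.
Qed.

(** The kernel is spanned by the unit vectors of the kept columns, whence the geometric multiplicity
    in [has_dim_jordan]. *)
Lemma jordan_ker n (J : 'M[K]_n) (c : 'cV[K]_n) : nilpotent_jordan J ->
  J *m c = 0 <-> forall j, [exists i, J i j == 1] -> c j 0 = 0.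
Proof.
move=> Jn; split=> [Jc j /existsP[i Jij]|h].
  have /matrixP/(_ i 0) := Jc; rewrite !mxE (bigD1 j) //= big1 ?addr0 => [|k kj].
    by rewrite (eqP Jij) mul1r.
  by rewrite (jordan_row Jn Jij) // mul0r.
apply/matrixP => i k; rewrite !mxE; apply: big1 => j _; rewrite (ord1 k).
have [|J1] := boolP (J i j == 1); last first.
  have := Jn i j; case: ifP => _; last by move=> /eqP->; rewrite mul0r.
  by rewrite (negPf J1) orbF => /eqP->; rewrite mul0r.
by move=> J1; rewrite h ?mulr0 //; apply/existsP; exists i.
Qed.

End JordanStriking.

(** * First-order asymptotics at the origin *)

Section NearZero.
Variable R : realType.
Local Notation C := R[i].
Local Notation F0 := (nbhs (0 : C^o)).

(** The estimate [f z = l + O(z)] with an explicit constant is stable under sums, products and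
    determinants. The neighbourhood contains 0, so it includes [f 0 = l]. *)
Definition nearO (f : C^o -> C) (l : C) :=
  exists2 c : R, 0 <= c & \forall z \near F0, nm (f z - l) <= c * nm z.

Lemma nearO_cst l : nearO (fun=> l) l.
Proof. by exists 0 => //; apply: filterE => z; rewrite subrr nm0 mul0r. Qed.

Lemma near0_le (c : R) : 0 < c -> \forall z \near F0, nm z <= c.
Proof.
move=> c0; have := @cvg_id _ F0; move/cvg_nmP => /(_ _ c0).
by apply: filterS => z; rewrite subr0.
Qed.

Lemma nearO_id : nearO (fun z => z) 0.
Proof. by exists 1 => //; apply: filterE => z; rewrite subr0 mul1r. Qed.

Lemma nearOD f g l m : nearO f l -> nearO g m -> nearO (fun z => f z + g z) (l + m).
Proof.
move=> [c c0 hf] [d d0 hg]; exists (c + d); first exact: addr_ge0.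
move: hf hg; apply: filterS2 => z hf hg; rewrite opprD addrACA mulrDl.
by apply: le_trans (nmD _ _) _; exact: lerD.
Qed.

Lemma nearOM f g l m : nearO f l -> nearO g m -> nearO (fun z => f z * g z) (l * m).
Proof.
move=> [c c0 hf] [d d0 hg]; exists (c * (d + nm m) + nm l * d).
  by rewrite addr_ge0 ?mulr_ge0 ?addr_ge0 ?nm_ge0.
move: hf hg (near0_le ltr01); apply: filterS3 => z hf hg z1.
have -> : f z * g z - l * m = (f z - l) * g z + l * (g z - m) by ring.
apply: le_trans (nmD _ _) _; rewrite !nmM mulrDl; apply: lerD.
  rewrite mulrAC; apply: ler_pM; rewrite ?nm_ge0 //.
  rewrite -[g z](subrK m); apply: le_trans (nmD _ _) _; rewrite lerD2r.
  by apply: le_trans hg _; rewrite ler_piMr.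
by rewrite -mulrA ler_wpM2l ?nm_ge0.
Qed.

Lemma nearO_sum I (r : seq I) (P : pred I) f l : (forall i, P i -> nearO (f i) (l i)) ->
  nearO (fun z => \sum_(i <- r | P i) f i z) (\sum_(i <- r | P i) l i).
Proof.
move=> h; elim: r => [|a r IH].
  by rewrite big_nil; under [X in nearO X]eq_fun do rewrite big_nil; exact: nearO_cst.
rewrite big_cons; under [X in nearO X]eq_fun do rewrite big_cons.
by case: ifP => [Pa|//]; apply: nearOD => //; exact: h.
Qed.

Lemma nearO_prod I (r : seq I) (P : pred I) f l : (forall i, P i -> nearO (f i) (l i)) ->
  nearO (fun z => \prod_(i <- r | P i) f i z) (\prod_(i <- r | P i) l i).
Proof.
move=> h; elim: r => [|a r IH].
  by rewrite big_nil; under [X in nearO X]eq_fun do rewrite big_nil; exact: nearO_cst.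
rewrite big_cons; under [X in nearO X]eq_fun do rewrite big_cons.
by case: ifP => [Pa|//]; apply: nearOM => //; exact: h.
Qed.

Lemma nearO_det n (f : C^o -> 'M[C]_n) (l : 'M[C]_n) :
  (forall i j, nearO (fun z => f z i j) (l i j)) -> nearO (fun z => \det (f z)) (\det l).
Proof.
move=> h; rewrite /determinant; apply: nearO_sum => s _.
by apply: nearOM; [exact: nearO_cst | apply: nearO_prod => i _; exact: h].
Qed.

Lemma nearO_det_jordan n (J X1 : 'M[C]_n) (X : C^o -> 'M[C]_n) : nilpotent_jordan J ->
  (forall i j, nearO (fun z => X z i j) (X1 i j)) ->
  exists2 g, nearO g ((-1) ^+ nu J * \det (struck J X1)) &
    forall z, \det (J + z *: X z) = z ^+ (n - nu J) * g z.
Proof.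
move=> Jn hX; exists (fun z => \det (\matrix_(i, j) (if rowhas J i then J i j + z * X z i j else X z i j))).
  rewrite -det_struck //; apply: nearO_det => i j; rewrite mxE.
  under [X in nearO X]eq_fun do rewrite mxE.
  case: ifP => _ //; rewrite -[J i j in X in nearO _ X]addr0 -(mul0r (X1 i j)).
  by apply: nearOD; [exact: nearO_cst | apply: nearOM => //; exact: nearO_id].
by move=> z; exact: det_jordanD.
Qed.

Lemma nearO_bigO (f g : C^o -> C^o) (h l : C) N :
  nearO g l -> (\forall z \near F0, f z = h * (z ^+ N * g z)) ->
  f = (fun z => h * (z ^+ N * l)) +O_F0 (fun z => z ^+ N.+1).
Proof.
move=> [c c0 hg] fE; apply/eqaddOP; exists (nm h * c)%:C; split.
  by rewrite realE lecR mulr_ge0 ?nm_ge0.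
move=> k hk; move: hg fE; apply: filterS2 => z hg fz.
have -> : (f - (fun w => h * (w ^+ N * l))) z = h * (z ^+ N * (g z - l)).
  by rewrite -[LHS]/(f z - h * (z ^+ N * l)) fz; ring.
rewrite !normrM exprS normrM; apply: le_trans (_ : (nm h * c)%:C * (`|z| * `|z ^+ N|) <= _); last first.
  by apply: ler_wpM2r; [exact: mulr_ge0 | exact: ltW].
rewrite -!nmE -!rmorphM /= lecR.
rewrite [leRHS](_ : _ = nm h * (nm (z ^+ N) * (c * nm z))); last by ring.
by rewrite ler_wpM2l ?nm_ge0 // ler_wpM2l ?nm_ge0.
Qed.

Lemma nearO_bigO0 (f : C^o -> C^o) : nearO f 0 -> f =O_F0 (fun z => z).
Proof.
move=> [c c0 hf]; apply/eqOP; exists c%:C; split; first by rewrite realE lecR c0.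
move=> k hk; move: hf; apply: filterS => z; rewrite subr0 => hf.
apply: le_trans (_ : c%:C * `|z| <= _); last by apply: ler_wpM2r => //; exact: ltW.
by rewrite -!nmE -rmorphM lecR.
Qed.

End NearZero.

(** * Bounded operators, Neumann series and bases of ranges *)

Section Operators.
Variables (R : realType) (V : completeNormedModType R[i]).
Local Notation C := R[i].
Implicit Types T P : V -> V.

Lemma lin0 T : linear T -> T 0 = 0.
Proof. by move=> l; have := l (-1) 0 0; rewrite scaler0 addr0 scaleN1r addNr. Qed.

Lemma linD T x y : linear T -> T (x + y) = T x + T y.
Proof. by move=> l; have := l 1 x y; rewrite !scale1r. Qed.

Lemma linZ T a x : linear T -> T (a *: x) = a *: T x.
Proof. by move=> l; have := l a x 0; rewrite (lin0 l) !addr0. Qed.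

Lemma linN T x : linear T -> T (- x) = - T x.
Proof. by move=> l; rewrite -scaleN1r (linZ _ _ l) scaleN1r. Qed.

Lemma linB T x y : linear T -> T (x - y) = T x - T y.
Proof. by move=> l; rewrite (linD _ _ l) (linN _ l). Qed.

Lemma lin_sum T I (r : seq I) (p : pred I) (F : I -> V) : linear T ->
  T (\sum_(i <- r | p i) F i) = \sum_(i <- r | p i) T (F i).
Proof.
by move=> l; apply: (big_morph T) => [x y|]; [exact: linD | exact: lin0].
Qed.

Lemma linear_comp T1 T2 : linear T1 -> linear T2 -> linear (fun x => T1 (T2 x)).
Proof. by move=> l1 l2 a x y; rewrite l2 l1. Qed.

Lemma linear_add T1 T2 : linear T1 -> linear T2 -> linear (fun x => T1 x + T2 x).
Proof. by move=> l1 l2 a x y; rewrite l1 l2 scalerDr addrACA. Qed.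

Lemma linear_opp T : linear T -> linear (fun x => - T x).
Proof. by move=> l a x y; rewrite l scalerN opprD. Qed.

Lemma linear_scale T a : linear T -> linear (fun x => a *: T x).
Proof. by move=> l c x y; rewrite l scalerDr !scalerA mulrC. Qed.

Lemma linear_sub T1 T2 : linear T1 -> linear T2 -> linear (fun x => T1 x - T2 x).
Proof. by move=> l1 l2; apply: linear_add => //; exact: linear_opp. Qed.

Lemma bounded_comp T1 T2 : bounded_op T1 -> bounded_op T2 -> bounded_op (fun x => T1 (T2 x)).
Proof.
move=> [l1 c1] [l2 c2]; split; first exact: linear_comp.
by move=> x; apply: (@continuous_comp _ _ _ T2 T1); [exact: c2 | exact: c1].
Qed.

Lemma bounded_add T1 T2 : bounded_op T1 -> bounded_op T2 -> bounded_op (fun x => T1 x + T2 x).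
Proof.
move=> [l1 c1] [l2 c2]; split; first exact: linear_add.
by move=> x; apply: cvgD; [exact: c1 | exact: c2].
Qed.

Lemma bounded_opp T : bounded_op T -> bounded_op (fun x => - T x).
Proof.
move=> [l c]; split; first exact: linear_opp.
by move=> x; apply: cvgN; exact: c.
Qed.

Lemma bounded_sub T1 T2 : bounded_op T1 -> bounded_op T2 -> bounded_op (fun x => T1 x - T2 x).
Proof. by move=> b1 b2; apply: bounded_add => //; exact: bounded_opp. Qed.

Lemma bounded_scale T a : bounded_op T -> bounded_op (fun x => a *: T x).
Proof.
move=> [l c]; split; first exact: linear_scale.
by move=> x; apply: cvgZr; exact: c.
Qed.

Lemma bounded_id : bounded_op (@id V).
Proof. by split=> // x; exact: cvg_id. Qed.

Lemma bounded_compl P : bounded_op P -> bounded_op (compl P).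
Proof. by move=> bP; apply: bounded_sub => //; exact: bounded_id. Qed.

(** The iteration [y |-> x - T y] converges geometrically; the a priori bound [bound] gives
    uniqueness. *)
Lemma neumann T : linear T -> (forall x, nm (T x) <= 2^-1 * nm x) ->
  exists N : V -> V, [/\ linear N, forall x, N x = x - T (N x) &
    forall x, nm (N x) <= 2 * nm x].
Proof.
move=> l hT.
have bound x u : u = x - T u -> nm u <= 2 * nm x.
  move=> e; have h : nm u <= nm x + 2^-1 * nm u.
    by rewrite {1}e; apply: le_trans (nmB _ _) _; rewrite lerD2l.
  by lra.
have ex x : exists u, u = x - T u.
  pose u n := iter n (fun y => x - T y) x.
  have u2 n : nm (u n) <= 2 * nm x.
    elim: n => [|n IH]; first by rewrite /u /= mulr_natl mulr2n lerDl nm_ge0.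
    rewrite /u /= -/(u n); apply: le_trans (nmB _ _) _.
    by have := hT (u n); have := IH; lra.
  have du n k : nm (u (n + k)%N - u n) <= 2^-1 ^+ n * (4 * nm x).
    elim: n => [|n IH].
      rewrite expr0 mul1r add0n; apply: le_trans (nmB _ _) _.
      by have := u2 k; have := u2 0%N; lra.
    have -> : u (n.+1 + k)%N - u n.+1 = T (u n - u (n + k)%N).
      by rewrite (linB _ _ l) addSn /u !iterS -!/(u _) opprB addrC addrA subrK.
    by rewrite exprS -mulrA; apply: le_trans (hT _) _; rewrite ler_wpM2l // nmBC.
  have cu : cvgn u.
    apply: cvgn_nm_cauchy => eps e0.
    have h : (2^-1 : R) ^+ n * (4 * nm x) @[n --> \oo] --> (0 : R).
      rewrite -[X in _ --> X](mul0r (4 * nm x)); apply: cvgM; last exact: cvg_cst.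
      by apply: cvg_expr; rewrite ger0_norm; lra.
    have [n _ hn] : \forall n \near \oo, (2^-1 : R) ^+ n * (4 * nm x) < eps.
      exact: (cvgr_lt _ h).
    exists n => m nm'; rewrite -(subnKC nm'); apply: le_trans (du _ _) _.
    by apply: ltW; apply: hn => /=.
  exists (lim (u n @[n --> \oo])).
  apply: (@cvg_unique _ (@norm_hausdorff _ V) (u n.+1 @[n --> \oo])).
    by move: cu; rewrite -[X in X -> _](@cvg_shiftS _ u).
  have cT : continuous T by exact: linear_bound_continuous hT.
  apply: cvgB; first exact: cvg_cst.
  exact: cvg_comp cu (cT _).
have [N hN] := choice ex; exists N; split=> //; last by move=> x; exact: bound.
(* The defect of additivity satisfies the equation with right-hand side 0, so [bound] makes it
   vanish. *)
move=> a x y; apply/eqP; rewrite -subr_eq0 -nm_eq0 eq_le nm_ge0 andbT.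
rewrite -(mulr0 2) -[X in 2 * X](@nm0 R V); apply: bound; rewrite sub0r.
rewrite {1}hN {1}[N x]hN {1}[N y]hN (linB _ _ l) (linD _ _ l) (linZ _ _ l).
rewrite scalerBr !opprD !opprK; move: (T _) (_ *: T _) (T _) => p q s.
by rewrite [- _ + q + _]addrACA -opprD addrACA subrr add0r.
Qed.

Section Separable.
Variable dot : {dot V for conjC}.
Hypotheses (Hdot : is_hilbert dot) (Hsep : separable V).

(** The image of a countable dense set is countable and, by continuity of [T], dense in the
    range. *)
Lemma onb_range T : bounded_op T -> exists e, onb dot (range T) e.
Proof.
move=> [l c]; have [D cD dD] := Hsep.
apply: (@onb_exists _ _ _ Hdot (range T) (T @` D)).
- by exists 0 => //; exact: lin0.
- by move=> _ _ [x _ <-] [y _ <-]; exists (x + y) => //; exact: linD.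
- by move=> a _ [x _ <-]; exists (a *: x) => //; exact: linZ.
- exact: (sub_countable (card_image_le _ _)).
- exact: image_subset.
move=> _ [x _ <-] B hB; have /c := hB; rewrite /= nbhsE => -[U [openU Ux] UB].
have [|y [Uy Dy]] := dD U _ openU; first by exists x.
by exists (T y); split; [exists y | exact: UB].
Qed.

Lemma onb_setT_ex : exists e, onb dot setT e.
Proof.
have := onb_range bounded_id; suff -> : range (@id V) = setT by [].
by apply/seteqP; split=> // x _; exists x.
Qed.

Lemma hsb_op_bound T e c : onb dot setT e -> bounded_op T -> 0 <= c -> hsb e T c ->
  forall x, nm (T x) <= c * nm x.
Proof.
move=> he [l cT] c0 hT x.
have h : T (proj dot e n x) @[n --> \oo] --> T x.
  exact: cvg_comp (onb_cvg he I) (cT _).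
rewrite -[T x]subr0; apply: (@cvg_nm_le _ V _ _ _ _ _ _ _ h); apply: nearW => n; rewrite subr0.
rewrite /proj lin_sum //; apply: le_trans (nm_sum _ _ _) _.
under eq_bigr do rewrite linZ // nmZ.
apply: le_trans (l2_CS _ _) _; rewrite mulrC; apply: ler_pM; rewrite ?l2_ge0 ?l2_le ?nm_ge0 //.
by apply: bessel => //; exact: onb_onsys he.
Qed.
End Separable.

End Operators.

(** * Coordinates on a finite-dimensional range *)

Section Coordinates.
Variables (R : realType) (V : completeNormedModType R[i]).
Local Notation C := R[i].

Lemma lincombZ n (b : 'I_n -> V) a c : lincomb b (a *: c) = a *: lincomb b c.
Proof. by rewrite /lincomb scaler_sumr; apply: eq_bigr => i _; rewrite mxE scalerA. Qed.

Lemma lincomb0 n (b : 'I_n -> V) : lincomb b 0 = 0.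
Proof. by rewrite /lincomb big1 // => i _; rewrite mxE scale0r. Qed.

Lemma lincomb_delta n (b : 'I_n -> V) j : lincomb b (delta_mx j 0) = b j.
Proof.
rewrite /lincomb (bigD1 j) //= big1 ?addr0 => [|i ij]; rewrite mxE ?eqxx ?scale1r //.
by rewrite (negPf ij) scale0r.
Qed.

Lemma lincomb_inj M n (b : 'I_n -> V) : is_basis M b -> injective (lincomb b).
Proof. by move=> [_ h _] c d cd; apply: h; rewrite ?inE. Qed.

Lemma basis_coord M n (b : 'I_n -> V) x : is_basis M b -> M x -> exists c, lincomb b c = x.
Proof. by move=> [_ _ h] /h [c _ <-]; exists c. Qed.

Lemma basis_mem M n (b : 'I_n -> V) c : is_basis M b -> M (lincomb b c).
Proof. by move=> [h _ _]; exact: h. Qed.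

Lemma basis_vec M n (b : 'I_n -> V) j : is_basis M b -> M (b j).
Proof. by move=> hb; rewrite -lincomb_delta; exact: basis_mem. Qed.

(** [det_fin] selects its value by [get]. Any two bases are related by an invertible matrix [G] with
    [X *m G = G *m X'], so every admissible value is the same. *)
Lemma det_finE M n (b : 'I_n -> V) (T : V -> V) (X : 'M[C]_n) : is_basis M b -> linear T ->
  (forall j, T (b j) = \sum_i X i j *: b i) -> det_fin n M T = \det X.
Proof.
move=> hb lT hX; rewrite /det_fin.
set D := [set d | _].
have [|b' [X' [hb' hX' ->]]] := @getPex _ D; first by exists (\det X), b, X.
have col (u v : 'I_n -> V) : is_basis M u -> is_basis M v ->
    exists G : 'M[C]_n, forall j, v j = \sum_i G i j *: u i.
  move=> hu hv; have h j : exists c, lincomb u c = v j.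
    by apply: (basis_coord hu); exact: basis_vec hv.
  have [c hc] := choice h; exists (\matrix_(i, j) c j i 0) => j.
  by rewrite -hc; apply: eq_bigr => i _; rewrite mxE.
have uniq (u : 'I_n -> V) (Y Z : 'M[C]_n) : is_basis M u ->
    (forall j, \sum_i Y i j *: u i = \sum_i Z i j *: u i) -> Y = Z.
  move=> hu h; apply/matrixP => i j.
  have /(lincomb_inj hu)/matrixP/(_ i 0) : lincomb u (\col_i Y i j) = lincomb u (\col_i Z i j).
    rewrite /lincomb; under eq_bigr do rewrite mxE; rewrite h.
    by apply: eq_bigr => k _; rewrite mxE.
  by rewrite !mxE.
have mul (u v : 'I_n -> V) (Y Z : 'M[C]_n) j : (forall k, v k = \sum_i Y i k *: u i) ->
    \sum_k Z k j *: v k = \sum_i (Y *m Z) i j *: u i.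
  move=> h; under eq_bigr => k _ do rewrite h scaler_sumr.
  rewrite exchange_big; apply: eq_bigr => i _; rewrite mxE scaler_suml.
  by apply: eq_bigr => k _; rewrite scalerA mulrC.
have [G hG] := col _ _ hb hb'; have [H hH] := col _ _ hb' hb.
have GH : G *m H = 1%:M.
  apply: (uniq b _ _ hb) => j; rewrite -(mul b b' G H j hG) -hH.
  by rewrite (bigD1 j) //= big1 ?addr0 => [|i ij]; rewrite mxE ?eqxx ?scale1r // (negPf ij) scale0r.
have XG : X *m G = G *m X'.
  apply: (uniq b _ _ hb) => j.
  rewrite -(mul b (T \o b) X G j hX) -(mul b b' G X' j hG) -hX' hG lin_sum //.
  by apply: eq_bigr => k _; rewrite linZ.
have /(congr1 determinant) := XG; rewrite !det_mulmx mulrC => /mulfI -> //.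
have /(congr1 determinant) := GH; rewrite det_mulmx det1 => gh.
by apply: contra_eq_neq gh => ->; rewrite mul0r eq_sym oner_eq0.
Qed.

Variable dot : {dot V for conjC}.
Hypothesis Hdot : is_hilbert dot.

Definition coordinates n (P : V -> V) (b : 'I_n -> V) (be : 'I_n -> V -> C) :=
  [/\ exists2 kb : R, 0 <= kb & forall i x, nm (be i x) <= kb * nm x,
      forall i x y, be i (x + y) = be i x + be i y,
      forall i a x, be i (a *: x) = a * be i x,
      forall x, P x = \sum_i be i x *: b i &
      forall i x, be i (P x) = be i x].

Lemma gram_unit M n (b : 'I_n -> V) : is_basis M b ->
  \matrix_(i, j) dot (b i) (b j) \in unitmx.
Proof.
move=> hb; rewrite unitmxE unitfE; apply/det0P => -[v v0 vG].
have x0 : lincomb b v^T = 0.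
  have dx j : dot (lincomb b v^T) (b j) = 0.
    move/matrixP/(_ 0 j) : vG; rewrite !mxE => vG.
    rewrite -[RHS]vG /lincomb dot_suml; apply: eq_bigr => i _.
    by rewrite dotZl !mxE.
  apply/eqP; rewrite -nm_eq0 -sqrf_eq0; apply/eqP.
  have /eqP := nm_dot Hdot (lincomb b v^T).
  rewrite {2}/lincomb dot_sumr big1 => [|i _]; last by rewrite dotZr dx mulr0.
  by rewrite (fmorph_eq0 (real_complex R)) => /eqP.
move/negP: v0; apply; rewrite -trmx_eq0; apply/eqP; apply: (lincomb_inj hb).
by rewrite x0 lincomb0.
Qed.

(** The inverse Gram matrix expresses the coordinates of [P x] through the inner products with the
    basis, which makes them bounded functionals. *)
Lemma coordinates_exist P n (b : 'I_n -> V) : bounded_op P -> (forall x, P (P x) = P x) ->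
  is_basis (range P) b -> exists be, coordinates P b be.
Proof.
move=> [lP cP] PP hb; have [kp kp0 hP] := op_norm_bound lP cP.
pose G : 'M[C]_n := \matrix_(i, j) dot (b i) (b j).
have uG : G \in unitmx := gram_unit hb.
pose be (i : 'I_n) x := \sum_k dot (P x) (b k) * invmx G k i.
exists be; split.
- pose K := \sum_i \sum_k (kp * nm (b k) * nm (invmx G k i)).
  have t0 i k : 0 <= kp * nm (b k) * nm (invmx G k i) by rewrite !mulr_ge0 ?nm_ge0.
  exists K => [|i x]; first by apply: sumr_ge0 => i _; apply: sumr_ge0.
  apply: le_trans (_ : \sum_k (kp * nm (b k) * nm (invmx G k i)) * nm x <= _).
    apply: le_trans (nm_sum _ _ _) _; apply: ler_sum => k _; rewrite nmM.
    rewrite -mulrA [_ * nm x]mulrC mulrA; apply: ler_wpM2r; first exact: nm_ge0.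
    apply: le_trans (dot_CS Hdot _ _) _; rewrite mulrAC; apply: ler_wpM2r; first exact: nm_ge0.
    exact: hP.
  rewrite -mulr_suml; apply: ler_wpM2r; first exact: nm_ge0.
  rewrite /K [leRHS](bigD1 i) //= lerDl; apply: sumr_ge0 => j _; exact: sumr_ge0.
- by move=> i x y; rewrite /be -big_split; apply: eq_bigr => k _; rewrite linD // dotDl mulrDl.
- by move=> i a x; rewrite /be mulr_sumr; apply: eq_bigr => k _; rewrite linZ // dotZl mulrA.
- move=> x; have [|c hc] := @basis_coord _ _ _ (P x) hb; first by exists x.
  rewrite -hc; apply: eq_bigr => i _; congr (_ *: _).
  have e k : dot (P x) (b k) = (c^T *m G) 0 k.
    by rewrite -hc /lincomb dot_suml mxE; apply: eq_bigr => j _; rewrite dotZl !mxE.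
  rewrite /be; under eq_bigr do rewrite e.
  have -> : \sum_k (c^T *m G) 0 k * invmx G k i = (c^T *m G *m invmx G) 0 i by rewrite [RHS]mxE.
  by rewrite mulmxK // mxE.
- by move=> i x; rewrite /be PP.
Qed.

Lemma coord_unique M P n (b : 'I_n -> V) be (a : 'I_n -> C) x : is_basis M b ->
  coordinates P b be -> P x = \sum_i a i *: b i -> forall i, be i x = a i.
Proof.
move=> hb [_ _ _ hP _]; rewrite hP => e i.
have /(lincomb_inj hb)/matrixP/(_ i 0) : lincomb b (\col_i be i x) = lincomb b (\col_i a i).
  rewrite /lincomb; under eq_bigr do rewrite mxE; rewrite e.
  by apply: eq_bigr => k _; rewrite mxE.
by rewrite !mxE.
Qed.

Lemma coord_basis M P n (b : 'I_n -> V) be i j : is_basis M b -> coordinates P b be ->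
  (forall x, M x -> P x = x) -> be i (b j) = (i == j)%:R.
Proof.
move=> hb hbe Pid; apply: (@coord_unique M P n b be (fun i => (i == j)%:R)) => //.
rewrite Pid; last exact: basis_vec hb.
by rewrite (bigD1 j) //= big1 ?addr0 => [|k /negPf kj]; rewrite ?eqxx ?scale1r // kj scale0r.
Qed.

End Coordinates.

(** * Trace of a matrix without nonzero eigenvalues *)

Section NilpotentTrace.
Variable R : realType.
Local Notation C := R[i].

Lemma trace_no_eigenvalue n (N : 'M[C]_n) :
  (forall (mu : C) (c : 'cV[C]_n), N *m c = mu *: c -> c != 0 -> mu = 0) -> \tr N = 0.
Proof.
move=> h; have [P [Ps [T [PP trigT TE]]]] : exists P Ps T : 'M[C]_n,
    [/\ P *m Ps = 1%:M, is_trig_mx T & T = P *m N *m Ps].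
  by have [P [T [h1 h2 h3 _]]] := schur_form N; exists P; eexists; exists T; split; eassumption.
have PsP : Ps *m P = 1%:M by apply: mulmx1C.
have -> : \tr N = \tr T by rewrite TE mxtrace_mulC mulmxA PsP mul1mx.
rewrite /mxtrace big1 // => i _; apply/eqP; apply/negP => /negP Ti; move/eqP: (Ti); apply.
have dT : \det (T - (T i i)%:M) = 0.
  rewrite det_trig; last first.
    apply/is_trig_mxP => j k jk; rewrite !mxE (is_trig_mxP trigT j k jk).
    by rewrite (_ : (j == k) = false) ?mulr0n ?subr0 //; apply/negbTE; rewrite -val_eqE /= neq_ltn jk.
  by rewrite (bigD1 i) //= !mxE eqxx mulr1n subrr mul0r.
have dN : \det (N - (T i i)%:M)^T == 0.
  rewrite det_tr; apply/eqP; rewrite -[RHS]dT TE mxE.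
  set t := \sum_j _; have -> : P *m N *m Ps - t%:M = P *m (N - t%:M) *m Ps.
    by rewrite mulmxBr mulmxBl -scalemx1 -scalemxAr -scalemxAl mulmx1 PP scalemx1.
  by rewrite !det_mulmx mulrAC -det_mulmx PP det1 mul1r.
have /det0P[v v0 hv] := dN; apply: (h _ v^T); last by rewrite trmx_eq0.
apply/eqP; rewrite -subr_eq0; apply/eqP; apply: trmx_inj.
by rewrite -mul_scalar_mx -mulmxBl trmx_mul trmxK hv trmx0.
Qed.

End NilpotentTrace.
(** * Expansion of the determinant *)

Section Corrector.
Variables (R : realType) (V : completeNormedModType R[i]).
Variable dot : {dot V for conjC}.
Hypothesis Hdot : is_hilbert dot.
Local Notation C := R[i].
Variables (A P : V -> V) (r : R).
Hypotheses (bA : bounded_op A) (r_iso : isolating_radius A 1 r).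
Hypothesis P_riesz : riesz_projection dot A 1 r P.
Local Notation Q := (compl P).

(* [W] solves [(I - Q T Q) W = Q T P], by a Neumann series around the approximate
   reduced resolvent [S] of [A] at 1. *)
Lemma corrector : exists K del : R, [/\ 0 <= K, 0 < del &
  forall T d, bounded_op T -> 0 <= d -> d <= del -> (forall x, nm (T x - A x) <= d * nm x) ->
  exists W, [/\ bounded_op W, forall x, P (W x) = 0,
    forall x, P x = x -> Q (T (x + W x)) = W x &
    forall x, nm (W x) <= K * d * nm x]].
Proof.
have bP := riesz_bounded Hdot r_iso P_riesz.
have PP := riesz_idem Hdot bA r_iso P_riesz.
have PA := riesz_comm Hdot bA r_iso P_riesz.
have [kp kp0 hP] := op_norm_bound bP.1 bP.2.
have [kq kq0 hQ] := compl_bound bP.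
have lP := bP.1; have bQ := bounded_compl bP; have lQ := bQ.1; have lA := bA.1.
pose k1 := kq + 1; have k11 : 1 <= k1 by rewrite lerDr.
have k10 : 0 < k1 by apply: lt_le_trans k11.
have hQ1 x : nm (Q x) <= k1 * nm x.
  by apply: le_trans (hQ x) _; rewrite ler_wpM2r ?nm_ge0 // lerDl.
(* This tolerance and [del] below are chosen so that [Q (E1 u)] and [Q (E2 u)] each stay below a
   quarter of [nm u], after the losses from the norms of [Q] and [S]. *)
have eps0 : 0 < (4 * k1 ^+ 2)^-1 by rewrite invr_gt0 mulr_gt0 // exprn_gt0.
have [S lS [[bS bS0 hS] SE]] := riesz_near_inverse Hdot bA r_iso P_riesz eps0.
pose del := (4 * k1 ^+ 3 * (bS + 1))^-1.
have del0 : 0 < del by rewrite invr_gt0 !mulr_gt0 ?exprn_gt0 // ltr_wpDl.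
have PQ x : P (Q x) = 0 by rewrite /compl (linB _ _ lP) PP subrr.
have Qid x : P x = 0 -> Q x = x by rewrite /compl => ->; rewrite subr0.
have QA x : Q (A x) = A (Q x) by rewrite /compl PA (linB _ _ lA).
exists (k1 * bS * 2 * k1 * kp), del; split=> //; first by rewrite !mulr_ge0 // ltW.
move=> T d bT d0 dd TA; have lT := bT.1.
(* For [Q u = u] one has [u + E u = Q (T - 1) Q S u], since [Q] commutes with [A]. Here [E1] is the
   error of the approximate inverse and [E2] the effect of the perturbation. *)
pose E1 u := A (S (Q u)) - S (Q u) - Q u.
pose E2 u := T (Q (S (Q u))) - A (Q (S (Q u))).
pose E u := Q (E1 u) + Q (E2 u).
have lSQ : linear (fun u => S (Q u)) by exact: linear_comp.
have lE1 : linear E1.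
  by apply: linear_sub => //; apply: linear_sub => //; exact: (linear_comp lA lSQ).
have lE2 : linear E2.
  by apply: linear_sub; [apply: (linear_comp lT) | apply: (linear_comp lA)]; exact: (linear_comp lQ lSQ).
have lE : linear E by apply: linear_add; exact: linear_comp.
have hE u : nm (E u) <= 2^-1 * nm u.
  have h1 : nm (Q (E1 u)) <= 4^-1 * nm u.
    apply: le_trans (hQ1 _) _.
    have h := SE (Q u) (PQ u); rewrite scale1r in h.
    have h' : nm (E1 u) <= (4 * k1 ^+ 2)^-1 * (k1 * nm u).
      by apply: le_trans h _; apply: ler_wpM2l; [exact: ltW | exact: hQ1].
    apply: le_trans (ler_wpM2l (ltW k10) h') _.
    rewrite le_eqVlt; apply/orP; left; apply/eqP; field; exact: lt0r_neq0.
  have h2 : nm (Q (E2 u)) <= 4^-1 * nm u.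
    apply: le_trans (hQ1 _) _.
    have h : nm (E2 u) <= del * (k1 * ((bS + 1) * (k1 * nm u))).
      apply: le_trans (TA _) _; apply: ler_pM => //; first exact: nm_ge0.
      apply: le_trans (hQ1 _) _; rewrite ler_wpM2l ?(ltW k10) //.
      apply: le_trans (hS _) _; apply: ler_pM; rewrite ?nm_ge0 ?lerDl //.
    apply: le_trans (ler_wpM2l (ltW k10) h) _; rewrite /del.
    rewrite le_eqVlt; apply/orP; left; apply/eqP; field.
    by rewrite !lt0r_neq0 // ltr_wpDl.
  by apply: le_trans (nmD _ _) _; lra.
have [N [lN NE hN]] := neumann lE hE.
(* As [Q A P = 0], this is [Q (T x)] for [P x = x]; the difference form shows that it is of order
   [d]. *)
pose v x := Q (T (P x) - A (P x)).
have lv : linear v.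
  by apply: (linear_comp lQ); apply: linear_sub; exact: linear_comp.
pose W x := - Q (S (N (v x))).
have lW : linear W.
  apply: linear_opp; apply: (linear_comp lQ); apply: (linear_comp lS); exact: linear_comp.
have hW x : nm (W x) <= k1 * bS * 2 * k1 * kp * d * nm x.
  rewrite /W nmN; apply: le_trans (hQ1 _) _.
  rewrite -!mulrA; rewrite ler_wpM2l ?(ltW k10) //.
  apply: le_trans (hS _) _; rewrite ler_wpM2l //.
  apply: le_trans (hN _) _; rewrite ler_wpM2l //.
  apply: le_trans (hQ1 _) _; rewrite ler_wpM2l ?(ltW k10) //.
  apply: le_trans (TA _) _; rewrite mulrCA ler_wpM2l //.
exists W; split=> //.
- split=> //; exact: linear_bound_continuous hW.
- by move=> x; rewrite /W (linN _ lP) PQ oppr0.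
move=> x Px; set u := N (v x).
have uE : v x = u + E u by rewrite /u {1}NE subrK.
have Qu : Q u = u.
  by apply: Qid; rewrite /u NE (linB _ _ lP) /E (linD _ _ lP) !PQ addr0 subr0.
have QAx : Q (A x) = 0 by rewrite QA /compl Px subrr lin0.
have vx : Q (T x) = v x by rewrite /v Px (linB _ _ lQ) QAx subr0.
rewrite (linD _ _ lT) (linD _ _ lQ) vx uE /W -/u (linN _ lT) (linN _ lQ) /E /E1 /E2 Qu.
rewrite !(linB _ _ lQ) [Q (A (Q _))]QA !QA [Q (Q _)](Qid _ (PQ _)) Qu.
move: (Q (S u)) (A (Q (S u))) (Q (T (Q (S u)))) => a3 a2 a1.
have -> : a2 - a3 - u + (a1 - a2) = a1 - a3 - u by rewrite addrC !addrA subrK.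
by rewrite [u + _]addrC subrK addrAC subrr add0r.
Qed.

End Corrector.

Section NearCexp.
Variable R : realType.
Local Notation C := R[i].

Lemma nearO_cexp (f : C^o -> C) : nearO f 0 -> nearO (fun z => cexp (f z)) 1.
Proof.
move=> [c c0 hf]; exists (c * expR c); first by rewrite mulr_ge0 ?expR_ge0.
move: hf (@near0_le R _ ltr01); apply: filterS2 => z; rewrite subr0 => hf z1.
apply: le_trans (cexp_near1 _) _; rewrite mulrAC; apply: ler_pM; rewrite ?nm_ge0 ?expR_ge0 //.
by rewrite ler_expR; apply: le_trans hf _; rewrite ler_piMr.
Qed.

End NearCexp.

Section HsbMore.
Variables (R : realType) (V : completeNormedModType R[i]).

Lemma hsb_le (e : nat -> V) T c d : hsb e T c -> 0 <= c -> c <= d -> hsb e T d.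
Proof.
move=> h c0 cd n; apply: le_trans (h n) _; by rewrite ler_sqr // nnegrE (le_trans c0).
Qed.

End HsbMore.
Section Expansion.
Variables (R : realType) (V : completeNormedModType R[i]).
Variable dot : {dot V for conjC}.
Hypotheses (Hdot : is_hilbert dot) (Hsep : separable V).
Local Notation C := R[i].
Local Notation F0 := (nbhs (0 : C^o)).
Local Notation e := (get (onb dot setT)).

Variables (Omega0 : set R[i]^o) (A : R[i]^o -> V -> V) (A0 A1 : V -> V).
Hypotheses (Omega0_open : open Omega0) (Omega0_0 : Omega0 0).
Hypothesis A_hs : forall z, Omega0 z -> hilbert_schmidt dot (A z).
Hypotheses (A0_hs : hilbert_schmidt dot A0) (A1_hs : hilbert_schmidt dot A1).
Hypothesis A_expansion : exists c : R, \forall z \near F0,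
  (hs_norm dot (fun x => A z x - A0 x - z *: A1 x))%:C <= c%:C * `|z| ^+ 2.

Lemma hs_norm_ge0 T : 0 <= hs_norm dot T.
Proof. exact: sqrtr_ge0. Qed.

Lemma family_expansion : exists2 K : R, 0 <= K & \forall z \near F0,
  [/\ bounded_op (A z), hsb e (A z) (hs_norm dot (A z)),
      hsb e (fun x => A z x - A0 x - z *: A1 x) (K * nm z ^+ 2) &
      hsb e (fun x => A z x - A0 x) (K * nm z)].
Proof.
have [c hc] := A_expansion; exists (`|c| + hs_norm dot A1).
  by rewrite addr_ge0 ?hs_norm_ge0.
have Onear : \forall z \near F0, Omega0 z by exact: open_nbhs_nbhs.
move: hc Onear (@near0_le R _ ltr01); apply: filterS3 => z hz Oz z1.
have [bAz _] := A_hs Oz; have hAz := hilbert_schmidt_hsb (A_hs Oz).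
have h0 := hilbert_schmidt_hsb A0_hs; have h1 := hilbert_schmidt_hsb A1_hs.
have hz2 : hs_norm dot (fun x => A z x - A0 x - z *: A1 x) <= c * nm z ^+ 2.
  by move: hz; rewrite -nmE -rmorphXn -rmorphM lecR.
have hzA1 : hsb e (fun x => z *: A1 x) (nm z * hs_norm dot A1).
  by apply: hsb_comp h1 => [|k]; rewrite ?nm_ge0 ?nmZ.
have hd : hsb e (fun x => A z x - A0 x) (hs_norm dot (A z) + hs_norm dot A0).
  by apply: hsb_triangle hAz h0; rewrite ?hs_norm_ge0 // => k; exact: nmB.
(* The expansion bounds an [hs_norm], which is meaningful only for a finite sum. The crude bound by
   three separate norms supplies the finiteness. *)
have hD : hsb e (fun x => A z x - A0 x - z *: A1 x) (hs_norm dot (fun x => A z x - A0 x - z *: A1 x)).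
  apply: hsb_norm; apply: hsb_triangle hd hzA1; rewrite ?addr_ge0 ?mulr_ge0 ?nm_ge0 ?hs_norm_ge0 //.
  by move=> k; exact: nmB.
have cz : c * nm z ^+ 2 <= `|c| * nm z ^+ 2 by rewrite ler_wpM2r ?exprn_ge0 ?nm_ge0 ?ler_norm.
have z2 : nm z ^+ 2 <= nm z by rewrite expr2 ler_piMl ?nm_ge0.
split=> //.
  apply: hsb_le hD _ _; first exact: hs_norm_ge0.
  by rewrite mulrDl (le_trans hz2) // (le_trans cz) // lerDl mulr_ge0 ?hs_norm_ge0 ?exprn_ge0 ?nm_ge0.
apply: (@hsb_le _ _ _ _ (hs_norm dot (fun x => A z x - A0 x - z *: A1 x) + nm z * hs_norm dot A1)).
- apply: hsb_triangle hD hzA1; rewrite ?mulr_ge0 ?nm_ge0 ?hs_norm_ge0 // => k.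
  by rewrite -[X in nm X](subrK (z *: A1 (e k))); exact: nmD.
- by rewrite addr_ge0 ?mulr_ge0 ?nm_ge0 ?hs_norm_ge0.
rewrite mulrDl [nm z * _]mulrC lerD2r (le_trans hz2) // (le_trans cz) //.
by rewrite ler_wpM2l.
Qed.

Variables (r : R) (P : V -> V).
Hypotheses (r_iso : isolating_radius A0 1 r) (P_riesz : riesz_projection dot A0 1 r P).
Local Notation Q := (compl P).
Let bA0 : bounded_op A0 := A0_hs.1.
Let bP : bounded_op P := riesz_bounded Hdot r_iso P_riesz.
Let PP : forall x, P (P x) = P x := riesz_idem Hdot bA0 r_iso P_riesz.
Let PA : forall x, P (A0 x) = A0 (P x) := riesz_comm Hdot bA0 r_iso P_riesz.
Let exV : exists e, onb dot setT e := onb_setT_ex Hdot Hsep.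
Let exM : exists e, onb dot (range Q) e := onb_range Hdot Hsep (bounded_compl bP).

Lemma range_fixed x : range P x -> P x = x.
Proof. by move=> [y _ <-]; rewrite PP. Qed.

Let he : onb dot setT e.
Proof. by have [e1 /getI] := exV. Qed.

Variables (n : nat) (b : 'I_n -> V) (be : 'I_n -> V -> C).
Hypotheses (hb : is_basis (range P) b) (hbe : coordinates P b be).

Lemma be_delta i j : be i (b j) = (i == j)%:R.
Proof. by apply: coord_basis hb hbe _; exact: range_fixed. Qed.

(* [A0 - 1] has no nonzero eigenvalue on [range P], hence trace 0 there. *)
Lemma trace_riesz : \sum_i be i (A0 (b i)) = n%:R.
Proof.
have [_ beD beZ Pbe _] := hbe; have lA := bA0.1; have lP := bP.1.
pose N : 'M[C]_n := \matrix_(i, j) (be i (A0 (b j)) - (i == j)%:R).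
suff : \tr N = 0.
  rewrite /mxtrace; under eq_bigr do rewrite mxE eqxx.
  rewrite big_split /= -[in X in _ + X]mulrN1z.
  by rewrite sumrN sumr_const card_ord => /eqP; rewrite subr_eq0 => /eqP.
apply: trace_no_eigenvalue => mu c Nc c0.
have Pb j : P (b j) = b j by apply: range_fixed; exact: basis_vec hb.
have PL : P (lincomb b c) = lincomb b c by apply: range_fixed; exact: basis_mem hb.
apply: (riesz_eigen Hdot bA0 r_iso P_riesz (x := lincomb b c)) => //; last first.
  by apply: contra_neq c0 => h; apply: (lincomb_inj hb); rewrite h lincomb0.
rewrite scale1r -lincombZ -Nc {1 2}/lincomb lin_sum // -sumrB.
transitivity (\sum_j c j 0 *: \sum_i N i j *: b i).
  apply: eq_bigr => j _; rewrite linZ // -scalerBr; congr (_ *: _).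
  have -> : A0 (b j) - b j = P (A0 (b j) - b j) by rewrite linB // PA Pb.
  rewrite Pbe; apply: eq_bigr => i _; rewrite mxE -scaleN1r beD beZ be_delta.
  by rewrite mulN1r.
under eq_bigr do rewrite scaler_sumr.
rewrite exchange_big /lincomb; apply: eq_bigr => i _; rewrite mxE scaler_suml.
by apply: eq_bigr => j _; rewrite scalerA mulrC.
Qed.

Local Notation detQ := (det2 dot (range Q) (Q \o A0 \o Q)).

Lemma nearO_detQ : nearO (fun z => det2 dot (range Q) (Q \o A z \o Q)) detQ.
Proof.
have [K K0 hK] := family_expansion; have [kq kq0 hQ] := compl_bound bP.
set h0 := hs_norm dot A0; have h00 : 0 <= h0 := hs_norm_ge0 A0.
pose s := kq * (h0 + K); have s0 : 0 <= s by rewrite mulr_ge0 ?addr_ge0.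
(* The bound on [nm z] derived from [e1] meets the smallness condition of [det2_lipschitz] at radius
   [s]. *)
pose e1 := (4 * (1 + expR s))^-1; have g0 : 0 < 1 + expR s by rewrite addr_gt0 ?expR_gt0.
have e10 : 0 < e1 / (kq * K + 1) by rewrite divr_gt0 ?invr_gt0 ?mulr_gt0 // ltr_wpDl ?mulr_ge0.
exists (kq * K * mdetK s); first by rewrite !mulr_ge0 ?mdetK_ge0.
have lQ := (bounded_compl bP).1; have MQ T x : range Q (Q (T x)) by exists (T x).
have QQ k : Q (get (onb dot (range Q)) k) = get (onb dot (range Q)) k by exact: compl_onb_id.
move: hK (@near0_le R _ e10) (@near0_le R _ ltr01); apply: filterS3 => z [bAz _ _ hd] ze z1.
have e'0 : hsb (get (onb dot (range Q))) A0 h0.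
  by apply: hsb_compl => //; [exact: bA0.1|exact: bA0.2|exact: hilbert_schmidt_hsb].
have bd : bounded_op (fun x => A z x - A0 x) by exact: bounded_sub.
have e'd : hsb (get (onb dot (range Q))) (fun x => A z x - A0 x) (K * nm z).
  by apply: hsb_compl => //; [exact: bd.1|exact: bd.2|rewrite mulr_ge0 ?nm_ge0].
have e'z : hsb (get (onb dot (range Q))) (A z) (h0 + K * nm z).
  apply: hsb_triangle e'0 e'd => // [|k]; first by rewrite mulr_ge0 ?nm_ge0.
  by rewrite -[X in nm X](addrNK (A0 (get (onb dot (range Q)) k))) addrC; exact: nmD.
have comp T c : hsb (get (onb dot (range Q))) T c -> hsb (get (onb dot (range Q))) (Q \o T \o Q) (kq * c).
  by move=> hT; apply: hsb_comp hT => // k; rewrite /= QQ; exact: hQ.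
have -> : kq * K * mdetK s * nm z = (kq * (K * nm z)) * mdetK s by rewrite mulrAC !mulrA.
apply: det2_lipschitz => //.
- by rewrite !mulr_ge0 ?nm_ge0.
- exact: bounded_QAQ.
- exact: bounded_QAQ.
- apply: hsb_le (comp _ _ e'0) _ _; first exact: mulr_ge0.
  by rewrite ler_wpM2l // lerDl.
- apply: hsb_le (comp _ _ e'z) _ _; first by rewrite !mulr_ge0 ?addr_ge0 ?mulr_ge0 ?nm_ge0.
  by rewrite ler_wpM2l // lerD2l ler_piMr.
- have -> : (fun x => (Q \o A z \o Q) x - (Q \o A0 \o Q) x) = Q \o (fun x => A z x - A0 x) \o Q.
    by apply/funext => x /=; rewrite (linB _ _ lQ).
  exact: comp.
rewrite mulrA; apply: le_trans (_ : e1 * (1 + expR s) <= _); last first.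
  by rewrite /e1 invfM -mulrA mulVf ?mulr1 ?lt0r_neq0.
rewrite ler_wpM2r ?(ltW g0) //; apply: le_trans (_ : (kq * K + 1) * nm z <= _).
  by rewrite ler_wpM2r ?nm_ge0 // lerDl.
rewrite mulrC -ler_pdivlMr // ltr_wpDl // mulr_ge0 //.
Qed.

Lemma nearO_coord_sum : nearO (fun z => \sum_i be i (A z (b i)) - n%:R) 0.
Proof.
have [K K0 hK] := family_expansion; have [[kb kb0 hB] beD beZ _ _] := hbe.
suff : nearO (fun z => \sum_i be i (A z (b i)) - n%:R) (\sum_i be i (A0 (b i)) - n%:R).
  by rewrite trace_riesz subrr.
apply: nearOD; last exact: nearO_cst.
apply: nearO_sum => i _; exists (kb * (K * nm (b i))); first by rewrite !mulr_ge0 ?nm_ge0.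
move: hK; apply: filterS => z [bAz _ _ hd].
rewrite -mulN1r -beZ scaleN1r -beD; apply: le_trans (hB _ _) _.
rewrite -!mulrA ler_wpM2l // [nm _ * nm z]mulrC mulrA.
apply: (hsb_op_bound Hdot he) hd _; first exact: bounded_sub.
by rewrite mulr_ge0 ?nm_ge0.
Qed.

Lemma det2_expansion : exists (g : C^o -> C) (B : C^o -> V -> V),
  [/\ nearO g detQ, forall z, bounded_op (B z), op_bigO B & \forall z \near F0,
    det2 dot setT (A z) = g z * (expR n%:R)%:C * (-1) ^+ n *
      \det (\matrix_(i, j) be i (A0 (b j) - b j + z *: (A1 (b j) + B z (b j))))].
Proof.
have [K K0 hK] := family_expansion; have [[kb kb0 hB] beD beZ Pbe beP] := hbe.
have [kp kp0 hP] := op_norm_bound bP.1 bP.2.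
have [KW [del [KW0 del0 corr]]] := corrector Hdot bA0 r_iso P_riesz.
have d0 : 0 < del / (K + 1) by rewrite divr_gt0 // ltr_wpDl.
pose good z W := [/\ bounded_op W, forall x, P (W x) = 0,
    forall x, P x = x -> Q (A z (x + W x)) = W x &
    forall x, nm (W x) <= KW * (K * nm z) * nm x].
have exW : \forall z \near F0, exists W, good z W.
  move: hK (@near0_le R _ d0); apply: filterS2 => z [bAz _ _ hd] ze.
  apply: (corr (A z) (K * nm z)) => //; first by rewrite mulr_ge0 ?nm_ge0.
    apply: le_trans (_ : (K + 1) * nm z <= _); first by rewrite ler_wpM2r ?nm_ge0 // lerDl.
    by rewrite mulrC -ler_pdivlMr // ltr_wpDl.
  move=> x; apply: (hsb_op_bound Hdot he (T := fun x => A z x - A0 x)) hd x; first exact: bounded_sub.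
  by rewrite mulr_ge0 ?nm_ge0.
have [W hW] : exists W : C^o -> V -> V, forall z, (exists W, good z W) -> good z (W z).
  have /choice [W hW] : forall z, exists W, (exists W, good z W) -> good z W.
    by move=> z; have [[W hW]|nW] := pselect (exists W, good z W); [exists W | exists id].
  by exists W.
pose ok z := (exists W, good z W) /\ bounded_op (A z).
pose D z x := P (A z (x + W z x) - A0 x - z *: A1 x).
(* The value 0 away from the good parameters keeps [B z] bounded for every [z]. At [z = 0] the
   convention [0^-1 = 0] gives [B 0 = 0], consistently with [D 0 = 0]. *)
pose B z x := if pselect (ok z) then z^-1 *: D z x else 0.
have bB z : bounded_op (B z).
  rewrite /B; case: (pselect (ok z)) => [[gz bAz]|nok] /=.
    apply: bounded_scale; apply: bounded_comp => //; apply: bounded_sub.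
      apply: bounded_sub => //; apply: (bounded_comp bAz); apply: bounded_add; first exact: bounded_id.
      by have [] := hW z gz.
    exact: bounded_scale A1_hs.1.
  split=> [a x y|x]; [by rewrite scaler0 addr0 | exact: cvg_cst].
pose c := kp * (K + K * (KW * K)).
have c0 : 0 <= c by rewrite !(mulr_ge0, addr_ge0).
have hD : \forall z \near F0, ok z /\ forall x, nm (D z x) <= c * nm z ^+ 2 * nm x.
  move: hK exW; apply: filterS2 => z [bAz _ hd2 hd] gz; split=> [|x]; first by split.
  have [bW PW _ hWb] := hW z gz.
  have lP := bP.1; have lAz := bAz.1.
  have -> : D z x = P (A z x - A0 x - z *: A1 x) + P (A z (W z x) - A0 (W z x)).
    (* As [P] commutes with [A0] and kills [W z x], the term [A0 (W z x)] can be subtracted at no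
       cost; then [A z - A0] and [W z] contribute one factor [z] each. *)
    have PAW : P (A0 (W z x)) = 0 by rewrite PA PW; exact: lin0 bA0.1.
    by rewrite /D (linD _ _ lAz) !(linB _ _ lP) (linD _ _ lP) PAW subr0 -addrA addrAC addrA.
  apply: le_trans (nmD _ _) _; rewrite /c mulrDr !mulrDl; apply: lerD.
    apply: le_trans (hP _) _.
    have -> : kp * K * nm z ^+ 2 * nm x = kp * (K * nm z ^+ 2 * nm x) by rewrite !mulrA.
    rewrite ler_wpM2l //.
    apply: (hsb_op_bound Hdot he (T := fun x => A z x - A0 x - z *: A1 x)) hd2 x.
      by apply: bounded_sub; [exact: bounded_sub | exact: bounded_scale A1_hs.1].
    by rewrite mulr_ge0 ?exprn_ge0 ?nm_ge0.
  apply: le_trans (hP _) _.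
  have -> : kp * (K * (KW * K)) * nm z ^+ 2 * nm x = kp * (K * (KW * K) * nm z ^+ 2 * nm x) by rewrite !mulrA.
  rewrite ler_wpM2l //; apply: le_trans (_ : (K * nm z) * nm (W z x) <= _).
    apply: (hsb_op_bound Hdot he (T := fun x => A z x - A0 x)) hd _; first exact: bounded_sub.
    by rewrite mulr_ge0 ?nm_ge0.
  have -> : K * (KW * K) * nm z ^+ 2 * nm x = (K * nm z) * (KW * (K * nm z) * nm x) by ring.
  by rewrite ler_wpM2l ?mulr_ge0 ?nm_ge0.
exists (fun z => det2 dot (range Q) (Q \o A z \o Q) * cexp (\sum_i be i (A z (b i)) - n%:R)), B.
split=> //.
- rewrite -[detQ]mulr1; apply: nearOM; first exact: nearO_detQ.
  by apply: nearO_cexp; exact: nearO_coord_sum.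
- exists c; move: hD; apply: filterS => z [okz hD] x.
  rewrite -!nmE -!rmorphM lecR /B; case: (pselect (ok z)) => //= okz'.
  rewrite nmZ nmV; have [->|z0] := eqVneq z 0.
    by rewrite nm0 invr0 mul0r mulr0 mul0r.
  rewrite mulrC ler_pdivrMr ?nm_gt0 //; apply: le_trans (hD x) _.
  by rewrite expr2 mulrA mulrAC.
move: hD hK; apply: filterS2 => z [[gz bAz] hD] [_ hAz _ _].
have [bW PW QW _] := hW z gz.
have Pb j : P (b j) = b j by apply: range_fixed; exact: basis_vec hb.
rewrite (block_det Hdot exV (hs_norm_ge0 (A z)) bAz hAz bP PP exM kb0 hB beD beZ Pbe
  (w := fun j => W z (b j))) //; last by move=> j; exact: QW.
(* The factor [exp n] is split off from the exponential of the trace; the remaining exponent is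
   [O(z)] by [nearO_coord_sum]. *)
have cE t : cexp t = cexp (t - n%:R) * (expR n%:R)%:C :> C.
  by rewrite -cexp_real -cexpD rmorph_nat subrK.
rewrite [cexp (\sum_i _)]cE -!mulrA; do 3! congr (_ * _).
rewrite -detZ; apply: (congr1 (fun M => _ * \det M)); apply/matrixP => i j; rewrite !mxE mulN1r.
have zB : z *: B z (b j) = D z (b j).
  rewrite /B; case: (pselect (ok z)) => [okz|[]] /=; last by split.
  rewrite scalerA; have [z0|z0] := eqVneq z 0; last by rewrite divff // scale1r.
  rewrite z0 mul0r scale0r; apply/esym/eqP; rewrite -nm_eq0 eq_le nm_ge0 andbT.
  by have := hD (b j); rewrite z0 nm0 expr0n mulr0 mul0r.
rewrite scalerDr zB /D !beD beP !(beD, beZ) -[- b j]scaleN1r beZ be_delta.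
rewrite -[- (A0 _)]scaleN1r -[- (z *: _)]scaleN1r !beZ; ring.
Qed.

End Expansion.

(** * The semisimple case and the geometric multiplicity *)

Section MainParts.
Variables (R : realType) (V : completeNormedModType R[i]).
Variable dot : {dot V for conjC}.
Hypothesis Hdot : is_hilbert dot.
Local Notation C := R[i].
Variables (A0 P : V -> V) (r : R).
Hypotheses (bA0 : bounded_op A0) (r_iso : isolating_radius A0 1 r).
Hypothesis P_riesz : riesz_projection dot A0 1 r P.
Let bP : bounded_op P := riesz_bounded Hdot r_iso P_riesz.
Let PP : forall x, P (P x) = P x := riesz_idem Hdot bA0 r_iso P_riesz.
Let PA : forall x, P (A0 x) = A0 (P x) := riesz_comm Hdot bA0 r_iso P_riesz.
Local Notation Q := (compl P).

Section Coords.
Variables (n : nat) (b : 'I_n -> V) (be : 'I_n -> V -> C).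
Hypotheses (hb : is_basis (range P) b) (hbe : coordinates P b be).

Lemma det_fin_coord (T U : V -> V) : linear T -> (forall x, P x = x -> T x = P (U x)) ->
  det_fin n (range P) T = \det (\matrix_(i, j) be i (U (b j))).
Proof.
move=> lT TU; have [_ _ _ Pbe _] := hbe; apply: (det_finE hb lT) => j.
rewrite TU; first by rewrite Pbe; apply: eq_bigr => i _; rewrite mxE.
by have [y _ <-] := basis_vec j hb.
Qed.

Lemma nearO_be (A1 : V -> V) (B : C^o -> V -> V) i x : op_bigO B ->
  nearO (fun z => be i (A1 x + B z x)) (be i (A1 x)).
Proof.
move=> [c hc]; have [[kb kb0 hB] beD beZ _ _] := hbe.
exists (kb * (`|c| * nm x)); first by rewrite !mulr_ge0 ?nm_ge0.
move: hc; apply: filterS => z /(_ x); rewrite -!nmE -!rmorphM lecR => hz.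
rewrite beD addrAC subrr add0r; apply: le_trans (hB _ _) _.
rewrite -!mulrA ler_wpM2l //; apply: le_trans hz _; rewrite mulrA [leRHS]mulrAC.
by rewrite -!mulrA ler_wpM2r ?ler_norm // mulr_ge0 ?nm_ge0.
Qed.

Hypothesis semisimple : forall x, A0 (P x) - P x = 0.

(* On [range P] the operator [P + A0] is 2, so that [I - (P + A0)] is -1 there. *)
Lemma det2_add_projection : separable V -> hilbert_schmidt dot A0 ->
  det2 dot setT (fun x => P x + A0 x) =
  det2 dot (range Q) (Q \o A0 \o Q) * (expR (2 * n%:R))%:C * (-1) ^+ n.
Proof.
move=> Hsep hsA0; have [[kb kb0 hB] beD beZ Pbe beP] := hbe.
have [kp kp0 hP] := op_norm_bound bP.1 bP.2.
have exV := onb_setT_ex Hdot Hsep; have bQ := bounded_compl bP.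
have exM := onb_range Hdot Hsep bQ.
have AP x : A0 (P x) = P x by apply/eqP; rewrite -subr_eq0 semisimple.
have bPA : bounded_op (fun x => P x + A0 x) by exact: bounded_add.
(* Semisimplicity gives [P = P A0], so [P] inherits a Hilbert-Schmidt bound from [A0]. *)
have hPA : hsb (get (onb dot setT)) (fun x => P x + A0 x) ((kp + 1) * hs_norm dot A0).
  apply: (hsb_comp _ _ (hilbert_schmidt_hsb hsA0)) => [|k]; first by rewrite addr_ge0.
  apply: le_trans (nmD _ _) _; rewrite mulrDl mul1r lerD2r -AP -PA; exact: hP.
have Pb j : P (b j) = b j by have [y _ <-] := basis_vec j hb.
have Ab j : A0 (b j) = b j by rewrite -[in LHS]Pb AP Pb.
have bd i j : be i (b j) = (i == j)%:R.
  by apply: (coord_basis _ _ hb hbe) => x [y _ <-].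
have Qb j : Q (b j) = 0 by rewrite /compl Pb subrr.
rewrite (block_det Hdot exV _ bPA hPA bP PP exM kb0 hB beD beZ Pbe (w := fun=> 0)); first last.
- by move=> j; rewrite addr0 Pb Ab (linD _ _ bQ.1) Qb addr0.
- by move=> j; exact: lin0 bP.1.
- by rewrite mulr_ge0 ?addr_ge0 ?hs_norm_ge0.
have QE : Q \o (fun x => P x + A0 x) \o Q = Q \o A0 \o Q.
  apply/funext => x; apply: (congr1 Q).
  by rewrite [P _ in LHS](linB _ _ bP.1) PP subrr add0r.
have trE : \sum_i be i (P (b i) + A0 (b i)) = (2 * n%:R)%:C.
  under eq_bigr do rewrite Pb Ab beD bd eqxx.
  by rewrite big_split /= !sumr_const card_ord rmorphM /= !rmorph_nat mulr_natl mulr2n.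
have sE : \matrix_(i, j) ((i == j)%:R - be i (P (b j + 0) + A0 (b j + 0))) = -1 *: 1%:M.
  by apply/matrixP => i j; rewrite !mxE addr0 Pb Ab beD bd mulN1r; ring.
by rewrite QE trE sE cexp_real detZ det1 mulr1.
Qed.

End Coords.

Section JordanBasis.
Variables (n : nat) (S : {linear V -> 'cV[C]_n}).
Hypothesis bijS : set_bij (range P) setT S.

Lemma S_inj x y : range P x -> range P y -> S x = S y -> x = y.
Proof. by move=> Px Py; have [_ h _] := bijS; apply: h; rewrite inE. Qed.

Lemma dual_basis_exists : exists b : 'I_n -> V,
  is_basis (range P) b /\ forall c, S (lincomb b c) = c.
Proof.
have ex (j : 'I_n) : exists x, range P x /\ S x = delta_mx j 0.
  by have [_ _ /(_ (delta_mx j 0) I)[x Px Sx]] := bijS; exists x.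
have [b hb] := choice ex; have lP := bP.1; exists b.
have Sb c : S (lincomb b c) = c.
  rewrite /lincomb linear_sum /=; apply/matrixP => i k; rewrite summxE (ord1 k) (bigD1 i) //=.
  rewrite linearZ /= (hb i).2 !mxE !eqxx mulr1 big1 ?addr0 // => j ji.
  by rewrite linearZ /= (hb j).2 !mxE eq_sym (negPf ji) mulr0.
have Pb c : range P (lincomb b c).
  exists (lincomb b c) => //; rewrite /lincomb lin_sum //; apply: eq_bigr => i _.
  by rewrite linZ //; have [[y _ <-] _] := hb i; rewrite PP.
split=> //; split=> //.
  by move=> c d _ _ /(congr1 S); rewrite !Sb.
by move=> x Px; exists (S x) => //; apply: S_inj.
Qed.

(** By [riesz_fixed] every eigenvector lies in the range of [P], where the eigenvalue equation reads
    [J *m S x = 0]; the basis vectors of the kept columns solve it. *)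
Lemma has_dim_jordan (J : 'M[C]_n) : nilpotent_jordan J ->
  has_matrix (range P) S (P \o (fun x => A0 (P x) - P x) \o P) J ->
  has_dim [set x | A0 x = x] (n - nu J).
Proof.
move=> Jn hJ; have [b [hb Sb]] := dual_basis_exists.
have lP := bP.1; have lA := bA0.1.
have fixP x : A0 x = x <-> range P x /\ J *m S x = 0.
  split=> [Ax|[[y _ <-]]].
    have Px : P x = x.
      by apply: (riesz_fixed Hdot bA0 r_iso P_riesz); rewrite scale1r.
    split; first by exists x.
    have rx : range P x by exists x.
    by rewrite -(hJ x rx) /= !Px Ax subrr lin0 // linear0.
  have ry : range P (P y) by exists y.
  rewrite -(hJ _ ry) /= !PP (linB _ _ lP) PA !PP => h; apply/eqP; rewrite -subr_eq0; apply/eqP.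
  by apply: S_inj; rewrite ?linear0 //; [exists (A0 (P y) - P y); rewrite // (linB _ _ lP) PA !PP | exists 0; rewrite // lin0].
have szt : size (kept_cols J) == (n - nu J)%N by rewrite size_kept_cols.
pose t : (n - nu J).-tuple 'I_n := Tuple szt.
have ut : uniq t by rewrite filter_uniq // enum_uniq.
have tinj : injective (tnth t) by exact/tuple_uniqP.
have tk k : ~~ [exists i, J i (tnth t k) == 1].
  by have := mem_tnth k t; rewrite mem_filter => /andP[].
exists (b \o tnth t).
have lE c : lincomb (b \o tnth t) c = lincomb b (\sum_k c k 0 *: delta_mx (tnth t k) 0).
  rewrite /lincomb /=; apply/esym; under eq_bigr do rewrite summxE scaler_suml.
  rewrite exchange_big /=; apply: eq_bigr => k _.
  rewrite (bigD1 (tnth t k)) //= big1 ?addr0 => [|i ik]; rewrite !mxE ?eqxx ?mulr1 //.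
  by rewrite (negPf ik) mulr0 scale0r.
have SlE c : S (lincomb (b \o tnth t) c) = \sum_k c k 0 *: delta_mx (tnth t k) 0.
  by rewrite lE Sb.
have ent (c : 'cV[C]_(n - nu J)) k :
    (\sum_k c k 0 *: delta_mx (tnth t k) 0 : 'cV[C]_n) (tnth t k) 0 = c k 0.
  rewrite summxE (bigD1 k) //= big1 ?addr0 => [|l lk]; rewrite !mxE ?eqxx ?mulr1 //.
  by rewrite (inj_eq tinj) eq_sym (negPf lk) mulr0.
split.
- move=> c _ /=; apply/fixP; split; first by rewrite lE; exact: basis_mem hb.
  rewrite SlE; apply/jordan_ker => // j jJ; rewrite summxE; apply: big1 => k _; rewrite !mxE.
  case: eqP => [e|]; last by rewrite mulr0.
  by have := tk k; rewrite -e jJ.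
- move=> c d _ _ /(congr1 S); rewrite !SlE => cd; apply/matrixP => k l.
  by rewrite (ord1 l) -ent cd ent.
move=> x /fixP[Px /jordan_ker/(_ _) JS]; exists (\col_k S x (tnth t k) 0) => //.
apply: S_inj => //; first by rewrite lE; exact: basis_mem hb.
rewrite SlE; apply/matrixP => j k; rewrite (ord1 k).
have [/tnthP[l ->]|jt] := boolP (j \in t); first by rewrite ent mxE.
have jJ : [exists i, J i j == 1].
  by move: jt; rewrite mem_filter mem_enum andbT negbK.
rewrite (JS Jn) // summxE; apply: big1 => l _; rewrite !mxE.
by case: eqP jt => [->|]; rewrite ?mem_tnth ?mulr0.
Qed.

End JordanBasis.

End MainParts.

(** * The expansions assembled *)

Theorem theorem2p7 (R : realType) (V : completeNormedModType R[i])
  (dot : {dot V for conjC}) (Hdot : is_hilbert dot) (Hsep : separable V)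
  (Omega0 : set R[i]^o) (Omega0_open : open Omega0) (Omega0_0 : Omega0 0)
  (A : R[i]^o -> V -> V) (A_analytic : hs_analytic dot Omega0 A)
  (A0 A1 : V -> V)
  (A0_hs : hilbert_schmidt dot A0) (A1_hs : hilbert_schmidt dot A1)
  (A_expansion : exists c : R, \forall z \near (0 : R[i]^o),
     (hs_norm dot (fun x => A z x - A0 x - z *: A1 x))%:C <= c%:C * `|z| ^+ 2)
  (one_discrete : discrete_spectrum dot A0 1)
  (r : R) (r_isolating : isolating_radius A0 1 r)
  (P0 : V -> V) (P0_riesz : riesz_projection dot A0 1 r P0)
  (n0 : nat) (n0_dim : has_dim (range P0) n0) :
  let F0 := nbhs (0 : R[i]^o) in
  let Q0 := fun x : V => x - P0 x in
  let D0 := fun x : V => A0 (P0 x) - P0 x in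
  let detA := fun z : R[i]^o => det2 dot setT (A z) in
  let detQ := det2 dot (range Q0) (Q0 \o A0 \o Q0) in
  let detP := det_fin n0 (range P0) in
  let expn0 : R[i]^o := (expR n0%:R)%:C in
  [/\ (exists (f : R[i]^o -> R[i]^o) (B : R[i]^o -> V -> V),
        [/\ f =O_F0 (fun z => z),
            (forall z, bounded_op (B z)),
            op_bigO B &
            \forall z \near (0 : R[i]^o),
              detA z = (detQ + f z) * expn0 * (-1) ^+ n0 *
                detP (fun x => P0 (D0 (P0 x)) +
                               z *: P0 (A1 (P0 x) + B z (P0 x)))]),
      (forall (S : {linear V -> 'cV[R[i]]_n0}) (J X1 : 'M[R[i]]_n0),
        set_bij (range P0) setT S ->
        nilpotent_jordan J ->
        has_matrix (range P0) S (P0 \o D0 \o P0) J ->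
        has_matrix (range P0) S (P0 \o A1 \o P0) X1 ->
        has_dim [set x | A0 x = x] (n0 - nu J) /\
        detA = (fun z => detQ * expn0 * \det (struck J X1) *
                  (- z) ^+ (n0 - nu J))
                 +O_F0 (fun z => z ^+ (n0 - nu J).+1)),
      ((forall x, D0 x = 0) ->
        detA = (fun z => detQ * expn0 * detP (P0 \o A1 \o P0) * (- z) ^+ n0)
                 +O_F0 (fun z => z ^+ n0.+1) /\
        detA = (fun z => det2 dot setT (fun x => P0 x + A0 x) *
                  (expR (- n0%:R))%:C * detP (P0 \o A1 \o P0) * z ^+ n0)
                 +O_F0 (fun z => z ^+ n0.+1)) &
      (n0 = 1%N ->
        detA = (fun z => det2 dot setT (fun x => P0 x + A0 x) *
                  (expR (- 1))%:C * detP (P0 \o A1 \o P0) * z)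
                 +O_F0 (fun z => z ^+ 2))].
Proof.
move=> F0 Q0 D0 detA detQ detP expn0.
have bA0 := A0_hs.1; have lA0 := bA0.1; have lA1 := A1_hs.1.1.
have bP := riesz_bounded Hdot r_isolating P0_riesz; have lP := bP.1.
have PP := riesz_idem Hdot bA0 r_isolating P0_riesz.
have PA := riesz_comm Hdot bA0 r_isolating P0_riesz.
have core := det2_expansion Hdot Hsep Omega0_open Omega0_0 A_analytic.1 A0_hs A1_hs
  A_expansion r_isolating P0_riesz.
have [b0 hb0] := n0_dim; have [be0 hbe0] := coordinates_exist Hdot bP PP hb0.
(* Kept apart because a simple eigenvalue also reduces to it. With [D0 = 0] the inner matrix is
   exactly [z] times another one, whence the factor [z ^+ n0]. *)
have part3 : (forall x, D0 x = 0) ->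
    detA = (fun z => detQ * expn0 * detP (P0 \o A1 \o P0) * (- z) ^+ n0)
             +O_F0 (fun z => z ^+ n0.+1) /\
    detA = (fun z => det2 dot setT (fun x => P0 x + A0 x) *
              (expR (- n0%:R))%:C * detP (P0 \o A1 \o P0) * z ^+ n0)
             +O_F0 (fun z => z ^+ n0.+1).
  move=> D00.
  have [g [B [hg bB hB detE]]] := core _ _ _ hb0 hbe0.
  have dP : detP (P0 \o A1 \o P0) = \det (\matrix_(i, j) be0 i (A1 (b0 j))).
    apply: (det_fin_coord Hdot bA0 r_isolating P0_riesz hb0 hbe0) => [|x Px]; last by rewrite /= Px.
    exact: linear_comp lP (linear_comp lA1 lP).
  have Db j : A0 (b0 j) - b0 j = 0.
    have := D00 (b0 j); rewrite /D0.
    by have [y _ <-] := basis_vec j hb0; rewrite PP.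
  pose dX z := \det (\matrix_(i, j) be0 i (A1 (b0 j) + B z (b0 j))).
  have hX : nearO dX (detP (P0 \o A1 \o P0)).
    rewrite dP; apply: nearO_det => i j; rewrite mxE.
    under [X in nearO X]eq_fun do rewrite mxE.
    exact: (nearO_be hbe0).
  have key : detA = (fun z => expn0 * (-1) ^+ n0 * (z ^+ n0 * (detQ * detP (P0 \o A1 \o P0))))
      +O_F0 (fun z => z ^+ n0.+1).
    apply: (nearO_bigO (nearOM hg hX)); move: detE; apply: filterS => z; rewrite /detA => ->.
    set M := \matrix_(i, j) _; have -> : M = z *: \matrix_(i, j) be0 i (A1 (b0 j) + B z (b0 j)).
      have [_ _ beZ _ _] := hbe0.
      by apply/matrixP => i j; rewrite !mxE Db add0r beZ.
    by rewrite detZ -/(dX z) /expn0; ring.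
  have e1 : (fun z => expn0 * (-1) ^+ n0 * (z ^+ n0 * (detQ * detP (P0 \o A1 \o P0)))) =
      (fun z : R[i]^o => detQ * expn0 * detP (P0 \o A1 \o P0) * (- z) ^+ n0).
    by apply/funext => z; rewrite [(- z) ^+ _]exprNn; ring.
  split; first by rewrite -e1.
  (* Adding [P0] contributes [e ^ (2 n0)] and the sign [(-1) ^ n0]; the factor [expR (- n0%:R)]
     corrects the former, and the latter turns [(- z) ^+ n0] into [z ^+ n0]. *)
  rewrite (det2_add_projection Hdot bA0 r_isolating P0_riesz hb0 hbe0 D00 Hsep A0_hs) -/detQ.
  suff <- : (fun z => expn0 * (-1) ^+ n0 * (z ^+ n0 * (detQ * detP (P0 \o A1 \o P0)))) =
      (fun z : R[i]^o => detQ * (expR (2 * n0%:R))%:C * (-1) ^+ n0 * (expR (- n0%:R))%:C *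
         detP (P0 \o A1 \o P0) * z ^+ n0) by [].
  apply/funext => z.
  have -> : expn0 = (expR (2 * n0%:R))%:C * (expR (- n0%:R))%:C.
    by rewrite /expn0 -rmorphM -expRD; congr (expR _)%:C; ring.
  ring.
split; [| |exact: part3|].
- have [g [B [hg bB hB detE]]] := core _ _ _ hb0 hbe0.
  exists (fun z => g z - detQ), B; split=> //.
    by apply: nearO_bigO0; rewrite -[0](subrr detQ); apply: nearOD => //; exact: nearO_cst.
  move: detE; apply: filterS => z; rewrite /detA => ->.
  rewrite addrC subrK; apply: (congr1 (fun d => _ * d)); apply/esym.
  apply: (det_fin_coord Hdot bA0 r_isolating P0_riesz hb0 hbe0 (U := fun x => A0 x - x + z *: (A1 x + B z x))) => [|x Px].
    have lBz := (bB z).1.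
    apply: linear_add.
      by apply: (linear_comp lP); apply: linear_sub; [do 2!apply: linear_comp => // |apply: linear_comp => //].
    apply: linear_scale; apply: (linear_comp lP).
    by apply: linear_add; exact: linear_comp.
  by rewrite /D0 !Px (linD (A0 x - x) (z *: _) lP) (linZ z _ lP).
- move=> S J X1 bijS Jn hJ hX1; split.
    exact: (has_dim_jordan Hdot bA0 r_isolating P0_riesz bijS Jn hJ).
  have [b [hb Sb]] := dual_basis_exists Hdot bA0 r_isolating P0_riesz bijS.
  have [be hbe] := coordinates_exist Hdot bP PP hb.
  have [_ beD beZ Pbe beP] := hbe.
  have [g [B [hg bB hB detE]]] := core _ _ _ hb hbe.
  have Sbe x : S (P0 x) = \col_i be i x.
    rewrite -[RHS]Sb Pbe; congr (S _); apply: eq_bigr => i _; by rewrite mxE.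
  have rb j : range P0 (b j) := basis_vec j hb.
  have Pb j : P0 (b j) = b j by have [y _ <-] := rb j; rewrite PP.
  have SbJ j : S (b j) = delta_mx j 0 by rewrite -lincomb_delta Sb.
  (* In the basis that [S] sends to the unit vectors, coordinates are the entries of the matrices
     given through [S]. *)
  have mxJ (T : V -> V) Y : has_matrix (range P0) S (P0 \o T \o P0) Y -> forall i j, be i (T (b j)) = Y i j.
    move=> hY i j; have := hY _ (rb j); rewrite /= Pb Sbe SbJ -colE => /matrixP/(_ i 0).
    by rewrite !mxE.
  have hX i j : nearO (fun z => (\matrix_(i, j) be i (A1 (b j) + B z (b j))) i j) (X1 i j).
    under [X in nearO X]eq_fun do rewrite mxE.
    rewrite -(mxJ _ _ hX1); exact: (nearO_be hbe).
  have [g2 hg2 g2E] := nearO_det_jordan Jn hX.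
  have nun : (nu J <= n0)%N by rewrite nu_rows // -[n0 in leqRHS]card_ord max_card.
  suff <- : (fun z => expn0 * (-1) ^+ n0 * (z ^+ (n0 - nu J) * (detQ * ((-1) ^+ nu J * \det (struck J X1))))) =
      (fun z : R[i]^o => detQ * expn0 * \det (struck J X1) * (- z) ^+ (n0 - nu J)).
    apply: (nearO_bigO (nearOM hg hg2)); move: detE; apply: filterS => z; rewrite /detA => ->.
    set M := \matrix_(i, j) _.
    have -> : M = J + z *: \matrix_(i, j) be i (A1 (b j) + B z (b j)).
      apply/matrixP => i j; rewrite !mxE beD beZ; congr (_ + _).
      by rewrite -(mxJ _ _ hJ) /D0 Pb.
    by rewrite g2E /expn0; ring.
  apply/funext => z; rewrite [(- z) ^+ _]exprNn.
  (* The signs from [det2_expansion] and from striking combine to that of [(- z) ^+ (n0 - nu J)],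
     because [(-1) ^+ nu J] occurs twice. *)
  have -> : (-1) ^+ n0 = (-1) ^+ (n0 - nu J) * (-1) ^+ nu J :> R[i].
    by rewrite -exprD subnK.
  have nn : (-1) ^+ nu J * (-1) ^+ nu J = 1 :> R[i] by rewrite -signr_odd; case: (odd _); rewrite ?expr0 ?mulr1 // expr1 mulrNN mulr1.
  move: nn; move: ((-1) ^+ nu J) ((-1) ^+ (n0 - nu J)) => s t nn.
  transitivity (detQ * expn0 * \det (struck J X1) * (t * z ^+ (n0 - nu J)) * (s * s)); first by ring.
  by rewrite nn mulr1.
move=> n01; subst n0.
(* In dimension 1 the trace [n0 = 1] from [trace_riesz] is the only matrix entry of [A0] on the
   range, so semisimplicity is automatic. *)
have D00 x : D0 x = 0.
  have [_ _ _ Pbe0 _] := hbe0.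
  have tr := trace_riesz Hdot A0_hs r_isolating P0_riesz hb0 hbe0.
  rewrite big_ord1 in tr.
  have Pb : P0 (b0 ord0) = b0 ord0 by have [y _ <-] := basis_vec ord0 hb0; rewrite PP.
  have Ab : A0 (b0 ord0) = b0 ord0.
    by rewrite -[in LHS]Pb -PA Pbe0 big_ord1 tr scale1r.
  by rewrite /D0 Pbe0 big_ord1 (linZ _ _ lA0) Ab subrr.
exact: (part3 D00).2.
Qed.
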